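(* Let $X$ be a Banach space and let $A_1,A_2,A_3$ be positive operators in $X$ with the same domain $X^1$. Assume that, for any pairwise distinct $i,j,k\in\{1,2,3\}$, the operator $A_i-A_j$ is invertible and commutes with the resolvent of $A_k$. Let $$\Lambda_3=\begin{pmatrix}A_1&0&0\\ 0&A_2&0\\ I&0&A_3\end{pmatrix},\qquad D(\Lambda_3)=X^1\times X^1\times X^1\subset X\times X\times X.$$ Then the fractional powers of $\Lambda_3$ can be calculated explicitly: for all $\alpha\in(0,1)$, $$\Lambda_3^{-\alpha}=\begin{pmatrix}A_1^{-\alpha}&0&0\\ 0&A_2^{-\alpha}&0\\ (A_1-A_3)^{-1}(A_1^{-\alpha}-A_3^{-\alpha})&0&A_3^{-\alpha}\end{pmatrix}\in\mathcal L(X\times X\times X),$$ and $$\Lambda_3^{\alpha}=\begin{pmatrix}A_1^{\alpha}&0&0\\ 0&A_2^{\alpha}&0\\ (A_1-A_3)^{-1}(A_1^{\alpha}-A_3^{\alpha})&0&A_3^{\alpha}\end{pmatrix},\qquad\text{with } D(\Lambda_3^{\alpha})=X^{\alpha}\times X^{\alpha}\times X^{\alpha},$$ where $X^\alpha$ denotes the domain of the $\alpha$-th power of $A_i$, the same symbol being used for $i=1,2,3$ (just as $X^1$ is the domain of each $A_i$).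
   Context: A closed densely defined operator $A:D(A)\subset X\to X$ on a Banach space $X$ is called positive if there is $M\ge 1$ such that $[0,\infty)\subset\rho(-A)$ and $(1+s)\|(s+A)^{-1}\|_{\mathcal L(X)}\le M$ for every positive real $s$. Fractional powers of a positive operator $A$: for $\alpha>0$, $A^{-\alpha}:=\frac{1}{2\pi i}\int_\Gamma(-\lambda)^{-\alpha}(\lambda+A)^{-1}\,d\lambda\in\mathcal L(X)$ (principal branch), where $\Gamma$ is a contour from $\infty e^{-i\psi}$ to $\infty e^{i\psi}$ lying in $(\{|\arg z|\le\psi\}\cup B(0,r_0))\setminus[0,\infty)$, with $0<\psi<\arcsin(\frac1{2M})$ and $0<r_0<\frac1{2M}$. For $\alpha\in(0,1)$ this equals $\frac{\sin(\pi\alpha)}{\pi}\int_0^\infty s^{-\alpha}(s+A)^{-1}ds$. The operator $A^{-\alpha}$ is injective, and $A^{\alpha}:=(A^{-\alpha})^{-1}$ with domain $D(A^\alpha)=R(A^{-\alpha})$ (the range); this domain, with the graph norm, is denoted $X^\alpha$. The operator $A_i-A_j$ is considered on $D(A_i)\cap D(A_j)=X^1$. The resolvent of $A_k$ is the family $(\lambda+A_k)^{-1}$, $\lambda\in\rho(-A_k)$. Under the stated hypotheses $\Lambda_3$ is a positive operator on $X\times X\times X$, and its fractional powers are those of a positive operator on that space.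
   Formalization: The domains of the A_i^α need not coincide under the hypotheses; the formula for Λ_3^α with domain X^α×X^α×X^α is proved assuming they do. Without this, the domain is the product of the D(A_i^α) and Λ_3^α extends the matrix. *)

(* Defs.v *)
From Stdlib Require Import Reals ClassicalEpsilon.
From Coquelicot Require Import Coquelicot.
Open Scope R_scope.

(* A possibly unbounded operator is its graph: [T x y] reads "x is in D(T) and
   T x = y".  Sums, products and inverses carry their natural domains. *)
Definition operator (X : NormedModule C_AbsRing) : Type := X -> X -> Prop.

Section Operators.
Context {X : NormedModule C_AbsRing}.
Implicit Types S T : operator X.

Definition op_dom T (x : X) : Prop := exists y, T x y.

Definition op_incl S T : Prop := forall x y, S x y -> T x y.
Definition op_eq S T : Prop := forall x y, S x y <-> T x y.

Definition op_zero : operator X := fun _ y => y = zero.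
Definition op_scalar (l : C) : operator X := fun x y => y = scal l x.
Definition op_id : operator X := op_scalar 1.
Definition op_opp T : operator X := fun x z => exists y, T x y /\ z = opp y.
Definition op_add S T : operator X :=
  fun x z => exists y1 y2, S x y1 /\ T x y2 /\ z = plus y1 y2.
Definition op_sub S T : operator X := op_add S (op_opp T).
Definition op_comp S T : operator X := fun x z => exists y, T x y /\ S y z.
Definition op_inv T : operator X := fun y x => T x y.

(* The value T x; arbitrary when x is not in D(T). *)
Definition op_app T (x : X) : X := epsilon (inhabits zero) (T x).

Definition linear_operator T : Prop :=
  T zero zero
  /\ (forall x x' y y', T x y -> T x' y' -> T (plus x x') (plus y y'))
  /\ (forall (l : C) x y, T x y -> T (scal l x) (scal l y))
  /\ (forall x y y', T x y -> T x y' -> y = y').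

Definition closed_operator T : Prop :=
  closed (fun p : X * X => T (fst p) (snd p)).

Definition densely_defined T : Prop :=
  forall (x : X) (eps : posreal), exists y, op_dom T y /\ ball x eps y.

(* T belongs to L(X). *)
Definition bounded_operator T : Prop :=
  linear_operator T
  /\ (forall x, op_dom T x)
  /\ exists K : R, forall x y, T x y -> norm y <= K * norm x.

Definition invertible T : Prop := bounded_operator (op_inv T).

Definition resolvent_set T (l : C) : Prop :=
  invertible (op_sub (op_scalar l) T).

(* (l + T)^{-1}, the resolvent of -T. *)
Definition resolvent T (l : C) : operator X :=
  op_inv (op_add (op_scalar l) T).

(* B R extends R B, the usual meaning of "B commutes with R" for an unbounded
   B and a bounded R. *)
Definition commutes_with_resolvent B T : Prop :=
  forall l : C, resolvent_set (op_opp T) l ->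
    op_incl (op_comp (resolvent T l) B) (op_comp B (resolvent T l)).

Definition positivity_constant T (M : R) : Prop :=
  1 <= M
  /\ (forall s : R, 0 <= s -> resolvent_set (op_opp T) s)
  /\ (forall s : R, 0 < s -> forall x y, resolvent T s x y ->
        (1 + s) * norm y <= M * norm x).

Definition positive_operator T : Prop :=
  linear_operator T /\ closed_operator T /\ densely_defined T
  /\ exists M, positivity_constant T M.

End Operators.

(* Principal argument, in (-PI, PI], for z <> 0. *)
Definition Carg (z : C) : R :=
  if Rlt_dec (Im z) 0 then - acos (Re z / Cmod z) else acos (Re z / Cmod z).

Definition Ccis (t : R) : C := (cos t, sin t).

(* z^a for z <> 0 and a real exponent a. *)
Definition Cpower (z : C) (a : R) : C :=
  Cmult (RtoC (Rpower (Cmod z) a)) (Ccis (a * Carg z)).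

(* Same group, uniform structure and norm; only the scalars change, so that
   Coquelicot's Riemann integral applies to functions with values in X. *)
Section RestrictScalars.
Variable X : NormedModule C_AbsRing.

Definition rscal (a : R) (x : X) : X := scal (RtoC a) x.

Lemma rscal_assoc (x y : R) (u : X) :
  rscal x (rscal y u) = rscal (mult x y) u.
Proof.
  unfold rscal. rewrite scal_assoc. f_equal. symmetry. apply RtoC_mult.
Qed.

Lemma rscal_one (u : X) : rscal one u = u.
Proof. exact (scal_one u). Qed.

Lemma rscal_distr_l (x : R) (u v : X) :
  rscal x (plus u v) = plus (rscal x u) (rscal x v).
Proof. exact (scal_distr_l (RtoC x) u v). Qed.

Lemma rscal_distr_r (x y : R) (u : X) :
  rscal (plus x y) u = plus (rscal x u) (rscal y u).
Proof.
  unfold rscal. rewrite RtoC_plus. exact (scal_distr_r (RtoC x) (RtoC y) u).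
Qed.

Definition restrict_ModuleSpace_mixin :=
  ModuleSpace.Mixin R_Ring (NormedModule.AbelianGroup C_AbsRing X)
    rscal rscal_assoc rscal_one rscal_distr_l rscal_distr_r.

Definition restrict_NormedModuleAux : NormedModuleAux R_AbsRing :=
  NormedModuleAux.Pack R_AbsRing X
    (NormedModuleAux.Class R_AbsRing X
      (ModuleSpace.Class R_Ring X
        (AbelianGroup.class (NormedModule.AbelianGroup C_AbsRing X))
        restrict_ModuleSpace_mixin)
      (UniformSpace.class (NormedModule.UniformSpace C_AbsRing X))) X.

Lemma norm_rscal (l : R) (x : X) : norm (rscal l x) <= abs l * norm x.
Proof.
  apply (Rle_trans _ (Cmod (RtoC l) * norm x)).
  - exact (@norm_scal C_AbsRing X (RtoC l) x).
  - rewrite Cmod_R. apply Rle_refl.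
Qed.

Definition restrict_NormedModule_mixin :=
  NormedModule.Mixin R_AbsRing restrict_NormedModuleAux
    (@norm C_AbsRing X) (@norm_factor C_AbsRing X)
    norm_triangle norm_rscal norm_compat1 norm_compat2 norm_eq_zero.

Definition restrict_scalars : NormedModule R_AbsRing :=
  NormedModule.Pack R_AbsRing X
    (NormedModule.Class R_AbsRing X
      (NormedModuleAux.class R_AbsRing restrict_NormedModuleAux)
      restrict_NormedModule_mixin) X.

End RestrictScalars.

(* ({|arg z| <= psi} U B(0,r0)) \ [0,oo) *)
Definition contour_region (psi r0 : R) (z : C) : Prop :=
  (Rabs (Carg z) <= psi \/ Cmod z < r0) /\ ~ (Im z = 0 /\ 0 <= Re z).

(* g is a C^1 path (derivative dg) in the region above, from oo e^{-i psi} to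
   oo e^{i psi}.  The velocity may vanish, so contours with corners are
   included after reparametrization. *)
Definition contour (psi r0 : R) (g dg : R -> C) : Prop :=
  (forall t : R, is_derive (K := R_AbsRing) (V := C_R_NormedModule) g t (dg t))
  /\ (forall t : R, continuous dg t)
  /\ (forall t : R, contour_region psi r0 (g t))
  /\ filterlim (fun t => Cmod (g t)) (Rbar_locally m_infty) (Rbar_locally p_infty)
  /\ filterlim (fun t => Cmod (g t)) (Rbar_locally p_infty) (Rbar_locally p_infty)
  /\ filterlim (fun t => Cdiv (g t) (RtoC (Cmod (g t))))
       (Rbar_locally m_infty) (locally (Ccis (- psi)))
  /\ filterlim (fun t => Cdiv (g t) (RtoC (Cmod (g t))))
       (Rbar_locally p_infty) (locally (Ccis psi)).

Section FractionalPowers.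
Context {X : NormedModule C_AbsRing}.

Definition is_contour_integral (g dg : R -> C) (f : C -> X) (v : X) : Prop :=
  is_RInt_gen (V := restrict_scalars X) (fun t : R => scal (dg t) (f (g t)))
    (Rbar_locally m_infty) (Rbar_locally p_infty) v.

(* T^{-a}: y is the value of the defining integral for every admissible choice
   of M, psi, r0 and of the contour. *)
Definition neg_power (T : operator X) (a : R) : operator X :=
  fun x y =>
    positive_operator T
    /\ forall (M psi r0 : R) (g dg : R -> C),
         positivity_constant T M ->
         0 < psi < asin (1 / (2 * M)) ->
         0 < r0 < 1 / (2 * M) ->
         contour psi r0 g dg ->
         exists v : X,
           is_contour_integral g dg
             (fun l => scal (Cpower (Copp l) (- a)) (op_app (resolvent T l) x)) v
           /\ y = scal (Cinv (Cmult (RtoC (2 * PI)) Ci)) v.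

(* T^a = (T^{-a})^{-1}, with domain the range of T^{-a}. *)
Definition frac_power (T : operator X) (a : R) : operator X :=
  op_inv (neg_power T a).

End FractionalPowers.

Definition cube (X : NormedModule C_AbsRing) : NormedModule C_AbsRing :=
  prod_NormedModule C_AbsRing (prod_NormedModule C_AbsRing X X) X.

Section Matrices.
Context {X : NormedModule C_AbsRing}.

Definition op_row (T1 T2 T3 : operator X) (x1 x2 x3 y : X) : Prop :=
  exists z1 z2 z3, T1 x1 z1 /\ T2 x2 z2 /\ T3 x3 z3
                   /\ y = plus (plus z1 z2) z3.

(* x = (x1, x2, x3) is in the domain when each xj is in the domain of every
   entry of column j. *)
Definition op_matrix (T11 T12 T13 T21 T22 T23 T31 T32 T33 : operator X) :
    operator (cube X) :=
  fun x y =>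
    let '(x1, x2, x3) := x in
    let '(y1, y2, y3) := y in
    op_row T11 T12 T13 x1 x2 x3 y1
    /\ op_row T21 T22 T23 x1 x2 x3 y2
    /\ op_row T31 T32 T33 x1 x2 x3 y3.

End Matrices.

Inductive index3 : Type := one3 | two3 | three3.

(* The natural domain of this matrix is D(A_1) x D(A_2) x D(A_3), since
   op_zero and op_id are everywhere defined. *)
Definition Lambda3 {X : NormedModule C_AbsRing} (A : index3 -> operator X) :
    operator (cube X) :=
  op_matrix (A one3) op_zero    op_zero
            op_zero  (A two3)   op_zero
            op_id    op_zero    (A three3).

(* Main.v *)
Require Import Defs.
From Stdlib Require Import Reals Lra Psatz List ClassicalEpsilon.
From Stdlib Require Import FunctionalExtensionality PropExtensionality.
From Coquelicot Require Import Coquelicot.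
Open Scope R_scope.

(* The crux is that the resolvents R1 and R3 of A1 and A3 commute.  Since A2 - A3 commutes
   with R1, the commutators of R1 with A2 and A3 agree; they are the limits of
   s^2 [R1, (s + A2)^-1] and s^2 [R1, (s + A3)^-1] as s -> oo, and expanding these with the
   other two hypotheses shows that they are also opposite, hence zero.  Then (A1 - A3)^-1
   commutes with R1 and R3, and the lower left entry of the resolvent of Lambda3 is
   - R3 R1 = (A1 - A3)^-1 (R1 - R3).

   For a resolvent family R, let H(l) x be the integral of s^-alpha R(s l) x over [0, 1].
   Then (1 - alpha) H + l H' = R, so - (-l)^(1 - alpha) H(l) x is a primitive of
   (-l)^-alpha R(l) x.  Every admissible contour therefore gives 2 i sin(pi alpha) times the
   integral I_alpha of s^-alpha R(s) over (0, oo), and the formula for the negative power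
   follows entry by entry.

   For the positive power one needs that A^-alpha is injective and that its range contains
   D(A).  Both follow from I_alpha I_(1 - alpha) = k A^-1 with k <> 0: the truncation of the
   left-hand side at N differs, by a Frullani integral tending to 0, from the same expression
   for the scalar family 1 / (1 + l) times A^-1.  Now if u = A1^-alpha f = A3^-alpha f3, then
   (A1 - A3)^-1 (A1^-alpha f - A3^-alpha f) = - A3^-alpha (A1 - A3)^-1 (f - f3). *)

(** * Linear identities in complex modules *)

(** The definition of a negative power quantifies over all admissible contours. So every contour
    must give the same value, and at least one contour must exist, since otherwise the quantifier
    would be vacuous. The explicit primitive replaces Cauchy's theorem in the first task. It only
    asks the region to be star-shaped about 0, because H(l) evaluates R on the segment from 0 to l.

    The exponents alpha and 1 - alpha are paired because they add up to 1: the powers of r then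
    cancel in the derivative of the product of the two truncated integrals, which leaves R(r)
    (H_alpha(r) + H_(1 - alpha)(r)). Writing H out gives integrals of R(a) R(r a) in a, and the
    resolvent identity turns each of them into a Frullani integral. Its value is A^-1 times a
    coefficient that depends on r alone, hence the same for every resolvent family. Subtracting the
    scalar family removes this coefficient without computing it, and k is the scalar double integral
    itself. It is never evaluated; it is nonzero because its integrands are positive. *)

Inductive lin_expr : Type :=
| LAtom : nat -> lin_expr
| LZero : lin_expr
| LPlus : lin_expr -> lin_expr -> lin_expr
| LOpp : lin_expr -> lin_expr
| LScal : C -> lin_expr -> lin_expr.

Section LinExpr.
Context {V : ModuleSpace C_Ring}.

Fixpoint lin_eval (env : list V) (e : lin_expr) : V :=
  match e with
  | LAtom n => nth n env zero
  | LZero => zero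
  | LPlus e1 e2 => plus (lin_eval env e1) (lin_eval env e2)
  | LOpp e1 => opp (lin_eval env e1)
  | LScal c e1 => scal c (lin_eval env e1)
  end.

Fixpoint lin_coef (e : lin_expr) (n : nat) : C :=
  match e with
  | LAtom m => if Nat.eqb m n then RtoC 1 else RtoC 0
  | LZero => RtoC 0
  | LPlus e1 e2 => Cplus (lin_coef e1 n) (lin_coef e2 n)
  | LOpp e1 => Copp (lin_coef e1 n)
  | LScal c e1 => Cmult c (lin_coef e1 n)
  end.

Fixpoint lin_sum (env : list V) (c : nat -> C) : V :=
  match env with
  | nil => zero
  | v :: env' => plus (scal (c O) v) (lin_sum env' (fun n => c (S n)))
  end.

Lemma lin_sum_ext env (c d : nat -> C) :
  (forall n, (n < length env)%nat -> c n = d n) -> lin_sum env c = lin_sum env d.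
Proof.
  revert c d; induction env as [|v env IH]; intros c d H; simpl; [easy|].
  rewrite (H O) by (simpl; lia).
  f_equal. apply IH. intros n Hn. apply H. simpl; lia.
Qed.

Lemma lin_sum_zero env : lin_sum env (fun _ => RtoC 0) = zero.
Proof.
  induction env as [|v env IH]; simpl; [easy|].
  rewrite IH. rewrite plus_zero_r. exact (scal_zero_l (K := C_Ring) v).
Qed.

Lemma lin_sum_plus env c d :
  lin_sum env (fun n => Cplus (c n) (d n)) = plus (lin_sum env c) (lin_sum env d).
Proof.
  revert c d; induction env as [|v env IH]; intros c d; simpl.
  - now rewrite plus_zero_l.
  - rewrite (IH (fun n => c (S n)) (fun n => d (S n))).
    rewrite (scal_distr_r (K := C_Ring) (c O) (d O) v : scal (Cplus (c O) (d O)) v = _).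
    rewrite <- !plus_assoc. f_equal.
    rewrite !plus_assoc. f_equal. apply plus_comm.
Qed.

Lemma lin_sum_scal env k c :
  lin_sum env (fun n => Cmult k (c n)) = scal k (lin_sum env c).
Proof.
  revert c; induction env as [|v env IH]; intros c; simpl.
  - now rewrite scal_zero_r.
  - rewrite (IH (fun n => c (S n))), scal_distr_l, scal_assoc. reflexivity.
Qed.

Lemma lin_sum_atom env m :
  lin_sum env (fun n => if Nat.eqb m n then RtoC 1 else RtoC 0) = nth m env zero.
Proof.
  revert m; induction env as [|v env IH]; intros [|m]; simpl; try easy.
  - rewrite (lin_sum_zero env), plus_zero_r. exact (scal_one (K := C_Ring) v).
  - rewrite IH. rewrite (scal_zero_l (K := C_Ring) v : scal (RtoC 0) v = zero).
    apply plus_zero_l.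
Qed.

Lemma lin_eval_sum env e : lin_eval env e = lin_sum env (lin_coef e).
Proof.
  induction e as [m| |e1 IH1 e2 IH2|e1 IH1|c e1 IH1]; simpl.
  - now rewrite lin_sum_atom.
  - now rewrite lin_sum_zero.
  - now rewrite lin_sum_plus, IH1, IH2.
  - rewrite IH1, <- (scal_opp_one (K := C_Ring)), <- lin_sum_scal.
    apply lin_sum_ext; intros n _. change (@opp C_Ring one) with (Copp (RtoC 1)). ring.
  - now rewrite lin_sum_scal, IH1.
Qed.

(** Reflection principle behind [lin_ring]. Agreement of the coefficients is sufficient even when
    the atoms are dependent, and indices beyond [env] do not count because [nth] returns [zero]
    there. *)
Lemma lin_eval_eq env e1 e2 :
  (forall n, (n < length env)%nat -> lin_coef e1 n = lin_coef e2 n) ->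
  lin_eval env e1 = lin_eval env e2.
Proof. intros H. rewrite !lin_eval_sum. now apply lin_sum_ext. Qed.

End LinExpr.

Ltac lin_index a env :=
  lazymatch env with
  | a :: _ => constr:(O)
  | _ :: ?env' => let n := lin_index a env' in constr:(S n)
  end.
Ltac lin_add a env :=
  lazymatch env with
  | context [a :: _] => env
  | _ => constr:(a :: env)
  end.
Ltac lin_atoms e env :=
  lazymatch e with
  | @plus _ ?a ?b => let env1 := lin_atoms a env in lin_atoms b env1
  | @minus _ ?a ?b => let env1 := lin_atoms a env in lin_atoms b env1
  | @opp _ ?a => lin_atoms a env
  | @scal _ _ _ ?a => lin_atoms a env
  | @zero _ => env
  | _ => lin_add e env
  end.
Ltac lin_reify e env :=
  lazymatch e with
  | @plus _ ?a ?b => let x := lin_reify a env in let y := lin_reify b env in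
                     constr:(LPlus x y)
  | @minus _ ?a ?b => let x := lin_reify a env in let y := lin_reify b env in
                      constr:(LPlus x (LOpp y))
  | @opp _ ?a => let x := lin_reify a env in constr:(LOpp x)
  | @scal _ _ ?c ?a => let x := lin_reify a env in constr:(LScal c x)
  | @zero _ => constr:(LZero)
  | _ => let n := lin_index e env in constr:(LAtom n)
  end.
(** Enumerates the atoms: each [destruct] peels one index off [n], until [lia] refutes the bound by
    the length of the environment. *)
Ltac lin_cases n Hn tac :=
  tryif (exfalso; clear - Hn; lia) then idtac
  else (destruct n as [|n];
        [clear Hn; cbn [lin_coef Nat.eqb]; tac | lin_cases n Hn tac]).
(* Reduces an equation between linear combinations in a complex module [V] to
   one equation in [C] for each atom. *)
Ltac lin_eq_in V tac :=
  lazymatch goal with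
  | |- @eq _ ?l ?r =>
    let env0 := lin_atoms l (@nil (NormedModule.sort C_AbsRing V)) in
    let env := lin_atoms r env0 in
    let el := lin_reify l env in
    let er := lin_reify r env in
    change (@lin_eval (NormedModule.ModuleSpace C_AbsRing V) env el
            = @lin_eval (NormedModule.ModuleSpace C_AbsRing V) env er);
    apply lin_eval_eq;
    let n := fresh "n" in let Hn := fresh "Hn" in
    intros n Hn; cbn [length] in Hn;
    lin_cases n Hn tac
  end.
Ltac c_norm := do 2 rewrite ?RtoC_mult, ?RtoC_plus, ?RtoC_minus, ?RtoC_opp.
Ltac lin_ring V := lin_eq_in V ltac:(c_norm; ring).

(** * Limits and derivatives in norm form *)

Section NormLemmas.
Context {V : NormedModule C_AbsRing}.
Implicit Types x y z : V.

Lemma norm_scalC (c : C) x : norm (scal c x) <= Cmod c * norm x.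
Proof. exact (@norm_scal C_AbsRing V c x). Qed.

Lemma norm_scalR (r : R) x : norm (scal (RtoC r) x) <= Rabs r * norm x.
Proof. rewrite <- Cmod_R. apply norm_scalC. Qed.

Lemma norm_minus_sym x y : norm (minus x y) = norm (minus y x).
Proof.
  rewrite <- (norm_opp (minus x y)). f_equal. lin_ring V.
Qed.

Lemma norm_minus_triangle x y z : norm (minus x z) <= norm (minus x y) + norm (minus y z).
Proof.
  replace (minus x z) with (plus (minus x y) (minus y z)) by lin_ring V.
  apply norm_triangle.
Qed.

Lemma norm_plus_le x y : norm (plus x y) <= norm x + norm y.
Proof. apply norm_triangle. Qed.

Lemma norm_minus_le x y : norm (minus x y) <= norm x + norm y.
Proof.
  unfold minus.  apply Rle_trans with (1 := norm_plus_le _ _). rewrite norm_opp. lra.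
Qed.

Lemma minus_eq x y : minus x y = zero -> x = y.
Proof.
  intros H. replace x with (plus (minus x y) y) by lin_ring V.
  rewrite H. apply plus_zero_l.
Qed.

Lemma norm_small_eq x y : (forall eps, 0 < eps -> norm (minus x y) <= eps) -> x = y.
Proof.
  intros H. apply minus_eq, norm_eq_zero.
  apply Rle_antisym; [|apply norm_ge_0].
  apply Rnot_lt_le; intros H0.
  specialize (H (norm (minus x y) / 2)). lra.
Qed.

End NormLemmas.

(** Norm form of convergence. The balls of a [NormedModule] are comparable with norm balls only up
    to [norm_factor], and this form keeps that factor out of the estimates. *)
Definition tends {T : Type} {V : NormedModule C_AbsRing}
    (F : (T -> Prop) -> Prop) (f : T -> V) (l : V) : Prop :=
  forall eps, 0 < eps -> F (fun t => norm (minus (f t) l) < eps).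

Section Tends.
Context {T : Type} {F : (T -> Prop) -> Prop} {FF : Filter F}.
Context {V W : NormedModule C_AbsRing}.

Lemma tends_filterlim (f : T -> V) l : tends F f l <-> filterlim f F (locally l).
Proof.
  split.
  - intros H P [eps HP]. unfold filtermap.
    apply filter_imp with (2 := H eps (cond_pos eps)).
    intros t Ht. apply HP. now apply norm_compat1.
  - intros H eps Heps.
    apply (H (fun y => norm (minus y l) < eps)).
    apply locally_le_locally_norm.
    exists (mkposreal eps Heps). intros y Hy. exact Hy.
Qed.

Lemma tends_const (l : V) : tends F (fun _ => l) l.
Proof.
  intros eps Heps. apply filter_forall. intros t.
  replace (minus l l) with (@zero V) by lin_ring V. now rewrite norm_zero.
Qed.

Lemma tends_plus (f g : T -> V) a b :
  tends F f a -> tends F g b -> tends F (fun t => plus (f t) (g t)) (plus a b).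
Proof.
  intros Hf Hg eps Heps.
  assert (H2 : 0 < eps / 2) by lra.
  apply filter_imp with (2 := filter_and _ _ (Hf _ H2) (Hg _ H2)).
  intros t [H1 H3].
  replace (minus _ _) with (plus (minus (f t) a) (minus (g t) b)) by lin_ring V.
  apply Rle_lt_trans with (1 := norm_plus_le (V := V) _ _). lra.
Qed.

Lemma tends_le (f : T -> V) (g : T -> R) l :
  F (fun t => norm (minus (f t) l) <= g t) ->
  (forall eps, 0 < eps -> F (fun t => g t < eps)) -> tends F f l.
Proof.
  intros H1 H2 eps Heps.
  apply filter_imp with (2 := filter_and _ _ H1 (H2 _ Heps)). intros t [H3 H4]. lra.
Qed.

Lemma tends_ext (f g : T -> V) l :
  F (fun t => f t = g t) -> tends F f l -> tends F g l.
Proof.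
  intros H1 H2 eps Heps.
  apply filter_imp with (2 := filter_and _ _ H1 (H2 _ Heps)). intros t [H3 H4].
  now rewrite <- H3.
Qed.

Lemma tends_ext_all (f g : T -> V) l :
  (forall t, f t = g t) -> tends F f l -> tends F g l.
Proof. intros H. apply tends_ext. now apply filter_forall. Qed.

Lemma tends_bounded (f : T -> V) l :
  tends F f l -> F (fun t => norm (f t) <= norm l + 1).
Proof.
  intros H. apply filter_imp with (2 := H 1 Rlt_0_1). intros t Ht.
  replace (f t) with (plus (minus (f t) l) l) by lin_ring V.
  apply Rle_trans with (1 := norm_plus_le (V := V) _ _). lra.
Qed.

(** Strongly convergent, uniformly bounded operators applied to a convergent argument: L_t f_t - b =
    L_t (f_t - a) + (L_t a - b). Linearity and the bound are asked along the filter only, because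
    resolvents are linear only inside their region. *)
Lemma tends_apply (L : T -> V -> W) (K : R) (f : T -> V) a b :
  F (fun t => forall x y, L t (minus x y) = minus (L t x) (L t y)) ->
  F (fun t => forall x, norm (L t x) <= K * norm x) ->
  tends F (fun t => L t a) b -> tends F f a -> tends F (fun t => L t (f t)) b.
Proof.
  intros Hl HK HL Hf eps Heps.
  assert (HK1 : 0 < Rabs K + 1) by (pose proof (Rabs_pos K); lra).
  assert (H2 : 0 < eps / 2) by lra.
  assert (H3 : 0 < eps / 2 / (Rabs K + 1)) by now apply Rdiv_lt_0_compat.
  pose proof (filter_and _ _ (filter_and _ _ Hl HK) (filter_and _ _ (HL _ H2) (Hf _ H3))) as H.
  apply filter_imp with (2 := H). intros t [[Hlt HKt] [HLt Hft]].
  replace (minus _ _) with (plus (L t (minus (f t) a)) (minus (L t a) b))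
    by (rewrite Hlt; lin_ring W).
  apply Rle_lt_trans with (1 := norm_plus_le (V := W) _ _).
  specialize (HKt (minus (f t) a)).
  assert (E : (Rabs K + 1) * (eps / 2 / (Rabs K + 1)) = eps / 2) by (field; lra).
  pose proof (norm_ge_0 (minus (f t) a)). pose proof (Rle_abs K). nra.
Qed.

Lemma tends_unique `{HF : ProperFilter' T F} (f : T -> V) a b :
  tends F f a -> tends F f b -> a = b.
Proof.
  rewrite !tends_filterlim. apply filterlim_locally_unique.
Qed.

End Tends.

Lemma tends_comp {T S : Type} {V : NormedModule C_AbsRing} F G
    (f : T -> V) (g : S -> T) l :
  tends F f l -> filterlim g G F -> tends G (fun s => f (g s)) l.
Proof. intros Hf Hg eps Heps. exact (Hg _ (Hf eps Heps)). Qed.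

Section MoreTends.
Context {T : Type} {F : (T -> Prop) -> Prop} {FF : Filter F}.
Context {V W : NormedModule C_AbsRing}.

Lemma tends_scal (c : T -> C) (f : T -> V) (k : C) l :
  tends (V := C_NormedModule) F c k -> tends F f l ->
  tends F (fun t => scal (c t) (f t)) (scal k l).
Proof.
  intros Hc Hf.
  apply (tends_apply (fun t => scal (c t)) (Cmod k + 1) f l).
  - apply filter_forall. intros t x y. lin_ring V.
  - apply filter_imp with (2 := tends_bounded _ _ Hc). intros t Ht x.
    apply Rle_trans with (1 := norm_scalC _ _).
    apply Rmult_le_compat_r; [apply norm_ge_0|exact Ht].
  - intros eps Heps. pose proof (norm_ge_0 l).
    assert (H3 : 0 < eps / (norm l + 1)) by (apply Rdiv_lt_0_compat; lra).
    apply filter_imp with (2 := Hc _ H3). intros t Ht.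
    change (Cmod (c t - k)%C < eps / (norm l + 1)) in Ht.
    replace (minus _ _) with (scal (c t - k)%C l) by lin_ring V.
    apply Rle_lt_trans with (1 := norm_scalC _ _).
    assert (E : eps / (norm l + 1) * (norm l + 1) = eps) by (field; lra).
    pose proof (Cmod_ge_0 (c t - k)%C). nra.
  - exact Hf.
Qed.

Lemma tends_opp (f : T -> V) l : tends F f l -> tends F (fun t => opp (f t)) (opp l).
Proof.
  intros Hf eps Heps. apply filter_imp with (2 := Hf eps Heps). intros t Ht.
  replace (minus _ _) with (opp (minus (f t) l)) by lin_ring V. now rewrite norm_opp.
Qed.

Lemma tends_minus (f g : T -> V) a b :
  tends F f a -> tends F g b -> tends F (fun t => minus (f t) (g t)) (minus a b).
Proof. intros Hf Hg. apply tends_plus; [exact Hf|now apply tends_opp]. Qed.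

Lemma tends_linear (L : V -> W) (K : R) (f : T -> V) a :
  (forall x y, L (minus x y) = minus (L x) (L y)) ->
  (forall x, norm (L x) <= K * norm x) ->
  tends F f a -> tends F (fun t => L (f t)) (L a).
Proof.
  intros H1 H2 Hf. apply (tends_apply (fun _ => L) K f a); try easy.
  - now apply filter_forall.
  - now apply filter_forall.
  - apply tends_const.
Qed.

Lemma tends_norm_le (f : T -> V) l K :
  ProperFilter' F -> tends F f l -> F (fun t => norm (f t) <= K) -> norm l <= K.
Proof.
  intros HF Hf HK. apply Rnot_lt_le. intros Hlt.
  apply (@filter_not_empty _ F HF).
  apply filter_imp with (2 := filter_and _ _ HK (Hf (norm l - K) ltac:(lra))).
  intros t [H1 H2].
  assert (norm l <= norm (f t) + norm (minus (f t) l)); [|lra].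
  replace l with (minus (f t) (minus (f t) l)) at 1 by lin_ring V.
  apply norm_minus_le.
Qed.

End MoreTends.

Lemma locally_R_intro (t : R) (P : R -> Prop) d :
  0 < d -> (forall s, Rabs (s - t) < d -> P s) -> locally t P.
Proof. intros Hd H. exists (mkposreal d Hd). intros s Hs. apply H. exact Hs. Qed.

Lemma locally_R_elim (t : R) (P : R -> Prop) :
  locally t P -> exists d, 0 < d /\ forall s, Rabs (s - t) < d -> P s.
Proof.
  intros [d Hd]. exists d. split; [apply cond_pos|]. intros s Hs. apply Hd. exact Hs.
Qed.

Lemma locally_self {T : UniformSpace} (t : T) (P : T -> Prop) : locally t P -> P t.
Proof. apply locally_singleton. Qed.

(* Caratheodory's form of the derivative. *)
Definition deriv {V : NormedModule C_AbsRing} (f : R -> V) (t : R) (l : V) : Prop :=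
  exists phi : R -> V,
    (forall s, minus (f s) (f t) = scal (RtoC (s - t)) (phi s))
    /\ tends (locally t) phi l.

(** Continuity on the whole line removes the side conditions from integrability. Integrands that
    make sense only on an interval are extended by clamping, as in [pow01], or through [Rabs]. *)
Definition cts {V : NormedModule C_AbsRing} (f : R -> V) : Prop :=
  forall t, tends (locally t) f (f t).

Lemma tends_self {V : NormedModule C_AbsRing} (f : R -> V) t l :
  tends (locally t) f l -> f t = l.
Proof.
  intros H. apply norm_small_eq. intros eps Heps. apply Rlt_le.
  exact (locally_self _ _ (H eps Heps)).
Qed.

Lemma tends_RtoC {T : Type} (F : (T -> Prop) -> Prop) (f : T -> R) (l : R) :
  (forall eps, 0 < eps -> F (fun t => Rabs (f t - l) < eps)) -> Filter F ->
  tends (V := C_NormedModule) F (fun t => RtoC (f t)) (RtoC l).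
Proof.
  intros H FF eps Heps. apply filter_imp with (2 := H eps Heps). intros t Ht.
  change (Cmod (RtoC (f t) - RtoC l) < eps)%C. rewrite <- RtoC_minus, Cmod_R. exact Ht.
Qed.

Lemma tends_RtoC_id (t : R) : tends (V := C_NormedModule) (locally t) RtoC (RtoC t).
Proof.
  apply tends_RtoC; [|apply locally_filter]. intros eps Heps.
  now apply locally_R_intro with eps.
Qed.

Section Deriv.
Context {V W : NormedModule C_AbsRing}.

Lemma scal_scal_inv (r : R) (x : V) :
  r <> 0 -> scal (RtoC r) (scal (RtoC (/ r)) x) = x.
Proof.
  intros Hr. transitivity (scal (RtoC (r * / r)) x); [lin_ring V|].
  rewrite Rinv_r by exact Hr. lin_ring V.
Qed.

Lemma scal_inv_scal (r : R) (x : V) :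
  r <> 0 -> scal (RtoC (/ r)) (scal (RtoC r) x) = x.
Proof.
  intros Hr. transitivity (scal (RtoC (r * / r)) x); [lin_ring V|].
  rewrite Rinv_r by exact Hr. lin_ring V.
Qed.

Lemma deriv_tends (f : R -> V) t l : deriv f t l -> tends (locally t) f (f t).
Proof.
  intros [phi [H1 H2]].
  apply tends_ext_all with (fun s => plus (f t) (scal (RtoC (s - t)) (phi s))).
  - intros s. rewrite <- H1. lin_ring V.
  - replace (f t) with (plus (f t) (scal (RtoC (t - t)) l)) at 1.
    2:{ rewrite Rminus_diag. lin_ring V. }
    apply tends_plus; [apply tends_const|].
    apply tends_scal; [|exact H2].
    apply tends_RtoC; [|apply locally_filter].
    intros eps Heps. apply locally_R_intro with (1 := Heps). intros s Hs.
    now replace (s - t - (t - t)) with (s - t) by ring.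
Qed.

Lemma deriv_plus (f g : R -> V) t a b :
  deriv f t a -> deriv g t b -> deriv (fun s => plus (f s) (g s)) t (plus a b).
Proof.
  intros [p [H1 H2]] [q [H3 H4]].
  exists (fun s => plus (p s) (q s)). split; [|now apply tends_plus].
  intros s.
  replace (scal _ (plus (p s) (q s)))
    with (plus (scal (RtoC (s - t)) (p s)) (scal (RtoC (s - t)) (q s))) by lin_ring V.
  rewrite <- H1, <- H3. lin_ring V.
Qed.

Lemma deriv_linear (L : V -> W) K (f : R -> V) t a :
  (forall x y, L (minus x y) = minus (L x) (L y)) ->
  (forall (c : C) x, L (scal c x) = scal c (L x)) ->
  (forall x, norm (L x) <= K * norm x) ->
  deriv f t a -> deriv (fun s => L (f s)) t (L a).
Proof.
  intros H1 H2 H3 [p [H4 H5]]. exists (fun s => L (p s)). split.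
  - intros s. now rewrite <- H1, H4, H2.
  - now apply tends_linear with K.
Qed.

Lemma deriv_eq (f : R -> V) t l l' : deriv f t l -> l = l' -> deriv f t l'.
Proof. now intros H <-. Qed.

Lemma deriv_minus (f g : R -> V) t a b :
  deriv f t a -> deriv g t b -> deriv (fun s => minus (f s) (g s)) t (minus a b).
Proof.
  intros [p [H1 H2]] [q [H3 H4]].
  exists (fun s => minus (p s) (q s)). split; [|now apply tends_minus].
  intros s.
  replace (scal _ (minus (p s) (q s)))
    with (minus (scal (RtoC (s - t)) (p s)) (scal (RtoC (s - t)) (q s))) by lin_ring V.
  rewrite <- H1, <- H3. lin_ring V.
Qed.

Lemma deriv_ext_loc (f g : R -> V) t l :
  locally t (fun s => f s = g s) -> deriv f t l -> deriv g t l.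
Proof.
  intros Hfg [p [H1 H2]].
  (* The difference quotient is meaningless at [s = t], so the slope function takes its limit [l]
     there. *)
  exists (fun s => if Req_EM_T s t then l else scal (RtoC (/ (s - t))) (minus (g s) (g t))).
  split.
  - intros s. destruct (Req_EM_T s t) as [->|Hs].
    + rewrite Rminus_diag. lin_ring V.
    + rewrite scal_scal_inv by lra. reflexivity.
  - apply tends_ext with (2 := H2).
    apply filter_imp with (2 := Hfg). intros s Hs.
    destruct (Req_EM_T s t) as [->|Hst].
    + exact (tends_self _ _ _ H2).
    + rewrite <- Hs, <- (locally_self _ _ Hfg), H1, scal_inv_scal by lra. reflexivity.
Qed.

Lemma deriv_scal (c : R -> C) (f : R -> V) t (dc : C) df :
  deriv (V := C_NormedModule) c t dc -> deriv f t df ->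
  deriv (fun s => scal (c s) (f s)) t (plus (scal dc (f t)) (scal (c t) df)).
Proof.
  intros [p [H1 H2]] Hf. pose proof (deriv_tends _ _ _ Hf) as Hft.
  destruct Hf as [q [H3 H4]].
  exists (fun s => plus (scal (p s) (f s)) (scal (c t) (q s))). split.
  - intros s.
    transitivity (plus (scal (minus (c s) (c t)) (f s)) (scal (c t) (minus (f s) (f t)))).
    { unfold minus. change (plus (c s) (opp (c t))) with (c s - c t)%C. lin_ring V. }
    rewrite H1, H3. change (scal (RtoC (s - t)) (p s)) with (RtoC (s - t) * p s)%C.
    lin_ring V.
  - apply tends_plus; [now apply tends_scal|].
    apply tends_scal; [apply tends_const|exact H4].
Qed.

End Deriv.

Section Deriv2.
Context {V : NormedModule C_AbsRing}.

(** Chain rule through a complex variable, for an [f] that is known only along the curve [g]: a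
    remainder quadratic in g(s) - g(t) is O(|s - t|) after division by s - t. *)
Lemma deriv_quadratic (f : R -> V) (g : R -> C) t (dg : C) l K :
  deriv (V := C_NormedModule) g t dg ->
  locally t (fun s => norm (minus (minus (f s) (f t)) (scal (g s - g t)%C l))
                      <= K * Cmod (g s - g t) ^ 2) ->
  deriv f t (scal dg l).
Proof.
  intros Hg HK. pose proof (deriv_tends _ _ _ Hg) as Hgt.
  destruct Hg as [p [H1 H2]].
  exists (fun s => if Req_EM_T s t then scal dg l
                   else scal (RtoC (/ (s - t))) (minus (f s) (f t))).
  split.
  { intros s. destruct (Req_EM_T s t) as [->|Hs].
    + rewrite Rminus_diag. lin_ring V.
    + rewrite scal_scal_inv by lra. reflexivity. }
  assert (H1' : forall s, (g s - g t = RtoC (s - t) * p s)%C) by exact H1.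
  pose proof (tends_bounded _ _ H2) as Hb.
  assert (Hpl : tends (locally t) (fun s => scal (p s) l) (scal dg l)).
  { apply tends_scal; [exact H2|apply tends_const]. }
  (* A bound for the slope of [g] near [t], valid there by [tends_bounded]. *)
  set (B := Cmod dg + 1).
  intros eps Heps.
  assert (HB : 0 < B) by (pose proof (Cmod_ge_0 dg); unfold B; lra).
  pose proof (Rabs_pos K) as HKp.
  assert (He : 0 < eps / 2 / ((Rabs K + 1) * B ^ 2)).
  { repeat apply Rdiv_lt_0_compat; try lra. apply Rmult_lt_0_compat; [lra|].
    now apply pow_lt. }
  assert (He' : 0 < eps / 2) by lra.
  pose proof (filter_and _ _ (filter_and _ _ HK Hb)
    (filter_and _ _ (Hpl (eps / 2) He')
       (locally_R_intro t (fun s => Rabs (s - t) < eps / 2 / ((Rabs K + 1) * B ^ 2))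
           _ He (fun s Hs => Hs)))) as Hall.
  apply filter_imp with (2 := Hall). intros s [[Ha Hc] [Hd He2]].
  destruct (Req_EM_T s t) as [->|Hst].
  { replace (minus _ _) with (@zero V) by lin_ring V. now rewrite norm_zero. }
  set (r := minus (minus (f s) (f t)) (scal (g s - g t)%C l)) in *.
  replace (minus _ _) with
    (plus (scal (RtoC (/ (s - t))) r) (minus (scal (p s) l) (scal dg l))).
  2:{ unfold r. rewrite H1'.
      replace (scal (p s) l) with (scal (RtoC (/ (s - t))) (scal (RtoC (s - t)) (scal (p s) l)))
        by (apply scal_inv_scal; lra).
      lin_ring V. }
  apply Rle_lt_trans with (1 := norm_plus_le (V := V) _ _).
  pose proof (norm_scalR (/ (s - t)) r) as Hr.
  rewrite H1', Cmod_mult, Cmod_R in Ha.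
  change (Cmod (p s) <= B) in Hc.
  assert (Hst0 : 0 < Rabs (s - t)) by (apply Rabs_pos_lt; lra).
  rewrite Rabs_inv in Hr.
  assert (Hr2 : norm (scal (RtoC (/ (s - t))) r) <= Rabs (s - t) * ((Rabs K + 1) * B ^ 2)).
  { apply Rle_trans with (1 := Hr).
    apply Rle_trans with (/ Rabs (s - t) * (K * (Rabs (s - t) * Cmod (p s)) ^ 2)).
    { apply Rmult_le_compat_l; [left; now apply Rinv_0_lt_compat|exact Ha]. }
    replace (/ Rabs (s - t) * (K * (Rabs (s - t) * Cmod (p s)) ^ 2))
      with (Rabs (s - t) * (K * Cmod (p s) ^ 2)) by (field; lra).
    apply Rmult_le_compat_l; [lra|].
    pose proof (Cmod_ge_0 (p s)). pose proof (Rle_abs K).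
    apply Rle_trans with ((Rabs K + 1) * Cmod (p s) ^ 2).
    - apply Rmult_le_compat_r; [apply pow2_ge_0|lra].
    - apply Rmult_le_compat_l; [lra|]. now apply pow_incr. }
  assert (HQ : 0 < (Rabs K + 1) * B ^ 2).
  { apply Rmult_lt_0_compat; [lra|now apply pow_lt]. }
  apply (Rmult_lt_compat_r _ _ _ HQ) in He2.
  replace (eps / 2 / ((Rabs K + 1) * B ^ 2) * ((Rabs K + 1) * B ^ 2)) with (eps / 2) in He2
    by (field; split; lra).
  replace eps with (eps / 2 + eps / 2) by field.
  apply Rplus_lt_compat; [exact (Rle_lt_trans _ _ _ Hr2 He2)|exact Hd].
Qed.

End Deriv2.

(** * Integrals of functions with values in a complex Banach space *)

Lemma continuous_cts {V : NormedModule C_AbsRing} (f : R -> V) t :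
  tends (locally t) f (f t) <-> continuous (U := restrict_scalars V) f t.
Proof.
  rewrite tends_filterlim. reflexivity.
Qed.

Lemma deriv_is_derive {V : NormedModule C_AbsRing} (f : R -> V) t l :
  deriv f t l -> is_derive (K := R_AbsRing) (V := restrict_scalars V) f t l.
Proof.
  intros [p [H1 H2]]. split.
  - apply (@is_linear_scal_l R_AbsRing (restrict_scalars V)).
  - intros x Hx. apply (@is_filter_lim_locally_unique R_AbsRing R_NormedModule) in Hx. subst x.
    intros eps. apply filter_imp with (2 := H2 eps (cond_pos eps)). intros s Hs.
    assert (E : minus (minus (f s) (f t)) (scal (RtoC (s - t)) l)
                = scal (RtoC (s - t)) (minus (p s) l)).
    { rewrite H1. lin_ring V. }
    change (@norm C_AbsRing V (minus (minus (f s) (f t)) (scal (RtoC (s - t)) l))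
            <= eps * Rabs (s - t)).
    rewrite E. apply Rle_trans with (1 := norm_scalR _ _).
    rewrite (Rmult_comm eps). apply Rmult_le_compat_l; [apply Rabs_pos|lra].
Qed.

Lemma deriv_of_remainder {V : NormedModule C_AbsRing} (f : R -> V) t l :
  (forall eps, 0 < eps -> locally t (fun s =>
     norm (minus (minus (f s) (f t)) (scal (RtoC (s - t)) l)) <= eps * Rabs (s - t))) ->
  deriv f t l.
Proof.
  intros H.
  exists (fun s => if Req_EM_T s t then l
                   else scal (RtoC (/ (s - t))) (minus (f s) (f t))).
  split.
  { intros s. destruct (Req_EM_T s t) as [->|Hs].
    + rewrite Rminus_diag. lin_ring V.
    + rewrite scal_scal_inv by lra. reflexivity. }
  intros eps Heps.
  apply filter_imp with (2 := H (eps / 2) ltac:(lra)). intros s Hs.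
  destruct (Req_EM_T s t) as [->|Hst].
  { replace (minus _ _) with (@zero V) by lin_ring V. now rewrite norm_zero. }
  replace (minus _ _) with (scal (RtoC (/ (s - t)))
     (minus (minus (f s) (f t)) (scal (RtoC (s - t)) l))).
  2:{ replace l with (scal (RtoC (/ (s - t))) (scal (RtoC (s - t)) l)) at 2
        by (apply scal_inv_scal; lra). lin_ring V. }
  apply Rle_lt_trans with (1 := norm_scalR _ _).
  rewrite Rabs_inv.
  assert (Hst0 : 0 < Rabs (s - t)) by (apply Rabs_pos_lt; lra).
  apply Rle_lt_trans with (/ Rabs (s - t) * (eps / 2 * Rabs (s - t))).
  - apply Rmult_le_compat_l; [left; now apply Rinv_0_lt_compat|exact Hs].
  - replace (/ Rabs (s - t) * (eps / 2 * Rabs (s - t))) with (eps / 2) by (field; lra). lra.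
Qed.

Lemma is_derive_deriv {V : NormedModule C_AbsRing} (f : R -> V) t l :
  is_derive (K := R_AbsRing) (V := restrict_scalars V) f t l -> deriv f t l.
Proof.
  intros [_ H]. apply deriv_of_remainder. intros eps Heps.
  specialize (H t (fun P HP => HP) (mkposreal eps Heps)).
  apply filter_imp with (2 := H). intros s Hs. exact Hs.
Qed.

Definition restrict_complete (X : CompleteNormedModule C_AbsRing) :
    CompleteNormedModule R_AbsRing :=
  CompleteNormedModule.Pack R_AbsRing X
    (CompleteNormedModule.Class R_AbsRing X
      (NormedModule.class R_AbsRing (restrict_scalars X))
      (CompleteNormedModule.mixin C_AbsRing X (CompleteNormedModule.class C_AbsRing X))) X.

Section Integral.
Context {X : CompleteNormedModule C_AbsRing}.
Implicit Types f g : R -> X.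

Definition integral f (a b : R) : X := RInt (V := restrict_complete X) f a b.

Lemma cts_continuous f t : cts f -> continuous (U := restrict_complete X) f t.
Proof. intros Hf. exact (proj1 (continuous_cts (V := X) f t) (Hf t)). Qed.

Lemma integral_correct f a b :
  cts f -> is_RInt (V := restrict_complete X) f a b (integral f a b).
Proof.
  intros Hf. apply (RInt_correct (V := restrict_complete X)), ex_RInt_continuous.
  intros t _. now apply cts_continuous.
Qed.

Lemma integral_ext f g a b :
  (forall t, Rmin a b < t < Rmax a b -> f t = g t) -> integral f a b = integral g a b.
Proof. intros H. apply (RInt_ext (V := restrict_complete X)), H. Qed.

Lemma integral_unique f a b l :
  is_RInt (V := restrict_complete X) f a b l -> integral f a b = l.
Proof. exact (is_RInt_unique (V := restrict_complete X) f a b l). Qed.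

Lemma integral_plus f g a b : cts f -> cts g ->
  integral (fun t => plus (f t) (g t)) a b = plus (integral f a b) (integral g a b).
Proof.
  intros Hf Hg. apply integral_unique.
  exact (is_RInt_plus _ _ _ _ _ _ (integral_correct f a b Hf) (integral_correct g a b Hg)).
Qed.

Lemma integral_minus f g a b : cts f -> cts g ->
  integral (fun t => minus (f t) (g t)) a b = minus (integral f a b) (integral g a b).
Proof.
  intros Hf Hg. apply integral_unique.
  exact (is_RInt_minus _ _ _ _ _ _ (integral_correct f a b Hf) (integral_correct g a b Hg)).
Qed.

Lemma integral_const (x : X) a b : integral (fun _ => x) a b = scal (RtoC (b - a)) x.
Proof.
  apply integral_unique.
  exact (is_RInt_const (V := restrict_complete X) a b x).
Qed.

Lemma norm_integral_le f (g : R -> R) a b l : a <= b -> cts f ->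
  (forall t, a <= t <= b -> norm (f t) <= g t) -> is_RInt g a b l ->
  norm (integral f a b) <= l.
Proof.
  intros Hab Hf Hg Hl.
  exact (norm_RInt_le (V := restrict_complete X) f g a b _ _ Hab Hg
          (integral_correct f a b Hf) Hl).
Qed.

Lemma norm_integral_le_const f K a b : a <= b -> cts f ->
  (forall t, a <= t <= b -> norm (f t) <= K) -> norm (integral f a b) <= (b - a) * K.
Proof.
  intros Hab Hf HK.
  exact (norm_RInt_le_const (V := restrict_complete X) f a b _ K Hab HK
          (integral_correct f a b Hf)).
Qed.

Lemma integral_Chasles f a b c : cts f ->
  plus (integral f a b) (integral f b c) = integral f a c.
Proof.
  intros Hf. symmetry. apply integral_unique.
  exact (is_RInt_Chasles _ _ _ _ _ _ (integral_correct f a b Hf) (integral_correct f b c Hf)).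
Qed.

Lemma deriv_integral f a t : cts f -> deriv (integral f a) t (f t).
Proof.
  intros Hf. apply is_derive_deriv.
  apply (is_derive_RInt (V := restrict_complete X) f (integral f a) a t).
  - apply filter_forall. intros b. now apply integral_correct.
  - now apply cts_continuous.
Qed.

Lemma integral_deriv f df a b :
  (forall t, Rmin a b <= t <= Rmax a b -> deriv f t (df t)) ->
  (forall t, Rmin a b <= t <= Rmax a b -> tends (locally t) df (df t)) ->
  is_RInt (V := restrict_complete X) df a b (minus (f b) (f a)).
Proof.
  intros H1 H2.
  apply (is_RInt_derive (V := restrict_complete X)).
  - intros t Ht. exact (deriv_is_derive (V := X) _ _ _ (H1 t Ht)).
  - intros t Ht. exact (proj1 (continuous_cts (V := X) df t) (H2 t Ht)).
Qed.

Lemma deriv_zero_eq f a b :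
  (forall t, Rmin a b <= t <= Rmax a b -> deriv f t zero) -> f a = f b.
Proof.
  intros H.
  assert (E : minus (f b) (f a) = zero).
  { rewrite <- (integral_unique (fun _ => zero) a b (minus (f b) (f a))).
    - rewrite integral_const. lin_ring X.
    - apply integral_deriv; [exact H|]. intros t _. apply tends_const. }
  symmetry. now apply minus_eq.
Qed.

(** Version of the fundamental theorem with derivatives on the open interval only; it is needed
    because [pow01] has a corner at 1. The difference of [f] and the integral of [df] has zero
    derivative inside, and continuity carries its constancy to the end points. *)
Lemma integral_deriv_open f df a b : a <= b ->
  (forall t, a < t < b -> deriv f t (df t)) -> cts f -> cts df ->
  integral df a b = minus (f b) (f a).
Proof.
  intros Hab H Hf Hdf.
  destruct (Req_dec a b) as [->|Hne].
  { rewrite (integral_unique df b b zero).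
    - lin_ring X.
    - exact (is_RInt_point (V := restrict_complete X) df b). }
  set (g := (fun t => minus (f t) (integral df a t)) : R -> X).
  assert (Hg : forall t, a < t < b -> deriv g t zero).
  { intros t Ht.
    apply (deriv_eq (V := X)) with (minus (df t) (df t)); [|lin_ring X].
    apply (deriv_minus (V := X)); [now apply H|now apply deriv_integral]. }
  assert (Hgc : cts g).
  { intros t. apply (tends_minus (V := X)); [apply Hf|].
    apply (deriv_tends (V := X) _ _ (df t)). now apply deriv_integral. }
  assert (E : g a = g b).
  { apply norm_small_eq. intros eps Heps.
    destruct (locally_R_elim _ _ (Hgc a (eps / 2) ltac:(lra))) as [d1 [Hd1 H1]].
    destruct (locally_R_elim _ _ (Hgc b (eps / 2) ltac:(lra))) as [d2 [Hd2 H2]].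
    (* Small enough for a + d and b - d to lie within the continuity radii at the end points and to
       stay ordered inside the interval. *)
    set (d := Rmin (Rmin (d1 / 2) (d2 / 2)) ((b - a) / 4)).
    assert (Hd : 0 < d).
    { unfold d. repeat apply Rmin_glb_lt; lra. }
    assert (Hda : d <= d1 / 2).
    { eapply Rle_trans; [apply Rmin_l|]. apply Rmin_l. }
    assert (Hdb : d <= d2 / 2).
    { eapply Rle_trans; [apply Rmin_l|]. apply Rmin_r. }
    assert (Hdc : d <= (b - a) / 4) by apply Rmin_r.
    assert (Eab : g (a + d) = g (b - d)).
    { apply deriv_zero_eq. rewrite Rmin_left, Rmax_right by lra. intros t Ht. apply Hg. lra. }
    specialize (H1 (a + d)). specialize (H2 (b - d)).
    replace (a + d - a) with d in H1 by ring. replace (b - d - b) with (- d) in H2 by ring.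
    rewrite Rabs_Ropp in H2. rewrite Rabs_pos_eq in H1, H2 by lra.
    specialize (H1 ltac:(lra)). specialize (H2 ltac:(lra)).
    apply Rle_trans with (1 := norm_minus_triangle (V := X) _ (g (a + d)) _).
    pose proof (norm_minus_sym (V := X) (g a) (g (a + d))) as E1.
    rewrite E1, Eab in *. lra. }
  unfold g in E.
  replace (integral df a a) with (@zero X) in E.
  2:{ symmetry. apply integral_unique.
      exact (is_RInt_point (V := restrict_complete X) df a). }
  replace (f b) with (plus (minus (f b) (integral df a b)) (integral df a b)) by lin_ring X.
  rewrite <- E. lin_ring X.
Qed.

Lemma norm_deriv_le f df (g dg : R -> R) a b : a <= b ->
  (forall t, a <= t <= b -> deriv f t (df t)) ->
  (forall t, a <= t <= b -> tends (locally t) df (df t)) ->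
  (forall t, a <= t <= b -> is_derive g t (dg t)) ->
  (forall t, a <= t <= b -> continuous dg t) ->
  (forall t, a <= t <= b -> norm (df t) <= dg t) ->
  norm (minus (f b) (f a)) <= g b - g a.
Proof.
  intros Hab H1 H2 H3 H4 H5.
  apply (norm_RInt_le (V := restrict_complete X) df dg a b _ _ Hab H5).
  - apply integral_deriv; rewrite Rmin_left, Rmax_right by lra; assumption.
  - apply (is_RInt_derive (V := R_CompleteNormedModule) g dg);
      rewrite Rmin_left, Rmax_right by lra; assumption.
Qed.

End Integral.

(** Obtained by differentiating L of the integral in its upper limit, so that no Riemann sums
    appear. *)
Lemma integral_linear {X Y : CompleteNormedModule C_AbsRing} (L : X -> Y) K (f : R -> X) a b :
  (forall x y, L (minus x y) = minus (L x) (L y)) ->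
  (forall (c : C) x, L (scal c x) = scal c (L x)) ->
  (forall x, norm (L x) <= K * norm x) -> a <= b -> cts f ->
  integral (fun t => L (f t)) a b = L (integral f a b).
Proof.
  intros H1 H2 H3 Hab Hf.
  rewrite (integral_deriv_open (X := Y) (fun t => L (integral f a t)) (fun t => L (f t))); trivial.
  - replace (integral f a a) with (@zero X).
    2:{ symmetry. apply integral_unique.
        exact (is_RInt_point (V := restrict_complete X) f a). }
    rewrite <- H1. f_equal. lin_ring X.
  - intros t _. apply (deriv_linear (V := X) (W := Y) L K); trivial. now apply deriv_integral.
  - intros t. apply (tends_linear (V := X) (W := Y) L K); trivial.
    apply (deriv_tends (V := X) _ _ (f t)). now apply deriv_integral.
  - intros t. apply (tends_linear (V := X) (W := Y) L K); trivial.
Qed.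

(** * Resolvent families and their fractional integrals *)

(** What the fractional calculus uses of a resolvent, so that it applies both to positive operators
    and to the scalar family [Cres]. The field [rf_star] is there because [frac_mean] at [l]
    evaluates [Rs] on the segment from 0 to [l]. *)
Record resolvent_family {V : NormedModule C_AbsRing}
    (Om : C -> Prop) (Rs : C -> V -> V) (K : R) : Prop := {
  rf_pos : 0 < K;
  rf_ray : forall r, 0 <= r -> Om (RtoC r);
  rf_star : forall l t, Om l -> 0 <= t <= 1 -> Om (RtoC t * l)%C;
  rf_plus : forall l x y, Om l -> Rs l (plus x y) = plus (Rs l x) (Rs l y);
  rf_scal : forall l c x, Om l -> Rs l (scal c x) = scal c (Rs l x);
  rf_bound : forall l x, Om l -> norm (Rs l x) <= K / (1 + Cmod l) * norm x;
  rf_id : forall l m x, Om l -> Om m ->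
    minus (Rs l x) (Rs m x) = scal (m - l)%C (Rs l (Rs m x)) }.

Section ResolventFamily.
Context {V : NormedModule C_AbsRing} {Om : C -> Prop} {Rs : C -> V -> V} {K : R}.
Hypothesis HR : resolvent_family Om Rs K.

Lemma rf_minus l x y : Om l -> Rs l (minus x y) = minus (Rs l x) (Rs l y).
Proof.
  intros Hl. replace (minus x y) with (plus x (scal (RtoC (-1)) y)) by lin_ring V.
  rewrite (rf_plus _ _ _ HR), (rf_scal _ _ _ HR) by easy. lin_ring V.
Qed.

Lemma rf_bound_K l x : Om l -> norm (Rs l x) <= K * norm x.
Proof.
  intros Hl. apply Rle_trans with (1 := rf_bound _ _ _ HR l x Hl).
  apply Rmult_le_compat_r; [apply norm_ge_0|].
  pose proof (rf_pos _ _ _ HR). pose proof (Cmod_ge_0 l).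
  apply Rmult_le_reg_r with (1 + Cmod l); [lra|].
  replace (K / (1 + Cmod l) * (1 + Cmod l)) with K by (field; lra). nra.
Qed.

Lemma rf_comm l m x : Om l -> Om m -> Rs l (Rs m x) = Rs m (Rs l x).
Proof.
  intros Hl Hm. destruct (excluded_middle_informative (l = m)) as [->|Hne]; [easy|].
  pose proof (rf_id _ _ _ HR l m x Hl Hm) as H1.
  pose proof (rf_id _ _ _ HR m l x Hm Hl) as H2.
  assert (E : scal (m - l)%C (Rs l (Rs m x)) = scal (m - l)%C (Rs m (Rs l x))).
  { rewrite <- H1.
    replace (scal (m - l)%C (Rs m (Rs l x))) with (opp (scal (l - m)%C (Rs m (Rs l x))))
      by lin_ring V.
    rewrite <- H2. lin_ring V. }
  assert (Hml : (m - l <> 0)%C).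
  { intros H0. apply Hne. replace m with (m - l + l)%C by ring. rewrite H0. ring. }
  assert (E2 : forall y : V, scal (/ (m - l))%C (scal (m - l)%C y) = y).
  { intros y. transitivity (scal (/ (m - l) * (m - l))%C y); [lin_ring V|].
    replace (/ (m - l) * (m - l))%C with (RtoC 1) by (field; exact Hml). lin_ring V. }
  rewrite <- (E2 (Rs l (Rs m x))), E. apply E2.
Qed.

(** The resolvent identity with both resolvents bounded by [K]. *)
Lemma rf_lipschitz l m x : Om l -> Om m ->
  norm (minus (Rs l x) (Rs m x)) <= Cmod (m - l) * (K ^ 2 * norm x).
Proof.
  intros Hl Hm. rewrite (rf_id _ _ _ HR) by easy.
  apply Rle_trans with (1 := norm_scalC _ _).
  apply Rmult_le_compat_l; [apply Cmod_ge_0|].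
  apply Rle_trans with (1 := rf_bound_K _ _ Hl).
  replace (K ^ 2 * norm x) with (K * (K * norm x)) by ring.
  apply Rmult_le_compat_l; [left; apply (rf_pos _ _ _ HR)|]. now apply rf_bound_K.
Qed.

(** The complex derivative of R at l is - R(l)^2. Using the resolvent identity twice gives a
    quadratic remainder, the form that [deriv_quadratic] takes. *)
Lemma rf_quadratic l m x : Om l -> Om m ->
  norm (plus (minus (Rs m x) (Rs l x)) (scal (m - l)%C (Rs l (Rs l x))))
  <= Cmod (m - l) ^ 2 * (K ^ 3 * norm x).
Proof.
  intros Hl Hm.
  rewrite (rf_id _ _ _ HR m l x) by easy.
  replace (plus _ _) with (scal (m - l)%C (minus (Rs l (Rs l x)) (Rs m (Rs l x))))
    by lin_ring V.
  apply Rle_trans with (1 := norm_scalC _ _).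
  replace (Cmod (m - l) ^ 2 * (K ^ 3 * norm x))
    with (Cmod (m - l) * (Cmod (m - l) * (K ^ 2 * (K * norm x)))) by ring.
  apply Rmult_le_compat_l; [apply Cmod_ge_0|].
  apply Rle_trans with (1 := rf_lipschitz _ _ _ Hl Hm).
  apply Rmult_le_compat_l; [apply Cmod_ge_0|].
  apply Rmult_le_compat_l; [apply pow2_ge_0|]. now apply rf_bound_K.
Qed.

Lemma rf_tends {T} (F : (T -> Prop) -> Prop) {FF : Filter F} (l : T -> C) l0 (y : T -> V) y0 :
  F (fun t => Om (l t)) -> Om l0 -> tends (V := C_NormedModule) F l l0 -> tends F y y0 ->
  tends F (fun t => Rs (l t) (y t)) (Rs l0 y0).
Proof.
  intros Ho Ho0 Hl Hy.
  apply (tends_apply (fun t => Rs (l t)) K y y0).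
  - apply filter_imp with (2 := Ho). intros t Ht u v. now apply rf_minus.
  - apply filter_imp with (2 := Ho). intros t Ht u. now apply rf_bound_K.
  - apply tends_le with (fun t => Cmod (l t - l0) * (K ^ 2 * norm y0)).
    + apply filter_imp with (2 := Ho). intros t Ht.
      apply Rle_trans with (1 := rf_lipschitz _ _ _ Ht Ho0).
      replace (Cmod (l0 - l t)) with (Cmod (l t - l0)); [lra|].
      rewrite <- Cmod_opp. f_equal. ring.
    + intros eps Heps. set (B := K ^ 2 * norm y0).
      assert (HB : 0 <= B).
      { apply Rmult_le_pos; [apply pow2_ge_0|apply norm_ge_0]. }
      assert (H : 0 < eps / (B + 1)) by (apply Rdiv_lt_0_compat; lra).
      apply filter_imp with (2 := Hl _ H). intros t Ht.
      change (Cmod (l t - l0) < eps / (B + 1)) in Ht.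
      apply (Rmult_lt_compat_r (B + 1)) in Ht; [|lra].
      replace (eps / (B + 1) * (B + 1)) with eps in Ht by (field; lra).
      pose proof (Cmod_ge_0 (l t - l0)). nra.
  - exact Hy.
Qed.

End ResolventFamily.

(* [t ^ m] clamped to the unit interval; [Rpower 0 m] is the junk value 1. *)
Definition pow01 (m t : R) : R :=
  if Rle_dec t 0 then 0 else if Rle_dec 1 t then 1 else Rpower t m.

Lemma pow01_interior m t : 0 < t < 1 -> pow01 m t = Rpower t m.
Proof.
  intros Ht. unfold pow01. destruct (Rle_dec t 0); [lra|]. now destruct (Rle_dec 1 t); [lra|].
Qed.

Lemma Rpower_le1 t m : 0 < t <= 1 -> 0 < m -> 0 < Rpower t m <= 1.
Proof.
  intros Ht Hm. split; [apply exp_pos|].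
  rewrite <- (Rpower_O t) by lra. unfold Rpower.
  destruct (Req_dec t 1) as [->|Hne].
  - rewrite ln_1, !Rmult_0_r. lra.
  - left. apply exp_increasing. assert (ln t < 0) by (rewrite <- ln_1; apply ln_increasing; lra).
    nra.
Qed.

Lemma pow01_bounds m t : 0 < m -> 0 <= pow01 m t <= 1.
Proof.
  intros Hm. unfold pow01. destruct (Rle_dec t 0); [lra|]. destruct (Rle_dec 1 t); [lra|].
  pose proof (Rpower_le1 t m ltac:(lra) Hm). lra.
Qed.

Lemma pow01_1 m : pow01 m 1 = 1.
Proof. unfold pow01. destruct (Rle_dec 1 0); [lra|]. destruct (Rle_dec 1 1); lra. Qed.

Lemma is_derive_Rpower m t : 0 < t -> is_derive (fun s => Rpower s m) t (m * Rpower t (m - 1)).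
Proof.
  intros Ht. apply is_derive_Reals. now apply derivable_pt_lim_power.
Qed.

Lemma pow01_continuous m t : 0 < m -> forall eps, 0 < eps ->
  locally t (fun s => Rabs (pow01 m s - pow01 m t) < eps).
Proof.
  intros Hm eps Heps.
  destruct (Rle_or_lt t 0) as [Ht|Ht].
  { assert (E : pow01 m t = 0) by (unfold pow01; destruct (Rle_dec t 0); lra).
    rewrite E.
    (* This number solves s^m = eps, so it is the radius at the left end. *)
    assert (Hp : 0 < Rpower eps (/ m)) by apply exp_pos.
    apply locally_R_intro with (1 := Rmin_glb_lt _ _ _ Hp Rlt_0_1).
    intros s Hs.
    assert (Hs' : s < Rmin (Rpower eps (/ m)) 1) by (apply Rabs_def2 in Hs; lra).
    rewrite Rminus_0_r, Rabs_pos_eq by apply pow01_bounds, Hm.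
    destruct (Rle_or_lt s 0) as [H0|H0].
    { unfold pow01. destruct (Rle_dec s 0); lra. }
    pose proof (Rmin_l (Rpower eps (/ m)) 1). pose proof (Rmin_r (Rpower eps (/ m)) 1).
    rewrite pow01_interior by lra.
    replace eps with (Rpower (Rpower eps (/ m)) m).
    2:{ rewrite Rpower_mult. replace (/ m * m) with 1 by (field; lra). now apply Rpower_1. }
    apply exp_increasing. apply Rmult_lt_compat_l; [easy|]. apply ln_increasing; lra. }
  assert (Hc : continuous (fun s => Rpower s m) t).
  { apply (ex_derive_continuous (fun s => Rpower s m)). eexists. now apply is_derive_Rpower. }
  assert (Hc2 : locally t (fun s => Rabs (Rpower s m - Rpower t m) < eps)).
  { apply (Hc (fun y => Rabs (y - Rpower t m) < eps)).
    exists (mkposreal eps Heps). intros y Hy. exact Hy. }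
  assert (H1 : Rpower 1 m = 1) by (unfold Rpower; now rewrite ln_1, Rmult_0_r, exp_0).
  assert (Hpos : locally t (fun s => 0 < s)).
  { apply locally_R_intro with (1 := Ht). intros s Hs. apply Rabs_def2 in Hs. lra. }
  apply filter_imp with (2 := filter_and _ _ Hc2 Hpos). intros s [Hs Hs0].
  (* Truncation at 1 is 1-Lipschitz, so continuity passes from [Rpower] to [pow01]. *)
  assert (E : forall u, 0 < u -> pow01 m u = Rmin (Rpower u m) 1).
  { intros u Hu. unfold pow01. destruct (Rle_dec u 0); [lra|].
    destruct (Rle_dec 1 u) as [Hu1|Hu1].
    - rewrite Rmin_right; [easy|]. rewrite <- H1. apply Rle_Rpower_l; lra.
    - rewrite Rmin_left; [easy|]. apply Rpower_le1; lra. }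
  rewrite !E by easy.
  apply Rle_lt_trans with (2 := Hs).
  unfold Rmin. destruct (Rle_dec (Rpower s m) 1), (Rle_dec (Rpower t m) 1);
    unfold Rabs; repeat destruct Rcase_abs; lra.
Qed.

Lemma pow01_derive m t : 0 < t < 1 -> is_derive (pow01 m) t (m * pow01 m t / t).
Proof.
  intros Ht. apply is_derive_ext_loc with (fun s => Rpower s m).
  - apply locally_R_intro with (1 := Rmin_glb_lt _ _ _ (proj1 Ht) (Rlt_Rminus _ _ (proj2 Ht))).
    intros s Hs. symmetry. apply pow01_interior.
    pose proof (Rmin_l t (1 - t)). pose proof (Rmin_r t (1 - t)).
    apply Rabs_def2 in Hs. lra.
  - rewrite pow01_interior by easy.
    replace (m * Rpower t m / t) with (m * Rpower t (m - 1)); [now apply is_derive_Rpower|].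
    unfold Rminus. rewrite Rpower_plus, Rpower_Ropp, Rpower_1 by lra. field. lra.
Qed.

(* [frac_mean Rs b l x] is the integral of [s^(b-1) Rs (s l) x] over [0,1], written with
   [t = s^b] to remove the singularity. *)
Definition frac_mean {X : CompleteNormedModule C_AbsRing} (Rs : C -> X -> X)
    (b : R) (l : C) (x : X) : X :=
  scal (RtoC (/ b)) (integral (fun t => Rs (RtoC (pow01 (/ b) t) * l)%C x) 0 1).

(** The derivative of [frac_mean] in [l], taken under the integral sign: R(s l) contributes - s R(s
    l)^2. The minus sign sits in the factor [- / b]. *)
Definition frac_mean' {X : CompleteNormedModule C_AbsRing} (Rs : C -> X -> X)
    (b : R) (l : C) (x : X) : X :=
  scal (RtoC (- / b)) (integral (fun t =>
    scal (RtoC (pow01 (/ b) t)) (Rs (RtoC (pow01 (/ b) t) * l)%C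
                                   (Rs (RtoC (pow01 (/ b) t) * l)%C x))) 0 1).

Lemma tends_Cmult {T} (F : (T -> Prop) -> Prop) {FF : Filter F} (f g : T -> C) a b :
  tends (V := C_NormedModule) F f a -> tends (V := C_NormedModule) F g b ->
  tends (V := C_NormedModule) F (fun t => (f t * g t)%C) (a * b)%C.
Proof. exact (tends_scal (V := C_NormedModule) f g a b). Qed.

Section FracMean.
Context {X : CompleteNormedModule C_AbsRing} {Om : C -> Prop} {Rs : C -> X -> X} {K : R}.
Hypothesis HR : resolvent_family Om Rs K.
Context (b : R) (Hb : 0 < b).

Let m := / b.
Let Hm : 0 < m.
Proof. now apply Rinv_0_lt_compat. Qed.

Lemma star_pow01 l t : Om l -> Om (RtoC (pow01 m t) * l)%C.
Proof. intros Hl. apply (rf_star _ _ _ HR); [easy|now apply pow01_bounds]. Qed.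

Lemma tends_pow01 t :
  tends (V := C_NormedModule) (locally t) (fun s => RtoC (pow01 m s)) (RtoC (pow01 m t)).
Proof.
  apply tends_RtoC; [|apply locally_filter]. now apply pow01_continuous.
Qed.

Lemma tends_pow01_mult l t :
  tends (V := C_NormedModule) (locally t) (fun s => RtoC (pow01 m s) * l)%C
    (RtoC (pow01 m t) * l)%C.
Proof.
  apply tends_Cmult; [apply locally_filter|apply tends_pow01|apply tends_const].
Qed.

Lemma cts_frac_mean l x : Om l -> cts (fun t => Rs (RtoC (pow01 m t) * l)%C x).
Proof.
  intros Hl t. apply (rf_tends HR).
  - apply locally_filter.
  - apply filter_forall. intros s. now apply star_pow01.
  - now apply star_pow01.
  - apply tends_pow01_mult.
  - apply tends_const.
Qed.

Lemma cts_frac_mean' l x : Om l ->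
  cts (fun t => scal (RtoC (pow01 m t))
    (Rs (RtoC (pow01 m t) * l)%C (Rs (RtoC (pow01 m t) * l)%C x))).
Proof.
  intros Hl t. apply (tends_scal (V := X)); [apply tends_pow01|].
  apply (rf_tends HR).
  - apply locally_filter.
  - apply filter_forall. intros s. now apply star_pow01.
  - now apply star_pow01.
  - apply tends_pow01_mult.
  - now apply cts_frac_mean.
Qed.

(* Integrate the derivative of [t Rs (t^(1/b) l) x]. *)
Lemma frac_mean_ode l x : Om l ->
  plus (scal (RtoC b) (frac_mean Rs b l x)) (scal l (frac_mean' Rs b l x)) = Rs l x.
Proof.
  intros Hl. unfold frac_mean, frac_mean'. fold m.
  set (f := fun t => Rs (RtoC (pow01 m t) * l)%C x).
  set (h := fun t => scal (RtoC (pow01 m t))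
    (Rs (RtoC (pow01 m t) * l)%C (Rs (RtoC (pow01 m t) * l)%C x))).
  assert (Hf : cts f) by now apply cts_frac_mean.
  assert (Hh : cts h) by now apply cts_frac_mean'.
  assert (Hlh : cts (fun t => scal (RtoC (- m) * l)%C (h t))).
  { intros t. apply (tends_scal (V := X)); [apply tends_const|apply Hh]. }
  assert (E : integral (fun t => plus (f t) (scal (RtoC (- m) * l)%C (h t))) 0 1 = Rs l x).
  { rewrite (integral_deriv_open (fun t => scal (RtoC t) (f t)) _ 0 1).
    - unfold f. rewrite pow01_1.
      replace (RtoC 1 * l)%C with l by ring. lin_ring X.
    - lra.
    - intros t Ht.
      pose proof (is_derive_deriv (V := C_NormedModule) (fun s => RtoC (pow01 m s)) t
        (RtoC (m * pow01 m t / t))) as Hd1.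
      assert (Hd2 : deriv (V := C_NormedModule) (fun s => (RtoC (pow01 m s) * l)%C) t
        (RtoC (m * pow01 m t / t) * l)%C).
      { apply (deriv_linear (V := C_NormedModule) (W := C_NormedModule)
          (fun z => (z * l)%C) (Cmod l)).
        - intros u v. change ((u - v) * l = u * l - v * l)%C. ring.
        - intros u v. change ((u * v) * l = u * (v * l))%C. ring.
        - intros u. change (Cmod (u * l) <= Cmod l * Cmod u). rewrite Cmod_mult. lra.
        - destruct (pow01_derive m t Ht) as [_ Hd].
          apply deriv_of_remainder. intros eps Heps.
          specialize (Hd t (fun P HP => HP) (mkposreal eps Heps)).
          apply filter_imp with (2 := Hd). intros s Hs.
          change (Cmod (RtoC (pow01 m s) - RtoC (pow01 m t)
            - RtoC (s - t) * RtoC (m * pow01 m t / t)) <= eps * Rabs (s - t)).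
          rewrite <- RtoC_mult, <- !RtoC_minus, Cmod_R. exact Hs. }
      (* The inner derivative is that of t^m l, the outer one is - R^2. *)
      assert (Hd3 : deriv f t (scal (RtoC (m * pow01 m t / t) * l)%C
          (opp (Rs (RtoC (pow01 m t) * l)%C (Rs (RtoC (pow01 m t) * l)%C x))))).
      { apply (deriv_quadratic (V := X)) with (g := fun s => (RtoC (pow01 m s) * l)%C)
          (K := K ^ 3 * norm x); [exact Hd2|].
        apply filter_forall. intros s.
        pose proof (rf_quadratic HR (RtoC (pow01 m t) * l)%C (RtoC (pow01 m s) * l)%C x
          (star_pow01 _ _ Hl) (star_pow01 _ _ Hl)) as Hq.
        unfold f. rewrite Rmult_comm.
        replace (minus (minus _ _) (scal _ _)) with
          (plus (minus (Rs (RtoC (pow01 m s) * l)%C x) (Rs (RtoC (pow01 m t) * l)%C x))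
             (scal (RtoC (pow01 m s) * l - RtoC (pow01 m t) * l)%C
               (Rs (RtoC (pow01 m t) * l)%C (Rs (RtoC (pow01 m t) * l)%C x))))
          by lin_ring X.
        exact Hq. }
      assert (Hid : deriv (V := C_NormedModule) RtoC t (RtoC 1)).
      { exists (fun _ => RtoC 1). split; [|apply tends_const].
        intros s. change (RtoC s - RtoC t = RtoC (s - t) * RtoC 1)%C.
        rewrite RtoC_minus. ring. }
      apply (deriv_eq (V := X)) with (1 := deriv_scal (V := X) RtoC f t _ _ Hid Hd3).
      unfold h.
      replace (RtoC (m * pow01 m t / t)) with (RtoC (/ t) * RtoC (m * pow01 m t))%C.
      2:{ rewrite <- RtoC_mult. f_equal. field. lra. }
      (* The factor 1/t in the derivative of t^m cancels against the factor t of the product, so the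
         integrand is regular at 0. *)
      assert (Et : (RtoC t * RtoC (/ t) = RtoC 1)%C).
      { rewrite <- RtoC_mult. f_equal. field. lra. }
      lin_eq_in X ltac:(c_norm; try ring).
      replace (RtoC 1 * RtoC 0 + RtoC t * (RtoC (/ t) * (RtoC m * RtoC (pow01 m t)) * l * (- RtoC 1)))%C
       with (- (RtoC t * RtoC (/ t)) * RtoC m * RtoC (pow01 m t) * l)%C by ring.
      rewrite Et. ring.
    - intros t. apply (tends_scal (V := X)); [apply tends_RtoC_id|apply Hf].
    - intros t. apply (tends_plus (V := X)); [apply Hf|apply Hlh]. }
  rewrite <- E. rewrite integral_plus by easy.
  rewrite (integral_linear (X := X) (Y := X) (scal (RtoC (- m) * l)%C) (Cmod (RtoC (- m) * l)) h 0 1).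
  - replace (scal (RtoC b) (scal (RtoC m) (integral f 0 1))) with (integral f 0 1).
    2:{ symmetry. apply (scal_scal_inv (V := X) b). lra. }
    lin_ring X.
  - intros u v. lin_ring X.
  - intros u v. lin_ring X.
  - intros u. apply (norm_scalC (V := X)).
  - lra.
  - exact Hh.
Qed.

Lemma frac_mean_plus l x y : Om l ->
  frac_mean Rs b l (plus x y) = plus (frac_mean Rs b l x) (frac_mean Rs b l y).
Proof.
  intros Hl. unfold frac_mean.
  rewrite (integral_ext _ (fun t => plus (Rs (RtoC (pow01 (/ b) t) * l)%C x)
     (Rs (RtoC (pow01 (/ b) t) * l)%C y))).
  - rewrite integral_plus by now apply cts_frac_mean. lin_ring X.
  - intros t _. apply (rf_plus _ _ _ HR). now apply star_pow01.
Qed.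

Lemma frac_mean_scal l c x : Om l ->
  frac_mean Rs b l (scal c x) = scal c (frac_mean Rs b l x).
Proof.
  intros Hl. unfold frac_mean.
  rewrite (integral_ext _ (fun t => scal c (Rs (RtoC (pow01 (/ b) t) * l)%C x))).
  - rewrite (integral_linear (X := X) (Y := X) (scal c) (Cmod c)
      (fun t => Rs (RtoC (pow01 (/ b) t) * l)%C x)); try lra.
    + lin_ring X.
    + intros u v. lin_ring X.
    + intros u v. lin_ring X.
    + intros u. apply (norm_scalC (V := X)).
    + now apply cts_frac_mean.
  - intros t _. apply (rf_scal _ _ _ HR). now apply star_pow01.
Qed.

Lemma frac_mean_bound l x : Om l -> norm (frac_mean Rs b l x) <= m * K * norm x.
Proof.
  intros Hl. unfold frac_mean. fold m.
  apply Rle_trans with (1 := norm_scalR (V := X) _ _).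
  rewrite Rabs_pos_eq, Rmult_assoc by lra.
  apply Rmult_le_compat_l; [lra|].
  replace (K * norm x) with ((1 - 0) * (K * norm x)) by ring.
  apply norm_integral_le_const; [lra|now apply cts_frac_mean|].
  intros t _. apply (rf_bound_K HR). now apply star_pow01.
Qed.

Lemma frac_mean_linear {Y : CompleteNormedModule C_AbsRing} (L : X -> Y) KL
    (Rs' : C -> Y -> Y) l x :
  (forall x y, L (minus x y) = minus (L x) (L y)) ->
  (forall (c : C) x, L (scal c x) = scal c (L x)) ->
  (forall x, norm (L x) <= KL * norm x) ->
  Om l -> (forall t, 0 <= t <= 1 -> L (Rs (RtoC t * l)%C x) = Rs' (RtoC t * l)%C (L x)) ->
  L (frac_mean Rs b l x) = frac_mean Rs' b l (L x).
Proof.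
  intros H1 H2 H3 Hl H. unfold frac_mean. rewrite H2. f_equal.
  rewrite <- (integral_linear L KL); trivial; try lra; [|now apply cts_frac_mean].
  apply integral_ext. intros t _. apply H. now apply pow01_bounds.
Qed.

(** [rf_quadratic] integrated over the segment; the points s l and s n are no farther apart than l
    and n because [pow01] is at most 1. *)
Lemma frac_mean_quadratic l n x : Om l -> Om n ->
  norm (minus (minus (frac_mean Rs b n x) (frac_mean Rs b l x))
          (scal (n - l)%C (frac_mean' Rs b l x)))
  <= m * K ^ 3 * norm x * Cmod (n - l) ^ 2.
Proof.
  intros Hl Hn. unfold frac_mean, frac_mean'. fold m.
  set (f := fun t => Rs (RtoC (pow01 m t) * l)%C x).
  set (g := fun t => Rs (RtoC (pow01 m t) * n)%C x).
  set (h := fun t => scal (RtoC (pow01 m t))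
    (Rs (RtoC (pow01 m t) * l)%C (Rs (RtoC (pow01 m t) * l)%C x))).
  assert (Hf : cts f) by now apply cts_frac_mean.
  assert (Hg : cts g) by now apply cts_frac_mean.
  assert (Hh : cts h) by now apply cts_frac_mean'.
  assert (Hgf : cts (fun t => minus (g t) (f t))).
  { intros t. apply (tends_minus (V := X)); [apply Hg|apply Hf]. }
  assert (Hlh : cts (fun t => scal (n - l)%C (h t))).
  { intros t. apply (tends_scal (V := X)); [apply tends_const|apply Hh]. }
  assert (E : integral (fun t => plus (minus (g t) (f t)) (scal (n - l)%C (h t))) 0 1
     = plus (minus (integral g 0 1) (integral f 0 1)) (scal (n - l)%C (integral h 0 1))).
  { transitivity (plus (integral (fun t => minus (g t) (f t)) 0 1)
                      (integral (fun t => scal (n - l)%C (h t)) 0 1)).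
    { exact (integral_plus (X := X) _ _ 0 1 Hgf Hlh). }
    f_equal; [exact (integral_minus (X := X) g f 0 1 Hg Hf)|].
    apply (integral_linear (X := X) (Y := X) (scal (n - l)%C) (Cmod (n - l)) h 0 1);
      try easy; try lra.
    + intros u v. lin_ring X.
    + intros u v. lin_ring X.
    + intros u. apply (norm_scalC (V := X)). }
  replace (minus _ _) with (scal (RtoC m)
    (plus (minus (integral g 0 1) (integral f 0 1)) (scal (n - l)%C (integral h 0 1))))
    by lin_ring X.
  rewrite <- E.
  apply Rle_trans with (1 := norm_scalR (V := X) _ _).
  rewrite Rabs_pos_eq by lra.
  replace (m * K ^ 3 * norm x * Cmod (n - l) ^ 2)
    with (m * ((1 - 0) * (Cmod (n - l) ^ 2 * (K ^ 3 * norm x)))) by ring.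
  apply Rmult_le_compat_l; [lra|].
  apply norm_integral_le_const; [lra| |].
  { intros t. apply (tends_plus (V := X)); [apply Hgf|apply Hlh]. }
  intros t _.
  pose proof (rf_quadratic HR (RtoC (pow01 m t) * l)%C (RtoC (pow01 m t) * n)%C x
          (star_pow01 _ _ Hl) (star_pow01 _ _ Hn)) as Hq.
  unfold f, g, h.
  replace (plus _ _) with
    (plus (minus (Rs (RtoC (pow01 m t) * n)%C x) (Rs (RtoC (pow01 m t) * l)%C x))
             (scal (RtoC (pow01 m t) * n - RtoC (pow01 m t) * l)%C
               (Rs (RtoC (pow01 m t) * l)%C (Rs (RtoC (pow01 m t) * l)%C x))))
          by lin_ring X.
  apply Rle_trans with (1 := Hq).
  apply Rmult_le_compat_r.
  { apply Rmult_le_pos; [|apply norm_ge_0]. apply pow_le. left; apply (rf_pos _ _ _ HR). }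
  apply pow_incr. split; [apply Cmod_ge_0|].
  replace (RtoC (pow01 m t) * n - RtoC (pow01 m t) * l)%C
    with (RtoC (pow01 m t) * (n - l))%C by ring.
  rewrite Cmod_mult, Cmod_R. pose proof (pow01_bounds m t Hm). pose proof (Cmod_ge_0 (n - l)%C).
  rewrite Rabs_pos_eq by lra. nra.
Qed.

Lemma deriv_frac_mean (g : R -> C) t dg x : locally t (fun s => Om (g s)) ->
  deriv (V := C_NormedModule) g t dg ->
  deriv (fun s => frac_mean Rs b (g s) x) t (scal dg (frac_mean' Rs b (g t) x)).
Proof.
  intros Hg Hd. apply (deriv_quadratic (V := X)) with (1 := Hd) (K := m * K ^ 3 * norm x).
  apply filter_imp with (2 := Hg). intros s Hs.
  apply frac_mean_quadratic; [exact (locally_self _ _ Hg)|exact Hs].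
Qed.

End FracMean.

(** * The principal power along curves *)

Lemma Cmod_sq (z : C) : Cmod z ^ 2 = Re z ^ 2 + Im z ^ 2.
Proof.
  unfold Cmod. rewrite pow2_sqrt; [easy|].
  apply Rplus_le_le_0_compat; apply pow2_ge_0.
Qed.

Lemma Cmod_Ccis t : Cmod (Ccis t) = 1.
Proof.
  unfold Cmod, Ccis; simpl.
  replace (_ + _) with 1; [apply sqrt_1|].
  pose proof (sin2_cos2 t). unfold Rsqr in H. nra.
Qed.

Lemma Ccis_plus s t : Ccis (s + t) = (Ccis s * Ccis t)%C.
Proof.
  unfold Ccis, Cmult; simpl. rewrite cos_plus, sin_plus. f_equal; ring.
Qed.

Lemma Ccis_0 : Ccis 0 = RtoC 1.
Proof. unfold Ccis. now rewrite cos_0, sin_0. Qed.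

Lemma C_eta (z : C) : z = (Re z, Im z).
Proof. now destruct z. Qed.

(** Reduces the evaluation of [Carg] on the right and upper half-planes to exhibiting a polar form
    with an arctangent. *)
Lemma polar_unique z r t : 0 < r -> - PI < t <= PI -> z = (RtoC r * Ccis t)%C ->
  Cmod z = r /\ Carg z = t.
Proof.
  intros Hr Ht ->.
  assert (Hm : Cmod (RtoC r * Ccis t) = r).
  { rewrite Cmod_mult, Cmod_Ccis, Cmod_R, Rabs_pos_eq by lra. ring. }
  split; [exact Hm|]. unfold Carg. rewrite Hm.
  replace (Re (RtoC r * Ccis t)) with (r * cos t) by (unfold Ccis; simpl; ring).
  replace (Im (RtoC r * Ccis t)) with (r * sin t) by (unfold Ccis; simpl; ring).
  replace (r * cos t / r) with (cos t) by (field; lra).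
  destruct (Rlt_dec (r * sin t) 0) as [Hs|Hs].
  - assert (Ht0 : t < 0).
    { apply Rnot_le_lt; intros H0.
      pose proof (sin_ge_0 t H0 (proj2 Ht)). nra. }
    rewrite <- (cos_neg t), acos_cos by lra. ring.
  - assert (Ht0 : 0 <= t).
    { apply Rnot_lt_le; intros H0. apply Hs.
      pose proof (sin_gt_0 (- t) ltac:(lra) ltac:(lra)). rewrite sin_neg in H. nra. }
    apply acos_cos. lra.
Qed.

Lemma Re_le_Cmod z : Rabs (Re z) <= Cmod z.
Proof. apply (Rle_trans _ _ _ (Rmax_l _ (Rabs (Im z))) (Rmax_Cmod z)). Qed.

Lemma Im_le_Cmod z : Rabs (Im z) <= Cmod z.
Proof. apply (Rle_trans _ _ _ (Rmax_r (Rabs (Re z)) _) (Rmax_Cmod z)). Qed.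

Lemma Re_div_Cmod z : z <> RtoC 0 -> -1 <= Re z / Cmod z <= 1.
Proof.
  intros Hz. pose proof (Cmod_gt_0 z) as H. pose proof (proj1 H Hz) as Hp.
  pose proof (Re_le_Cmod z) as Hr. apply Rabs_le_between in Hr.
  split; apply Rmult_le_reg_r with (Cmod z); trivial;
    unfold Rdiv; rewrite Rmult_assoc, Rinv_l by lra; lra.
Qed.

Lemma polar_form z : z <> RtoC 0 -> z = (RtoC (Cmod z) * Ccis (Carg z))%C.
Proof.
  intros Hz. pose proof (proj1 (Cmod_gt_0 z) Hz) as Hp.
  pose proof (Re_div_Cmod z Hz) as Hd.
  pose proof (cos_acos _ Hd) as Hc. pose proof (sin_acos _ Hd) as Hs.
  assert (Hs' : Cmod z * sin (acos (Re z / Cmod z)) = Rabs (Im z)).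
  { rewrite Hs. rewrite <- (Rabs_pos_eq (Cmod z)) at 1 by lra.
    rewrite <- sqrt_Rsqr_abs, <- sqrt_mult_alt by apply Rle_0_sqr.
    rewrite <- sqrt_Rsqr_abs. f_equal. unfold Rsqr.
    replace (Cmod z * Cmod z * (1 - Re z / Cmod z * (Re z / Cmod z)))
      with (Cmod z ^ 2 - Re z ^ 2) by (field; lra).
    rewrite Cmod_sq. ring. }
  assert (Hc' : Cmod z * cos (acos (Re z / Cmod z)) = Re z) by (rewrite Hc; field; lra).
  rewrite (C_eta z) at 1. unfold Carg, Ccis, Cmult; simpl.
  destruct (Rlt_dec (Im z) 0) as [Hi|Hi].
  - rewrite Rabs_left in Hs' by exact Hi. rewrite cos_neg, sin_neg. f_equal; lra.
  - rewrite Rabs_pos_eq in Hs' by lra. f_equal; lra.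
Qed.

(** The plane slit along the nonpositive real axis, as a union of three half-planes on each of which
    [Carg] is an arctangent up to sign and a constant. *)
Definition off_cut (z : C) : Prop := 0 < Re z \/ Im z <> 0.

Lemma off_cut_neq0 z : off_cut z -> z <> RtoC 0.
Proof. intros [H|H] ->; simpl in H; lra. Qed.

Lemma sqrt_1_sq_div x y : 0 < x -> sqrt (1 + (y / x)²) = sqrt (x ^ 2 + y ^ 2) / x.
Proof.
  intros Hx. replace (1 + (y / x)²) with ((x ^ 2 + y ^ 2) / x²) by (unfold Rsqr; field; lra).
  rewrite sqrt_div_alt by (apply Rsqr_pos_lt; lra). now rewrite sqrt_Rsqr by lra.
Qed.

Lemma atan_polar x y : 0 < x ->
  x = sqrt (x ^ 2 + y ^ 2) * cos (atan (y / x)) /\ y = sqrt (x ^ 2 + y ^ 2) * sin (atan (y / x)).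
Proof.
  intros Hx. rewrite cos_atan, sin_atan, sqrt_1_sq_div by exact Hx.
  assert (0 < sqrt (x ^ 2 + y ^ 2)).
  { apply sqrt_lt_R0. pose proof (pow2_ge_0 y). pose proof (pow_lt x 2 Hx). lra. }
  split; field; lra.
Qed.

Lemma Carg_right z : 0 < Re z -> Carg z = atan (Im z / Re z).
Proof.
  intros H. destruct (atan_polar (Re z) (Im z) H) as [H1 H2].
  pose proof (atan_bound (Im z / Re z)). pose proof PI_RGT_0.
  apply (polar_unique z (Cmod z)); [|lra|].
  - apply Cmod_gt_0, off_cut_neq0. now left.
  - rewrite (C_eta z) at 1. unfold Ccis, Cmult; simpl. unfold Cmod.
    change (fst z) with (Re z). change (snd z) with (Im z). f_equal; lra.
Qed.

Lemma Carg_upper z : 0 < Im z -> Carg z = PI / 2 - atan (Re z / Im z).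
Proof.
  intros H. destruct (atan_polar (Im z) (Re z) H) as [H1 H2].
  pose proof (atan_bound (Re z / Im z)). pose proof PI_RGT_0.
  apply (polar_unique z (Cmod z)); [|lra|].
  - apply Cmod_gt_0, off_cut_neq0. right. lra.
  - rewrite (C_eta z) at 1. unfold Ccis, Cmult; simpl. unfold Cmod.
    change (fst z) with (Re z). change (snd z) with (Im z).
    rewrite cos_shift, sin_shift, (Rplus_comm (Re z ^ 2)). f_equal; lra.
Qed.

Lemma Carg_conj z : Im z <> 0 -> Carg (Re z, - Im z) = - Carg z.
Proof.
  intros H. unfold Carg. simpl.
  replace (Cmod (Re z, - Im z)) with (Cmod z).
  2:{ unfold Cmod. f_equal. unfold Re, Im. simpl. ring. }
  destruct (Rlt_dec (- Im z) 0), (Rlt_dec (Im z) 0); lra.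
Qed.

Lemma Carg_lower z : Im z < 0 -> Carg z = - (PI / 2 - atan (Re z / - Im z)).
Proof.
  intros H. rewrite <- (Ropp_involutive (Carg z)), <- Carg_conj by lra. f_equal.
  rewrite Carg_upper; simpl; [easy|lra].
Qed.

Lemma Carg_opp_upper z : 0 < Im z -> Carg (- z)%C = Carg z - PI.
Proof.
  intros H. unfold Carg. rewrite Cmod_opp.
  replace (Im (- z)%C) with (- Im z) by now destruct z.
  replace (Re (- z)%C) with (- Re z) by now destruct z.
  destruct (Rlt_dec (- Im z) 0); [|lra]. destruct (Rlt_dec (Im z) 0); [lra|].
  replace (- Re z / Cmod z) with (- (Re z / Cmod z)).
  - rewrite acos_opp. lra.
  - unfold Rdiv; ring.
Qed.

Lemma Carg_opp_lower z : Im z < 0 -> Carg (- z)%C = Carg z + PI.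
Proof.
  intros H. unfold Carg. rewrite Cmod_opp.
  replace (Im (- z)%C) with (- Im z) by now destruct z.
  replace (Re (- z)%C) with (- Re z) by now destruct z.
  destruct (Rlt_dec (- Im z) 0); [lra|]. destruct (Rlt_dec (Im z) 0); [|lra].
  replace (- Re z / Cmod z) with (- (Re z / Cmod z)).
  - rewrite acos_opp. lra.
  - unfold Rdiv; ring.
Qed.

(** Above the real axis the principal argument of - z is that of z minus pi, below it is that of z
    plus pi. The two phases produce the factor 2 i sin in the contour integral. *)
Lemma Cpower_opp_upper z a : 0 < Im z -> Cpower (- z)%C a = (Ccis (- (a * PI)) * Cpower z a)%C.
Proof.
  intros H. unfold Cpower. rewrite Cmod_opp, Carg_opp_upper by exact H.
  replace (a * (Carg z - PI)) with (a * Carg z + - (a * PI)) by ring.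
  rewrite Ccis_plus. ring.
Qed.

Lemma Cpower_opp_lower z a : Im z < 0 -> Cpower (- z)%C a = (Ccis (a * PI) * Cpower z a)%C.
Proof.
  intros H. unfold Cpower. rewrite Cmod_opp, Carg_opp_lower by exact H.
  replace (a * (Carg z + PI)) with (a * Carg z + a * PI) by ring.
  rewrite Ccis_plus. ring.
Qed.

Lemma Cmod_Cpower z a : Cmod (Cpower z a) = Rpower (Cmod z) a.
Proof.
  unfold Cpower. rewrite Cmod_mult, Cmod_Ccis, Cmod_R, Rabs_pos_eq, Rmult_1_r; [easy|].
  left. apply exp_pos.
Qed.

Lemma Cpower_succ z a : z <> RtoC 0 -> (Cpower z (a - 1) * z)%C = Cpower z a.
Proof.
  intros Hz. pose proof (proj1 (Cmod_gt_0 z) Hz) as Hp.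
  rewrite (polar_form z Hz) at 2. unfold Cpower.
  replace (a * Carg z) with ((a - 1) * Carg z + Carg z) by ring.
  replace (Rpower (Cmod z) a) with (Rpower (Cmod z) (a - 1) * Cmod z).
  - rewrite Ccis_plus, RtoC_mult. ring.
  - rewrite <- (Rpower_1 (Cmod z)) at 2 by exact Hp. rewrite <- Rpower_plus. f_equal. ring.
Qed.

Lemma Cpower_RtoC r a : 0 < r -> Cpower (RtoC r) a = RtoC (Rpower r a).
Proof.
  intros Hr. unfold Cpower. rewrite Cmod_R, Rabs_pos_eq by lra.
  rewrite Carg_right by exact Hr. simpl.
  replace (0 / r) with 0 by (field; lra). rewrite atan_0, Rmult_0_r, Ccis_0. ring.
Qed.

Lemma deriv_C_intro (f : R -> C) t l :
  is_derive (fun s => Re (f s)) t (Re l) -> is_derive (fun s => Im (f s)) t (Im l) ->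
  deriv (V := C_NormedModule) f t l.
Proof.
  intros [_ H1] [_ H2]. apply deriv_of_remainder. intros eps Heps.
  assert (He : 0 < eps / 2) by lra.
  specialize (H1 t (fun P HP => HP) (mkposreal _ He)).
  specialize (H2 t (fun P HP => HP) (mkposreal _ He)).
  apply filter_imp with (2 := filter_and _ _ H1 H2). intros s [Hs1 Hs2].
  change (Cmod (f s - f t - RtoC (s - t) * l) <= eps * Rabs (s - t)).
  change (Rabs (Re (f s) - Re (f t) - (s - t) * Re l) <= eps / 2 * Rabs (s - t)) in Hs1.
  change (Rabs (Im (f s) - Im (f t) - (s - t) * Im l) <= eps / 2 * Rabs (s - t)) in Hs2.
  set (w := (f s - f t - RtoC (s - t) * l)%C).
  replace (Re (f s) - Re (f t) - (s - t) * Re l) with (Re w) in Hs1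
    by (unfold w; simpl; unfold Re, Im; ring).
  replace (Im (f s) - Im (f t) - (s - t) * Im l) with (Im w) in Hs2
    by (unfold w; simpl; unfold Re, Im; ring).
  replace w with (RtoC (Re w) + RtoC (Im w) * Ci)%C.
  2:{ rewrite (C_eta w) at 3. unfold Cplus, Cmult, RtoC, Ci; simpl. f_equal; ring. }
  apply Rle_trans with (1 := Cmod_triangle _ _).
  rewrite Cmod_mult, !Cmod_R.
  replace (Cmod Ci) with 1.
  2:{ unfold Cmod, Ci; simpl. replace (_ + _) with 1 by ring. now rewrite sqrt_1. }
  lra.
Qed.

Lemma norm_C_R (w : C) : @norm R_AbsRing C_R_NormedModule w = Cmod w.
Proof.
  change (sqrt (Rabs (fst w) ^ 2 + Rabs (snd w) ^ 2) = Cmod w).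
  unfold Cmod. now rewrite !pow2_abs.
Qed.

(** [contour] differentiates in C as a product of two real lines, [deriv] in C with restricted
    complex scalars. The two structures agree on values, but not by conversion alone. *)
Lemma is_derive_C_R (g : R -> C) t (l : C) :
  is_derive (K := R_AbsRing) (V := C_R_NormedModule) g t l
  <-> deriv (V := C_NormedModule) g t l.
Proof.
  assert (E : forall s, (g s - g t - RtoC (s - t) * l)%C =
      (@minus C_R_NormedModule (@minus C_R_NormedModule (g s) (g t))
         (@scal R_Ring C_R_NormedModule (@minus R_Ring s t) l) : C)).
  { intros s. apply injective_projections.
    - change (fst (g s) + - fst (g t) + - ((s - t) * fst l - 0 * snd l)
        = fst (g s) + - fst (g t) + - ((s - t) * fst l)). ring.
    - change (snd (g s) + - snd (g t) + - ((s - t) * snd l + 0 * fst l)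
        = snd (g s) + - snd (g t) + - ((s - t) * snd l)). ring. }
  split.
  - intros [_ H]. apply deriv_of_remainder. intros eps Heps.
    specialize (H t (fun P HP => HP) (mkposreal eps Heps)).
    apply filter_imp with (2 := H). intros s Hs. rewrite norm_C_R in Hs.
    change (Cmod (g s - g t - RtoC (s - t) * l) <= eps * Rabs (s - t)).
    rewrite E. exact Hs.
  - intros H. apply (deriv_is_derive (V := C_NormedModule)) in H. destruct H as [_ H].
    split; [apply (@is_linear_scal_l R_AbsRing C_R_NormedModule)|].
    intros u Hu eps. specialize (H u Hu eps).
    apply (@is_filter_lim_locally_unique R_AbsRing R_NormedModule) in Hu. subst u.
    apply filter_imp with (2 := H). intros s Hs. rewrite norm_C_R.
    change (Cmod (g s - g t - RtoC (s - t) * l) <= eps * Rabs (s - t)) in Hs.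
    rewrite E in Hs. exact Hs.
Qed.

Lemma deriv_C_Re (f : R -> C) t l : deriv (V := C_NormedModule) f t l ->
  is_derive (fun s => Re (f s)) t (Re l).
Proof.
  intros H. apply (deriv_is_derive (V := C_NormedModule)) in H. destruct H as [_ H].
  split; [apply (@is_linear_scal_l R_AbsRing R_NormedModule)|].
  intros x Hx eps. specialize (H x Hx eps).
  apply (@is_filter_lim_locally_unique R_AbsRing R_NormedModule) in Hx. subst x.
  apply filter_imp with (2 := H). intros s Hs.
  apply Rle_trans with (2 := Hs).
  change (Rabs (Re (f s) - Re (f t) - (s - t) * Re l)
    <= Cmod (f s - f t - RtoC (s - t) * l)).
  replace (Re (f s) - Re (f t) - (s - t) * Re l)
    with (Re (f s - f t - RtoC (s - t) * l)) by (simpl; unfold Re, Im; ring).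
  apply Re_le_Cmod.
Qed.

Lemma deriv_C_Im (f : R -> C) t l : deriv (V := C_NormedModule) f t l ->
  is_derive (fun s => Im (f s)) t (Im l).
Proof.
  intros H. apply (deriv_is_derive (V := C_NormedModule)) in H. destruct H as [_ H].
  split; [apply (@is_linear_scal_l R_AbsRing R_NormedModule)|].
  intros x Hx eps. specialize (H x Hx eps).
  apply (@is_filter_lim_locally_unique R_AbsRing R_NormedModule) in Hx. subst x.
  apply filter_imp with (2 := H). intros s Hs.
  apply Rle_trans with (2 := Hs).
  change (Rabs (Im (f s) - Im (f t) - (s - t) * Im l)
    <= Cmod (f s - f t - RtoC (s - t) * l)).
  replace (Im (f s) - Im (f t) - (s - t) * Im l)
    with (Im (f s - f t - RtoC (s - t) * l)) by (simpl; unfold Re, Im; ring).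
  apply Im_le_Cmod.
Qed.

Lemma continuous_pos (f : R -> R) t : continuous f t -> 0 < f t ->
  locally t (fun s => 0 < f s).
Proof.
  intros Hf H. apply (Hf (fun y => 0 < y)).
  exists (mkposreal _ H). intros y Hy. apply Rabs_def2 in Hy.
  change (y - f t < f t /\ - f t < y - f t) in Hy. lra.
Qed.

(** The three arctangent formulas for the argument all differentiate to (x y' - y x') / (x^2 +
    y^2). *)
Lemma is_derive_Carg (c : R -> C) t dc : off_cut (c t) ->
  deriv (V := C_NormedModule) c t dc ->
  is_derive (fun s => Carg (c s)) t
    ((Re (c t) * Im dc - Im (c t) * Re dc) / (Re (c t) ^ 2 + Im (c t) ^ 2)).
Proof.
  intros Ho Hd.
  pose proof (deriv_C_Re _ _ _ Hd) as Hx. pose proof (deriv_C_Im _ _ _ Hd) as Hy.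
  set (x := fun s => Re (c s)) in *. set (y := fun s => Im (c s)) in *.
  change (Re (c t)) with (x t). change (Im (c t)) with (y t).
  assert (Hcx : continuous x t) by (apply (ex_derive_continuous (V := R_NormedModule)); (eexists; eassumption)).
  assert (Hcy : continuous y t) by (apply (ex_derive_continuous (V := R_NormedModule)); (eexists; eassumption)).
  assert (Hex : ex_derive x t) by (eexists; eassumption).
  assert (Hey : ex_derive y t) by (eexists; eassumption).
  assert (Ux : Derive (fun s => x s) t = Re dc) by now apply is_derive_unique.
  assert (Uy : Derive (fun s => y s) t = Im dc) by now apply is_derive_unique.
  assert (Hcase : 0 < x t \/ 0 < y t \/ y t < 0).
  { unfold x, y. destruct Ho as [Ho|Ho]; lra. }
  destruct Hcase as [H|[H|H]].
  - apply is_derive_ext_loc with (fun s => atan (y s / x s)).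
    + apply filter_imp with (2 := continuous_pos x t Hcx H). intros s Hs.
      symmetry. now apply Carg_right.
    + auto_derive; [repeat split; trivial; lra|].
      rewrite Ux, Uy. field. split; nra.
  - apply is_derive_ext_loc with (fun s => PI / 2 - atan (x s / y s)).
    + apply filter_imp with (2 := continuous_pos y t Hcy H). intros s Hs.
      symmetry. now apply Carg_upper.
    + auto_derive; [repeat split; trivial; lra|].
      rewrite Ux, Uy. field. split; nra.
  - apply is_derive_ext_loc with (fun s => - (PI / 2 - atan (x s / - y s))).
    + assert (Hn : continuous (fun s => - y s) t) by now apply (continuous_opp y t).
      apply filter_imp with (2 := continuous_pos _ t Hn ltac:(lra)). intros s Hs.
      symmetry. apply Carg_lower. change (y s < 0). lra.
    + auto_derive; [repeat split; trivial; lra|].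
      rewrite Ux, Uy. field. split; nra.
Qed.

Lemma deriv_Cpower (c : R -> C) t dc a : off_cut (c t) ->
  deriv (V := C_NormedModule) c t dc ->
  deriv (V := C_NormedModule) (fun s => Cpower (c s) a) t
    (RtoC a * Cpower (c t) (a - 1) * dc)%C.
Proof.
  intros Ho Hd. pose proof (off_cut_neq0 _ Ho) as Hz.
  assert (Hm : 0 < Re (c t) ^ 2 + Im (c t) ^ 2).
  { rewrite <- Cmod_sq. apply pow_lt. now apply Cmod_gt_0. }
  (* The factor 1 / c is spelled out in coordinates, so that [field] can compare real and imaginary
     parts. *)
  assert (Hq : Cpower (c t) (a - 1) = Cmult (Cpower (c t) a)
     (Re (c t) / (Re (c t) ^ 2 + Im (c t) ^ 2), - Im (c t) / (Re (c t) ^ 2 + Im (c t) ^ 2))).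
  { change (Cpower (c t) (a - 1) = Cpower (c t) a * / c t)%C.
    rewrite <- (Cpower_succ (c t) a Hz). field. exact Hz. }
  pose proof (is_derive_Carg c t dc Ho Hd) as Ht.
  pose proof (deriv_C_Re _ _ _ Hd) as Hx. pose proof (deriv_C_Im _ _ _ Hd) as Hy.
  set (x := fun s => Re (c s)) in *. set (y := fun s => Im (c s)) in *.
  set (th := fun s => Carg (c s)) in *.
  change (Re (c t)) with (x t) in *. change (Im (c t)) with (y t) in *.
  assert (Hex : ex_derive x t) by (eexists; eassumption).
  assert (Hey : ex_derive y t) by (eexists; eassumption).
  assert (Het : ex_derive th t) by (eexists; eassumption).
  assert (Ux : Derive (fun s => x s) t = Re dc) by now apply is_derive_unique.
  assert (Uy : Derive (fun s => y s) t = Im dc) by now apply is_derive_unique.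
  assert (Ut : Derive (fun s => th s) t = (x t * Im dc - y t * Re dc) / (x t ^ 2 + y t ^ 2))
    by now apply is_derive_unique.
  assert (Hs : 0 < sqrt (x t ^ 2 + y t ^ 2)) by now apply sqrt_lt_R0.
  assert (Hss : sqrt (x t ^ 2 + y t ^ 2) * sqrt (x t ^ 2 + y t ^ 2) = x t ^ 2 + y t ^ 2)
    by (apply sqrt_sqrt; lra).
  assert (EL : forall s, Cpower (c s) a =
     (exp (a * ln (sqrt (x s ^ 2 + y s ^ 2))) * cos (a * th s),
      exp (a * ln (sqrt (x s ^ 2 + y s ^ 2))) * sin (a * th s))).
  { intros s. unfold Cpower, Rpower, Ccis, Cmult, Cmod; simpl. f_equal; unfold x, y, th, Re, Im; ring. }
  assert (Er : forall s, exp (a * ln (sqrt (x s ^ 2 + y s ^ 2))) * cos (a * th s) = Re (Cpower (c s) a))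
    by (intros s; now rewrite EL).
  assert (Ei : forall s, exp (a * ln (sqrt (x s ^ 2 + y s ^ 2))) * sin (a * th s) = Im (Cpower (c s) a))
    by (intros s; now rewrite EL).
  assert (Hdl : is_derive (fun s => ln (sqrt (x s ^ 2 + y s ^ 2))) t
     ((x t * Re dc + y t * Im dc) / (x t ^ 2 + y t ^ 2))).
  { auto_derive; [repeat split; trivial; simpl in *; lra|].
    rewrite Ux, Uy. simpl in *.
    set (q := sqrt (x t * (x t * 1) + y t * (y t * 1))) in *.
    rewrite <- Hss. field. lra. }
  set (L := fun s => ln (sqrt (x s ^ 2 + y s ^ 2))) in *.
  assert (Hel : ex_derive L t) by (eexists; eassumption).
  assert (Ul : Derive (fun s => L s) t = (x t * Re dc + y t * Im dc) / (x t ^ 2 + y t ^ 2))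
    by now apply is_derive_unique.
  apply deriv_C_intro.
  - apply is_derive_ext with (1 := Er).
    change (is_derive (fun s => exp (a * L s) * cos (a * th s)) t
       (Re (a * Cpower (c t) (a - 1) * dc))).
    rewrite Hq, EL. fold (L t).
    auto_derive; [repeat split; trivial|].
    rewrite Ul, Ut. simpl in *. unfold Re, Im. field. simpl. lra.
  - apply is_derive_ext with (1 := Ei).
    change (is_derive (fun s => exp (a * L s) * sin (a * th s)) t
       (Im (a * Cpower (c t) (a - 1) * dc))).
    rewrite Hq, EL. fold (L t).
    auto_derive; [repeat split; trivial|].
    rewrite Ul, Ut. simpl in *. unfold Re, Im. field. simpl. lra.
Qed.

(** * Primitives of z^(b-1) R(z) along curves, and their limit at infinity *)

Definition frac_prim {X : CompleteNormedModule C_AbsRing} (Rs : C -> X -> X)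
    (b : R) (l : C) (x : X) : X := scal (Cpower l b) (frac_mean Rs b l x).

(** By scaling, [frac_prim] at r > 0 is the integral of s^(b-1) R(s) x over [0, r], so this limit is
    the improper integral over (0, oo). Its existence is [frac_int_spec]. *)
Definition frac_int {X : CompleteNormedModule C_AbsRing} (Rs : C -> X -> X)
    (b : R) (x : X) : X :=
  epsilon (inhabits zero)
    (tends (Rbar_locally p_infty) (fun r => frac_prim Rs b (RtoC r) x)).

Lemma Rpower_neg_lim k c : 0 < c -> forall eps, 0 < eps ->
  Rbar_locally p_infty (fun r => 0 < r /\ k * Rpower r (- c) < eps).
Proof.
  intros Hc eps Heps.
  set (q := eps / (Rabs k + 1)).
  pose proof (Rabs_pos k). pose proof (Rle_abs k).
  assert (Hq : 0 < q) by (apply Rdiv_lt_0_compat; lra).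
  exists (Rmax 1 (Rpower q (- / c))). intros r Hr.
  pose proof (Rmax_l 1 (Rpower q (- / c))). pose proof (Rmax_r 1 (Rpower q (- / c))).
  split; [lra|].
  assert (Hlt : Rpower r (- c) < q).
  { replace q with (Rpower (Rpower q (- / c)) (- c)) at 1.
    2:{ rewrite Rpower_mult. replace (- / c * - c) with 1 by (field; lra). now apply Rpower_1. }
    apply exp_increasing.
    assert (ln (Rpower q (- / c)) < ln r) by (apply ln_increasing; [apply exp_pos|lra]).
    nra. }
  pose proof (exp_pos (- c * ln r)) as Hep. fold (Rpower r (- c)) in Hep.
  assert (E : q * (Rabs k + 1) = eps) by (unfold q; field; lra).
  nra.
Qed.

Lemma Rbar_locally_ge : Rbar_locally p_infty (fun r => 0 <= r).
Proof. exists 0. intros; lra. Qed.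

Lemma deriv_RtoC t : deriv (V := C_NormedModule) RtoC t (RtoC 1).
Proof.
  exists (fun _ => RtoC 1). split; [|apply tends_const].
  intros s. change (RtoC s - RtoC t = RtoC (s - t) * RtoC 1)%C. rewrite RtoC_minus. ring.
Qed.

Section FracInt.
Context {X : CompleteNormedModule C_AbsRing} {Om : C -> Prop} {Rs : C -> X -> X} {K : R}.
Hypothesis HR : resolvent_family Om Rs K.
Context (b : R) (Hb : 0 < b < 1).

(* [b H + l H' = Rs l x] makes [z^b H(c z)] a primitive of [z^(b-1) Rs (c z) x]. *)
Lemma deriv_frac_curve (z : R -> C) t (dz c : C) x :
  off_cut (z t) -> locally t (fun s => Om (c * z s)%C) ->
  deriv (V := C_NormedModule) z t dz ->
  deriv (fun s => scal (Cpower (z s) b) (frac_mean Rs b (c * z s)%C x)) t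
    (scal (dz * Cpower (z t) (b - 1))%C (Rs (c * z t)%C x)).
Proof.
  intros Ho Hl Hd.
  assert (Hcd : deriv (V := C_NormedModule) (fun s => (c * z s)%C) t (c * dz)%C).
  { apply (deriv_linear (V := C_NormedModule) (W := C_NormedModule)
      (fun w => (c * w)%C) (Cmod c)); [| | |exact Hd].
    - intros u v. change (c * (u - v) = c * u - c * v)%C. ring.
    - intros u v. change (c * (u * v) = u * (c * v))%C. ring.
    - intros u. change (Cmod (c * u) <= Cmod c * Cmod u). rewrite Cmod_mult. lra. }
  pose proof (deriv_frac_mean HR b (proj1 Hb) _ _ _ x Hl Hcd) as H1.
  pose proof (deriv_Cpower z t dz b Ho Hd) as H2.
  apply (deriv_eq (V := X)) with (1 := deriv_scal (V := X) _ _ _ _ _ H2 H1).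
  rewrite <- (frac_mean_ode HR b (proj1 Hb) (c * z t)%C x (locally_self _ _ Hl)).
  rewrite <- (Cpower_succ (z t) b) by now apply off_cut_neq0.
  lin_ring X.
Qed.

Lemma tends_frac_curve (z dz : R -> C) t (c : C) x :
  off_cut (z t) -> locally t (fun s => Om (c * z s)%C) ->
  deriv (V := C_NormedModule) z t (dz t) ->
  tends (V := C_NormedModule) (locally t) dz (dz t) ->
  tends (locally t) (fun s => scal (dz s * Cpower (z s) (b - 1))%C (Rs (c * z s)%C x))
    (scal (dz t * Cpower (z t) (b - 1))%C (Rs (c * z t)%C x)).
Proof.
  intros Ho Hl Hd Hdz. apply (tends_scal (V := X)).
  - apply tends_Cmult; [apply locally_filter|exact Hdz|].
    exact (deriv_tends (V := C_NormedModule) _ _ _ (deriv_Cpower z t (dz t) (b - 1) Ho Hd)).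
  - apply (rf_tends HR).
    + apply locally_filter.
    + exact Hl.
    + exact (locally_self _ _ Hl).
    + apply tends_Cmult; [apply locally_filter|apply tends_const|].
      exact (deriv_tends (V := C_NormedModule) _ _ _ Hd).
    + apply tends_const.
Qed.

Lemma locally_Om_pos t : 0 < t -> locally t (fun s => Om (RtoC 1 * RtoC s)%C).
Proof.
  intros Ht. apply locally_R_intro with (1 := Ht). intros s Hs. apply Rabs_def2 in Hs.
  rewrite Cmult_1_l. apply (rf_ray _ _ _ HR). lra.
Qed.

Lemma deriv_frac_prim t x : 0 < t ->
  deriv (fun s => frac_prim Rs b (RtoC s) x) t
    (scal (RtoC (Rpower t (b - 1))) (Rs (RtoC t) x)).
Proof.
  intros Ht.
  pose proof (deriv_frac_curve RtoC t (RtoC 1) (RtoC 1) x (or_introl Ht)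
    (locally_Om_pos t Ht) (deriv_RtoC t)) as H.
  apply (deriv_eq (V := X)) with (scal (RtoC 1 * Cpower t (b - 1))%C (Rs (RtoC 1 * RtoC t)%C x)).
  - apply (deriv_ext_loc (V := X)) with (2 := H). apply filter_forall. intros s.
    unfold frac_prim. now rewrite Cmult_1_l.
  - rewrite Cmult_1_l, (Cpower_RtoC t (b - 1) Ht). now rewrite Cmult_1_l.
Qed.

(** Tail estimate: the integrand is at most K |x| t^(b-2), which has the antiderivative - k t^(b-1).
    The condition b < 1 makes it vanish at infinity. *)
Lemma frac_prim_diff_le r s x : 0 < r <= s ->
  norm (minus (frac_prim Rs b (RtoC s) x) (frac_prim Rs b (RtoC r) x))
  <= K * norm x / (1 - b) * Rpower r (b - 1).
Proof.
  intros Hrs. set (k := K * norm x / (1 - b)).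
  pose proof (rf_pos _ _ _ HR) as HK. pose proof (norm_ge_0 x) as Hx.
  assert (Hk : 0 <= k).
  { unfold k. apply Rmult_le_pos; [nra|]. left. apply Rinv_0_lt_compat. lra. }
  assert (H : norm (minus (frac_prim Rs b (RtoC s) x) (frac_prim Rs b (RtoC r) x))
     <= - k * Rpower s (b - 1) - - k * Rpower r (b - 1)).
  { apply (norm_deriv_le (fun t => frac_prim Rs b (RtoC t) x)
      (fun t => scal (RtoC 1 * Cpower t (b - 1))%C (Rs (RtoC 1 * RtoC t)%C x))
      (fun t => - k * Rpower t (b - 1)) (fun t => K * norm x * Rpower t (b - 2))); [lra| | | | |].
    - intros t Ht.
      apply (deriv_eq (V := X)) with (1 := deriv_frac_prim t x ltac:(lra)).
      rewrite !Cmult_1_l, Cpower_RtoC by lra. reflexivity.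
    - intros t Ht. assert (Ht0 : 0 < t) by lra.
      apply (tends_frac_curve RtoC (fun _ => RtoC 1)); [now left|now apply locally_Om_pos| |].
      + apply deriv_RtoC.
      + apply tends_const.
    - intros t Ht.
      replace (K * norm x * Rpower t (b - 2)) with (- k * ((b - 1) * Rpower t (b - 1 - 1))).
      + apply (is_derive_scal (fun s => Rpower s (b - 1)) t (- k)).
        apply is_derive_Rpower. lra.
      + unfold k. replace (b - 1 - 1) with (b - 2) by ring. field. lra.
    - intros t Ht. apply (ex_derive_continuous (V := R_NormedModule)).
      eexists. apply (is_derive_scal (fun s => Rpower s (b - 2)) t (K * norm x)).
      apply is_derive_Rpower. lra.
    - intros t Ht. rewrite !Cmult_1_l, Cpower_RtoC by lra.
      apply Rle_trans with (1 := norm_scalR (V := X) _ _).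
      rewrite Rabs_pos_eq by (left; apply exp_pos).
      pose proof (rf_bound _ _ _ HR (RtoC t) x ltac:(apply (rf_ray _ _ _ HR); lra)) as Hbd.
      rewrite Cmod_R, Rabs_pos_eq in Hbd by lra.
      replace (b - 1) with (b - 2 + 1) by ring. rewrite Rpower_plus, Rpower_1 by lra.
      pose proof (exp_pos ((b - 2) * ln t)) as Hep. fold (Rpower t (b - 2)) in Hep.
      replace (K * norm x * Rpower t (b - 2)) with (Rpower t (b - 2) * t * (K * norm x / t))
        by (field; lra).
      apply Rmult_le_compat_l; [nra|].
      apply Rle_trans with (1 := Hbd). unfold Rdiv.
      replace (K * norm x * / t) with (K * / t * norm x) by ring.
      apply Rmult_le_compat_r; [exact Hx|]. apply Rmult_le_compat_l; [lra|].
      apply Rinv_le_contravar; lra. }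
  pose proof (exp_pos ((b - 1) * ln s)) as Hep. fold (Rpower s (b - 1)) in Hep. nra.
Qed.

Lemma frac_int_spec x :
  tends (Rbar_locally p_infty) (fun r => frac_prim Rs b (RtoC r) x) (frac_int Rs b x).
Proof.
  apply (epsilon_spec (inhabits zero)
    (tends (Rbar_locally p_infty) (fun r => frac_prim Rs b (RtoC r) x))).
  destruct (proj1 (@filterlim_locally_cauchy R X (Rbar_locally p_infty) _
     (fun r => frac_prim Rs b (RtoC r) x))) as [l Hl].
  - intros eps.
    destruct (Rpower_neg_lim (K * norm x / (1 - b)) (1 - b) ltac:(lra) (eps / 2)
      ltac:(destruct eps; simpl; lra)) as [N HN].
    exists (fun r => N + 1 < r). split; [now exists (N + 1)|].
    intros u v Hu Hv. apply (norm_compat1 (V := X)).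
    pose proof (HN (N + 1) ltac:(lra)) as [HN0 HN1].
    replace (- (1 - b)) with (b - 1) in HN1 by ring.
    pose proof (frac_prim_diff_le (N + 1) u x ltac:(lra)) as H1.
    pose proof (frac_prim_diff_le (N + 1) v x ltac:(lra)) as H2.
    apply Rle_lt_trans with (1 := norm_minus_triangle (V := X) _ (frac_prim Rs b (RtoC (N + 1)) x) _).
    rewrite (norm_minus_sym (V := X) _ (frac_prim Rs b (RtoC u) x)).
    apply Rle_lt_trans with (1 := Rplus_le_compat _ _ _ _ H2 H1). lra.
  - exists l. apply (tends_filterlim (V := X)). exact Hl.
Qed.

Lemma frac_int_unique x y :
  tends (Rbar_locally p_infty) (fun r => frac_prim Rs b (RtoC r) x) y -> frac_int Rs b x = y.
Proof.
  intros H. exact (tends_unique (V := X) _ _ _ (frac_int_spec x) H).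
Qed.

Lemma frac_int_plus x y : frac_int Rs b (plus x y) = plus (frac_int Rs b x) (frac_int Rs b y).
Proof.
  apply frac_int_unique.
  apply (tends_ext (V := X)) with (2 := tends_plus (V := X) _ _ _ _ (frac_int_spec x) (frac_int_spec y)).
  apply filter_imp with (2 := Rbar_locally_ge). intros r Hr.
  unfold frac_prim. rewrite (frac_mean_plus HR b (proj1 Hb)) by now apply (rf_ray _ _ _ HR).
  lin_ring X.
Qed.

Lemma frac_int_scal c x : frac_int Rs b (scal c x) = scal c (frac_int Rs b x).
Proof.
  apply frac_int_unique.
  apply (tends_ext (V := X)) with (2 := tends_scal (V := X) _ _ _ _ (tends_const (V := C_NormedModule) c) (frac_int_spec x)).
  apply filter_imp with (2 := Rbar_locally_ge). intros r Hr.
  unfold frac_prim. rewrite (frac_mean_scal HR b (proj1 Hb)) by now apply (rf_ray _ _ _ HR).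
  lin_ring X.
Qed.

(** Up to 1 the direct bound of [frac_mean] is used, beyond 1 the tail estimate started at 1. The
    bound on all truncations is kept because [tends_apply] needs it in the product formula. *)
Lemma frac_int_bound : exists KI, 0 <= KI /\
  (forall x, norm (frac_int Rs b x) <= KI * norm x) /\
  (forall x r, 0 < r -> norm (frac_prim Rs b (RtoC r) x) <= KI * norm x).
Proof.
  pose proof (rf_pos _ _ _ HR) as HK.
  assert (Hb1 : 0 < / b) by now apply Rinv_0_lt_compat.
  assert (Hb2 : 0 < / (1 - b)) by (apply Rinv_0_lt_compat; lra).
  set (KI := / b * K + K * / (1 - b)).
  assert (HKI : 0 <= KI) by (unfold KI; nra).
  assert (Hr : forall x r, 0 < r -> norm (frac_prim Rs b (RtoC r) x) <= KI * norm x).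
  { intros x r Hr. pose proof (norm_ge_0 x) as Hx.
    assert (H1 : forall s, 0 < s <= 1 -> norm (frac_prim Rs b (RtoC s) x) <= / b * K * norm x).
    { intros s Hs. unfold frac_prim. rewrite Cpower_RtoC by lra.
      apply Rle_trans with (1 := norm_scalR (V := X) _ _).
      pose proof (Rpower_le1 s b Hs ltac:(lra)). rewrite Rabs_pos_eq by lra.
      pose proof (frac_mean_bound HR b (proj1 Hb) (RtoC s) x
        ltac:(apply (rf_ray _ _ _ HR); lra)) as Hf.
      pose proof (norm_ge_0 (frac_mean Rs b (RtoC s) x)). nra. }
    assert (0 <= K * / (1 - b) * norm x) by (apply Rmult_le_pos; nra).
    destruct (Rle_or_lt r 1) as [Hr1|Hr1].
    - specialize (H1 r ltac:(lra)). unfold KI. lra.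
    - specialize (H1 1 ltac:(lra)).
      pose proof (frac_prim_diff_le 1 r x ltac:(lra)) as H2.
      replace (Rpower 1 (b - 1)) with 1 in H2 by (unfold Rpower; now rewrite ln_1, Rmult_0_r, exp_0).
      replace (frac_prim Rs b (RtoC r) x) with
        (plus (minus (frac_prim Rs b (RtoC r) x) (frac_prim Rs b (RtoC 1) x))
              (frac_prim Rs b (RtoC 1) x)) by lin_ring X.
      apply Rle_trans with (1 := norm_plus_le (V := X) _ _).
      apply Rle_trans with (1 := Rplus_le_compat _ _ _ _ H2 H1).
      unfold KI. right. field. lra. }
  exists KI. repeat split; [exact HKI| |exact Hr].
  intros x. apply (tends_norm_le (V := X) _ _ _ _ (frac_int_spec x)).
  exists 0. intros r Hr0. now apply Hr.
Qed.

Lemma frac_int_minus x y : frac_int Rs b (minus x y) = minus (frac_int Rs b x) (frac_int Rs b y).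
Proof.
  replace (minus x y) with (plus x (scal (RtoC (-1)) y)) by lin_ring X.
  rewrite frac_int_plus, frac_int_scal. lin_ring X.
Qed.

(* Compare [l] with its real part along a vertical segment. *)
Lemma frac_prim_vertical l x :
  0 < Re l -> Rabs (Im l) <= Re l ->
  (forall t, 0 <= t <= 1 -> Om (Re l, t * Im l)) ->
  norm (minus (frac_prim Rs b l x) (frac_prim Rs b (RtoC (Re l)) x))
  <= K * norm x * Rpower (Re l) (b - 1).
Proof.
  intros Hre Him HOm.
  set (cl := fun t => Rmax 0 (Rmin t 1)).
  set (z := fun t : R => (Re l, t * Im l) : C).
  pose proof (rf_pos _ _ _ HR) as HK. pose proof (norm_ge_0 x) as Hx.
  assert (Hdz : forall t, deriv (V := C_NormedModule) z t (0, Im l)).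
  { intros t. apply deriv_C_intro; simpl.
    - apply (is_derive_const (Re l) t).
    - auto_derive; [easy|ring]. }
  (* Clamping keeps the argument in [Om] for all real [t], as [cts] is a global condition. *)
  set (F := fun t => scal (Cpower (z (cl t)) b) (frac_mean Rs b (RtoC 1 * z (cl t))%C x)).
  set (dF := fun t => scal ((0, Im l) * Cpower (z (cl t)) (b - 1))%C (Rs (RtoC 1 * z (cl t))%C x)).
  assert (Hcl : forall t, 0 <= cl t <= 1).
  { intros t. unfold cl. split; [apply Rmax_l|]. apply Rmax_lub; [lra|apply Rmin_r]. }
  assert (Hclid : forall t, 0 <= t <= 1 -> cl t = t).
  { intros t Ht. unfold cl. rewrite Rmin_left, Rmax_right; lra. }
  assert (Hclc : forall t, filterlim cl (locally t) (locally (cl t))).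
  { intros t P [eps HP]. apply locally_R_intro with (1 := cond_pos eps). intros s Hs.
    apply HP. change (Rabs (cl s - cl t) < eps). apply Rle_lt_trans with (2 := Hs).
    unfold cl, Rmax, Rmin.
    repeat destruct Rle_dec; unfold Rabs; repeat destruct Rcase_abs; lra. }
  assert (HOm' : forall t, Om (RtoC 1 * z (cl t))%C).
  { intros t. rewrite Cmult_1_l. apply HOm, Hcl. }
  assert (Hoff : forall t, off_cut (z t)) by (intros t; now left).
  assert (Hzt : forall t, tends (V := C_NormedModule) (locally t) (fun s => z (cl s)) (z (cl t))).
  { intros t. exact (tends_comp (V := C_NormedModule) _ _ z cl _
      (deriv_tends (V := C_NormedModule) _ _ _ (Hdz (cl t))) (Hclc t)). }
  assert (Hpow : forall a t, tends (V := C_NormedModule) (locally t)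
      (fun s => Cpower (z (cl s)) a) (Cpower (z (cl t)) a)).
  { intros a t. exact (tends_comp (V := C_NormedModule) _ _ (fun s => Cpower (z s) a) cl _
      (deriv_tends (V := C_NormedModule) _ _ _ (deriv_Cpower z _ _ a (Hoff _) (Hdz (cl t))))
      (Hclc t)). }
  assert (Hz1 : forall t, tends (V := C_NormedModule) (locally t)
      (fun s => (RtoC 1 * z (cl s))%C) (RtoC 1 * z (cl t))%C).
  { intros t. apply tends_Cmult; [apply locally_filter|apply tends_const|apply Hzt]. }
  (* The quadratic estimate gives continuity of [frac_mean]: an increment d of the argument changes
     it by at most (k1 |d| + |H'|) |d|. *)
  assert (HF : cts F).
  { intros t. apply (tends_scal (V := X)); [apply Hpow|].
    apply (tends_le (V := X)) with (fun s =>
       (/ b * K ^ 3 * norm x * Cmod (RtoC 1 * z (cl s) - RtoC 1 * z (cl t))%C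
         + norm (frac_mean' Rs b (RtoC 1 * z (cl t))%C x))
        * Cmod (RtoC 1 * z (cl s) - RtoC 1 * z (cl t))%C).
    - apply filter_forall. intros s.
      pose proof (frac_mean_quadratic HR b (proj1 Hb) _ _ x (HOm' t) (HOm' s)) as Hq.
      set (d := (RtoC 1 * z (cl s) - RtoC 1 * z (cl t))%C) in *.
      set (A := frac_mean Rs b (RtoC 1 * z (cl s))%C x) in *.
      set (B := frac_mean Rs b (RtoC 1 * z (cl t))%C x) in *.
      set (D := frac_mean' Rs b (RtoC 1 * z (cl t))%C x) in *.
      apply Rle_trans with (norm (plus (minus (minus A B) (scal d D)) (scal d D))).
      { right. apply (f_equal (norm (V := X))). lin_ring X. }
      apply Rle_trans with (1 := norm_plus_le (V := X) (minus (minus A B) (scal d D)) (scal d D)).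
      apply Rle_trans with (1 := Rplus_le_compat _ _ _ _ Hq (norm_scalC (V := X) d D)).
      right. ring.
    - intros eps Heps.
      set (k := / b * K ^ 3 * norm x + norm (frac_mean' Rs b (RtoC 1 * z (cl t))%C x)).
      assert (Hb1 : 0 < / b) by now apply Rinv_0_lt_compat.
      assert (Hk1 : 0 <= / b * K ^ 3 * norm x).
      { apply Rmult_le_pos; [|exact Hx]. apply Rmult_le_pos; [lra|]. apply pow_le. lra. }
      pose proof (norm_ge_0 (frac_mean' Rs b (RtoC 1 * z (cl t))%C x)) as Hk2.
      assert (Hk : 0 <= k) by (unfold k; lra).
      (* The minimum with 1 makes |d| at most 1, which turns the quadratic bound into the linear one
         k |d|. *)
      assert (He : 0 < Rmin 1 (eps / (k + 1))).
      { apply Rmin_glb_lt; [lra|]. apply Rdiv_lt_0_compat; lra. }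
      apply filter_imp with (2 := Hz1 t _ He). intros s Hs.
      change (Cmod (RtoC 1 * z (cl s) - RtoC 1 * z (cl t))%C < Rmin 1 (eps / (k + 1))) in Hs.
      set (d := Cmod (RtoC 1 * z (cl s) - RtoC 1 * z (cl t))%C) in *.
      pose proof (Rmin_l 1 (eps / (k + 1))). pose proof (Rmin_r 1 (eps / (k + 1))).
      assert (Hd0 : 0 <= d) by apply Cmod_ge_0.
      assert (Hdk : d * (k + 1) < eps).
      { replace eps with (eps / (k + 1) * (k + 1)) by (field; lra).
        apply Rmult_lt_compat_r; lra. }
      apply Rle_lt_trans with (k * d); [|nra].
      apply Rmult_le_compat_r; [exact Hd0|]. unfold k. nra. }
  assert (HdF : cts dF).
  { intros t. apply (tends_scal (V := X)).
    - apply tends_Cmult; [apply locally_filter|apply tends_const|apply Hpow].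
    - apply (rf_tends HR); [apply locally_filter| | | |].
      + apply filter_forall. intros s. apply HOm'.
      + apply HOm'.
      + apply Hz1.
      + apply tends_const. }
  assert (E : integral dF 0 1 = minus (F 1) (F 0)).
  { apply (integral_deriv_open F dF 0 1); [lra| |exact HF|exact HdF].
    intros t Ht. assert (Hloc : locally t (fun s => 0 < s < 1)).
    { apply locally_R_intro with (Rmin t (1 - t)); [apply Rmin_glb_lt; lra|].
      intros s Hs. apply Rabs_def2 in Hs.
      pose proof (Rmin_l t (1 - t)). pose proof (Rmin_r t (1 - t)). lra. }
    unfold dF. rewrite Hclid by lra.
    apply (deriv_ext_loc (V := X)) with (fun s => scal (Cpower (z s) b)
      (frac_mean Rs b (RtoC 1 * z s)%C x)).
    - apply filter_imp with (2 := Hloc). intros s Hs. unfold F. now rewrite Hclid by lra.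
    - apply deriv_frac_curve; [apply Hoff| |apply Hdz].
      apply filter_imp with (2 := Hloc). intros s Hs. rewrite Cmult_1_l. apply HOm. lra. }
  assert (E1 : F 1 = frac_prim Rs b l x).
  { unfold F, frac_prim. rewrite Hclid by lra. unfold z. rewrite Rmult_1_l, Cmult_1_l.
    now rewrite <- C_eta. }
  assert (E0 : F 0 = frac_prim Rs b (RtoC (Re l)) x).
  { unfold F, frac_prim. rewrite Hclid by lra. unfold z. rewrite Rmult_0_l, Cmult_1_l.
    reflexivity. }
  rewrite <- E1, <- E0.
  apply Rle_trans with (norm (integral dF 0 1)); [right; now rewrite E|].
  replace (K * norm x * Rpower (Re l) (b - 1))
    with ((1 - 0) * (K * norm x * Rpower (Re l) (b - 1))) by ring.
  apply norm_integral_le_const; [lra|exact HdF|]. intros t Ht.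
  unfold dF. rewrite Hclid by lra.
  apply Rle_trans with (1 := norm_scalC (V := X) _ _).
  rewrite Cmod_mult, Cmod_Cpower.
  pose proof (rf_bound _ _ _ HR (RtoC 1 * z t)%C x) as Hbd.
  rewrite Cmult_1_l in *. specialize (Hbd (HOm t Ht)).
  assert (Hrm : Re l <= Cmod (z t)).
  { apply Rle_trans with (1 := Rle_abs _). exact (Re_le_Cmod (z t)). }
  assert (Hi : Cmod (0, Im l) = Rabs (Im l)).
  { unfold Cmod; simpl. rewrite <- sqrt_Rsqr_abs. f_equal. unfold Rsqr. ring. }
  rewrite Hi.
  (* The exponent b - 1 is negative, so the power decreases with the modulus. *)
  assert (Hp1 : Rpower (Cmod (z t)) (b - 1) <= Rpower (Re l) (b - 1)).
  { replace (b - 1) with (- (1 - b)) by ring. rewrite !Rpower_Ropp.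
    apply Rinv_le_contravar; [apply exp_pos|]. apply Rle_Rpower_l; lra. }
  assert (Hp0 : 0 < Rpower (Cmod (z t)) (b - 1)) by apply exp_pos.
  (* The length |Im l| of the segment is at most Re l, hence at most |z t|, and is absorbed by the
     decay of the resolvent. *)
  assert (Hfin : Rabs (Im l) * norm (Rs (z t) x) <= K * norm x).
  { apply Rle_trans with (Re l * (K / (1 + Cmod (z t)) * norm x)).
    - apply Rmult_le_compat; trivial; [apply Rabs_pos|apply norm_ge_0].
    - replace (Re l * (K / (1 + Cmod (z t)) * norm x))
        with (Re l / (1 + Cmod (z t)) * (K * norm x)) by (field; lra).
      rewrite <- (Rmult_1_l (K * norm x)) at 2.
      apply Rmult_le_compat_r; [nra|].
      apply Rmult_le_reg_r with (1 + Cmod (z t)); [lra|].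
      unfold Rdiv. rewrite Rmult_assoc, Rinv_l by lra. lra. }
  pose proof (Rabs_pos (Im l)). pose proof (norm_ge_0 (Rs (z t) x)).
  replace (Rabs (Im l) * Rpower (Cmod (z t)) (b - 1) * norm (Rs (z t) x))
    with (Rabs (Im l) * norm (Rs (z t) x) * Rpower (Cmod (z t)) (b - 1)) by ring.
  apply Rmult_le_compat; nra.
Qed.

End FracInt.

(** * The contour integral *)

Lemma filterlim_pinfty_gt {T} (F : (T -> Prop) -> Prop) (f : T -> R) :
  filterlim f F (Rbar_locally p_infty) -> forall k, F (fun t => k < f t).
Proof. intros H k. apply (H (fun y => k < y)). now exists k. Qed.

Lemma filterlim_Im_gt {T} (F : (T -> Prop) -> Prop) {FF : Filter F} (f : T -> C) (l : C) :
  filterlim f F (locally l) -> forall eps, 0 < eps ->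
  F (fun t => Rabs (Im (f t) - Im l) < eps).
Proof.
  intros H eps Heps. apply (H (fun y => Rabs (Im y - Im l) < eps)).
  exists (mkposreal eps Heps). intros y [_ Hy]. exact Hy.
Qed.

(* One end of a contour: [e] is 1 at [+oo] and -1 at [-oo]. *)
Lemma contour_end (F : (R -> Prop) -> Prop) {FF : Filter F} psi r0 (g : R -> C) e :
  0 < psi < PI / 4 -> 0 < r0 -> e = 1 \/ e = -1 ->
  (forall t, contour_region psi r0 (g t)) ->
  filterlim (fun t => Cmod (g t)) F (Rbar_locally p_infty) ->
  filterlim (fun t => Cdiv (g t) (RtoC (Cmod (g t)))) F (locally (Ccis (e * psi))) ->
  F (fun t => 0 < e * Im (g t) /\ 0 < Re (g t) /\ Rabs (Im (g t)) <= Re (g t)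
              /\ Rabs (Carg (g t)) <= psi)
  /\ filterlim (fun t => Re (g t)) F (Rbar_locally p_infty).
Proof.
  intros Hpsi Hr0 He Hreg Hinf Hdir.
  pose proof PI_RGT_0 as HPI.
  assert (Hsin : 0 < sin psi) by (apply sin_gt_0; lra).
  assert (Hcos : 0 < cos psi) by (apply cos_gt_0; lra).
  (* From psi < pi / 4; this gives |Im| <= Re in the sector, as [frac_prim_vertical] requires. *)
  assert (Hsc : sin psi <= cos psi).
  { rewrite <- cos_shift. apply cos_decr_1; lra. }
  assert (Hes : Im (Ccis (e * psi)) = e * sin psi).
  { unfold Ccis; simpl. destruct He as [-> | ->]; [f_equal; ring_simplify (1 * psi); ring|].
    replace (-1 * psi) with (- psi) by ring. rewrite sin_neg. ring. }
  (* Outside the disc of radius r0 only the sector alternative of the contour region remains. *)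
  assert (Hpol : forall t, r0 < Cmod (g t) -> Rabs (Carg (g t)) <= psi /\
     cos psi * Cmod (g t) <= Re (g t) /\ Rabs (Im (g t)) <= sin psi * Cmod (g t)).
  { intros t Ht. destruct (Hreg t) as [[Ha|Ha] _]; [|lra].
    split; [exact Ha|].
    assert (Hz : g t <> RtoC 0) by (intros E; rewrite E, Cmod_0 in Ht; lra).
    pose proof (polar_form _ Hz) as Ep.
    assert (ER : Re (g t) = Cmod (g t) * cos (Carg (g t))).
    { rewrite Ep at 1. unfold Ccis; simpl. ring. }
    assert (EI : Im (g t) = Cmod (g t) * sin (Carg (g t))).
    { rewrite Ep at 1. unfold Ccis; simpl. ring. }
    assert (Hc : cos psi <= cos (Carg (g t))).
    { replace (cos (Carg (g t))) with (cos (Rabs (Carg (g t)))).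
      - apply cos_decr_1; try lra; pose proof (Rabs_pos (Carg (g t))); lra.
      - unfold Rabs. destruct Rcase_abs; [apply cos_neg|reflexivity]. }
    assert (Hs : Rabs (sin (Carg (g t))) <= sin psi).
    { apply Rabs_le_between in Ha.
      apply Rabs_le_between. split.
      - rewrite <- sin_neg. apply sin_incr_1; lra.
      - apply sin_incr_1; lra. }
    rewrite ER, EI, Rabs_mult, (Rabs_pos_eq (Cmod _)) by lra.
    pose proof (Rabs_pos (sin (Carg (g t)))). split; nra. }
  split.
  (* The imaginary part of the direction tends to e sin psi, so a tolerance of sin psi fixes its
     sign. *)
  - pose proof (filter_and _ _ (filterlim_pinfty_gt F _ Hinf r0)
      (filterlim_Im_gt F _ _ Hdir (sin psi) Hsin)) as H.
    apply filter_imp with (2 := H). intros t [Ht1 Ht2].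
    destruct (Hpol t Ht1) as [H1 [H2 H3]].
    split; [|split; [nra|split; [|exact H1]]].
    + rewrite Hes in Ht2.
      assert (E : Im (g t / RtoC (Cmod (g t)))%C = Im (g t) * / Cmod (g t)).
      { unfold Cdiv. rewrite <- RtoC_inv by lra. simpl. unfold Re, Im. ring. }
      rewrite E in Ht2. apply Rabs_def2 in Ht2.
      assert (Hi : 0 < e * (Im (g t) * / Cmod (g t))).
      { destruct He as [-> | ->]; lra. }
      replace (e * Im (g t)) with (e * (Im (g t) * / Cmod (g t)) * Cmod (g t)) by (field; lra).
      apply Rmult_lt_0_compat; lra.
    + apply Rle_trans with (1 := H3). nra.
  - intros P [N HP].
    pose proof (filter_and _ _ (filterlim_pinfty_gt F _ Hinf r0)
      (filterlim_pinfty_gt F _ Hinf (N / cos psi))) as H.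
    apply filter_imp with (2 := H). intros t [Ht1 Ht2].
    destruct (Hpol t Ht1) as [_ [H2 _]]. apply HP.
    apply Rlt_le_trans with (2 := H2).
    replace N with (cos psi * (N / cos psi)) by (field; lra).
    now apply Rmult_lt_compat_l.
Qed.

Lemma Carg_segment_le z t : 0 < Re z -> 0 < t <= 1 ->
  Rabs (Carg (Re z, t * Im z)) <= Rabs (Carg z).
Proof.
  intros Hz Ht. rewrite !Carg_right by easy.
  change (Re (Re z, t * Im z)) with (Re z). change (Im (Re z, t * Im z)) with (t * Im z).
  replace (t * Im z / Re z) with (t * (Im z / Re z)) by (unfold Rdiv; ring).
  set (u := Im z / Re z).
  assert (Hmono : forall p q, p <= q -> atan p <= atan q).
  { intros p q [H|H]; [left; now apply atan_increasing|right; now rewrite H]. }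
  destruct (Rle_or_lt 0 u) as [Hu|Hu].
  - pose proof (Hmono 0 (t * u) ltac:(nra)). pose proof (Hmono (t * u) u ltac:(nra)).
    rewrite atan_0 in *. rewrite !Rabs_pos_eq by lra. lra.
  - pose proof (Hmono (t * u) 0 ltac:(nra)). pose proof (Hmono u (t * u) ltac:(nra)).
    rewrite atan_0 in *. rewrite !Rabs_left1 by lra. lra.
Qed.

Section ContourIntegral.
Context {X : CompleteNormedModule C_AbsRing} {Om : C -> Prop} {Rs : C -> X -> X} {K : R}.
Hypothesis HR : resolvent_family Om Rs K.
Context (b : R) (Hb : 0 < b < 1).

(** Far out, the primitive at g(t) differs from its value at Re g(t) by O((Re g)^(b-1)), so it tends
    to the integral over the ray. Passing from g to - g adds the phase of the half-plane. *)
Lemma frac_prim_contour_end (F : (R -> Prop) -> Prop) {FF : Filter F} psi r0 (g : R -> C) e x :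
  0 < psi < PI / 4 -> 0 < r0 -> e = 1 \/ e = -1 ->
  (forall z, contour_region psi r0 z -> Om z) ->
  (forall t, contour_region psi r0 (g t)) ->
  filterlim (fun t => Cmod (g t)) F (Rbar_locally p_infty) ->
  filterlim (fun t => Cdiv (g t) (RtoC (Cmod (g t)))) F (locally (Ccis (e * psi))) ->
  tends F (fun t => scal (Cpower (- g t)%C b) (frac_mean Rs b (g t) x))
    (scal (Ccis (- e * (b * PI))) (frac_int Rs b x)).
Proof.
  intros Hpsi Hr0 He HOm Hreg Hinf Hdir.
  destruct (contour_end F psi r0 g e Hpsi Hr0 He Hreg Hinf Hdir) as [Hend Hre].
  assert (Hphi : tends F (fun t => frac_prim Rs b (g t) x) (frac_int Rs b x)).
  { intros eps Heps.
    assert (H1 := tends_comp (V := X) _ _ (fun r => frac_prim Rs b (RtoC r) x) (fun t => Re (g t)) _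
      (frac_int_spec HR b Hb x) Hre (eps / 2) ltac:(lra)).
    destruct (Rpower_neg_lim (K * norm x) (1 - b) ltac:(lra) (eps / 2) ltac:(lra)) as [N HN].
    pose proof (filter_and _ _ (filter_and _ _ H1 Hend) (filterlim_pinfty_gt F _ Hre N)) as H.
    apply filter_imp with (2 := H). intros t [[Ht1 [Ht2 [Ht3 [Ht4 Ht5]]]] Ht6].
    destruct (HN _ Ht6) as [_ HN2]. replace (- (1 - b)) with (b - 1) in HN2 by ring.
    assert (Hv := frac_prim_vertical HR b Hb (g t) x Ht3 Ht4).
    apply Rle_lt_trans with (1 := norm_minus_triangle (V := X) _
       (frac_prim Rs b (RtoC (Re (g t))) x) _).
    apply Rle_lt_trans with (K * norm x * Rpower (Re (g t)) (b - 1)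
      + norm (minus (frac_prim Rs b (RtoC (Re (g t))) x) (frac_int Rs b x))).
    - apply Rplus_le_compat_r. apply Hv. intros u Hu.
      (* The foot of the vertical segment is on the positive axis, which the contour region
         excludes; there [rf_ray] applies instead. *)
      destruct (Req_dec u 0) as [->|Hu0].
      + rewrite Rmult_0_l. apply (rf_ray _ _ _ HR). lra.
      + apply HOm. split.
        * left. apply Rle_trans with (2 := Ht5). apply Carg_segment_le; lra.
        * simpl. intros [H0 _].
          apply Rmult_integral in H0. destruct H0 as [H0|H0]; [lra|].
          rewrite H0 in Ht2. lra.
    - replace eps with (eps / 2 + eps / 2) by field.
      apply Rplus_lt_compat; [exact HN2|exact Ht1]. }
  apply (tends_ext (V := X)) with (fun t => scal (Ccis (- e * (b * PI))) (frac_prim Rs b (g t) x)).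
  - apply filter_imp with (2 := Hend). intros t [Ht2 _]. unfold frac_prim.
    destruct He as [-> | ->].
    + rewrite Cpower_opp_upper by lra. replace (- (1) * (b * PI)) with (- (b * PI)) by ring.
      lin_ring X.
    + rewrite Cpower_opp_lower by lra. replace (- (-1) * (b * PI)) with (b * PI) by ring.
      lin_ring X.
  - apply (tends_scal (V := X)); [apply tends_const|exact Hphi].
Qed.

Lemma Ccis_diff t : (Ccis t - Ccis (- t) = RtoC (2 * sin t) * Ci)%C.
Proof.
  unfold Ccis, RtoC, Ci, Cminus, Cplus, Copp, Cmult; simpl.
  rewrite cos_neg, sin_neg. f_equal; ring.
Qed.

Lemma contour_integral_frac_int psi r0 (g dg : R -> C) x :
  0 < psi < PI / 4 -> 0 < r0 ->
  (forall z, contour_region psi r0 z -> Om z) -> contour psi r0 g dg ->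
  is_contour_integral g dg (fun l => scal (Cpower (- l)%C (b - 1)) (Rs l x))
    (scal (RtoC (2 * sin (b * PI)) * Ci)%C (frac_int Rs b x)).
Proof.
  intros Hpsi Hr0 HOm [Hd [Hdc [Hreg [Hm [Hp [Hdm Hdp]]]]]].
  assert (Hgd : forall t, deriv (V := C_NormedModule) g t (dg t)).
  { intros t. now apply is_derive_C_R. }
  assert (Hdgc : forall t, tends (V := C_NormedModule) (locally t) dg (dg t)).
  { intros t. exact (proj2 (tends_filterlim (V := C_NormedModule) dg (dg t)) (Hdc t)). }
  set (z := fun t => (- g t)%C).
  assert (Hzg : forall t, (RtoC (-1) * z t = g t)%C).
  { intros t. unfold z. replace (RtoC (-1)) with (- RtoC 1)%C; [ring|].
    rewrite <- RtoC_opp. f_equal. }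
  assert (Hzd : forall t, deriv (V := C_NormedModule) z t (- dg t)%C).
  { intros t. apply (deriv_eq (V := C_NormedModule)) with (- RtoC 1 * dg t)%C;
      [|change (- RtoC 1 * dg t = - dg t)%C; ring].
    apply (deriv_ext_loc (V := C_NormedModule)) with (fun s => (- RtoC 1 * g s)%C).
    { apply filter_forall. intros s. unfold z. change (- RtoC 1 * g s = - g s)%C. ring. }
    apply (deriv_linear (V := C_NormedModule) (W := C_NormedModule)
      (fun w => (- RtoC 1 * w)%C) (Cmod (- RtoC 1))); [| | |apply Hgd].
    - intros u v. change (- RtoC 1 * (u - v) = - RtoC 1 * u - - RtoC 1 * v)%C. ring.
    - intros u v. change (- RtoC 1 * (u * v) = u * (- RtoC 1 * v))%C. ring.
    - intros u. change (Cmod (- RtoC 1 * u) <= Cmod (- RtoC 1) * Cmod u).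
      rewrite Cmod_mult. lra. }
  assert (Hzdc : forall t, tends (V := C_NormedModule) (locally t) (fun s => (- dg s)%C) (- dg t)%C).
  { intros t. exact (tends_opp (V := C_NormedModule) dg (dg t) (Hdgc t)). }
  (* A contour avoids [0, oo), so its negative avoids the cut of the principal power. *)
  assert (Hoff : forall t, off_cut (z t)).
  { intros t. destruct (Hreg t) as [_ Hc]. unfold off_cut, z.
    replace (Re (- g t)) with (- Re (g t)) by now destruct (g t).
    replace (Im (- g t)) with (- Im (g t)) by now destruct (g t).
    destruct (Req_dec (Im (g t)) 0) as [H0|H0]; [|right; lra].
    left. destruct (Rlt_or_le (Re (g t)) 0) as [H1|H1]; [lra|]. now destruct Hc. }
  assert (HOmz : forall t, locally t (fun s => Om (RtoC (-1) * z s)%C)).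
  { intros t. apply filter_forall. intros s. rewrite Hzg. apply HOm, Hreg. }
  set (F := fun t => scal (Cpower (z t) b) (frac_mean Rs b (RtoC (-1) * z t)%C x)).
  set (dF := fun t => scal (- dg t * Cpower (z t) (b - 1))%C (Rs (RtoC (-1) * z t)%C x)).
  assert (HF : forall t, deriv F t (dF t)).
  { intros t. exact (deriv_frac_curve HR b Hb z t _ _ x (Hoff t) (HOmz t) (Hzd t)). }
  assert (HdF : cts dF).
  { intros t. exact (tends_frac_curve HR b z _ t _ x (Hoff t) (HOmz t) (Hzd t) (Hzdc t)). }
  (* The primitive is written in z = - g, so dz = - dg and the end points appear in reversed
     order. *)
  assert (HI : forall u v, is_RInt (V := restrict_scalars X)
    (fun t => scal (dg t) (scal (Cpower (- g t)%C (b - 1)) (Rs (g t) x))) u v (minus (F u) (F v))).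
  { intros u v.
    replace (minus (F u) (F v)) with (opp (minus (F v) (F u))) by lin_ring X.
    apply (is_RInt_ext (V := restrict_scalars X)) with (fun t => opp (dF t)).
    - intros t _. unfold dF. rewrite Hzg. unfold z. lin_ring X.
    - apply (is_RInt_opp (V := restrict_scalars X)).
      apply (integral_deriv (X := X)); [intros t _; apply HF|intros t _; apply HdF]. }
  assert (Lm : tends (Rbar_locally m_infty) F (scal (Ccis (- (-1) * (b * PI))) (frac_int Rs b x))).
  { apply (tends_ext_all (V := X)) with (fun t => scal (Cpower (- g t)%C b) (frac_mean Rs b (g t) x)).
    - intros t. unfold F. now rewrite Hzg.
    - apply (frac_prim_contour_end (Rbar_locally m_infty) psi r0); try assumption; [now right|].
      replace (-1 * psi) with (- psi) by ring. exact Hdm. }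
  assert (Lp : tends (Rbar_locally p_infty) F (scal (Ccis (- (1) * (b * PI))) (frac_int Rs b x))).
  { apply (tends_ext_all (V := X)) with (fun t => scal (Cpower (- g t)%C b) (frac_mean Rs b (g t) x)).
    - intros t. unfold F. now rewrite Hzg.
    - apply (frac_prim_contour_end (Rbar_locally p_infty) psi r0); try assumption; [now left|].
      replace (1 * psi) with psi by ring. exact Hdp. }
  replace (- (-1) * (b * PI)) with (b * PI) in Lm by ring.
  replace (- (1) * (b * PI)) with (- (b * PI)) in Lp by ring.
  intros P HP. unfold filtermapi.
  (* The two ends carry the phases e^(i b pi) and e^(- i b pi), and their difference is 2 i sin(b
     pi). *)
  assert (L : tends (filter_prod (Rbar_locally m_infty) (Rbar_locally p_infty))
     (fun ab : R * R => minus (F (fst ab)) (F (snd ab)))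
     (scal (RtoC (2 * sin (b * PI)) * Ci)%C (frac_int Rs b x))).
  { replace (scal (RtoC (2 * sin (b * PI)) * Ci)%C (frac_int Rs b x)) with
      (minus (scal (Ccis (b * PI)) (frac_int Rs b x)) (scal (Ccis (- (b * PI))) (frac_int Rs b x)))
      by (rewrite <- Ccis_diff; lin_ring X).
    apply (tends_minus (V := X)).
    - exact (tends_comp (V := X) _ _ F fst _ Lm filterlim_fst).
    - exact (tends_comp (V := X) _ _ F snd _ Lp filterlim_snd). }
  apply (tends_filterlim (V := X)) in L.
  apply (filter_imp (fun ab : R * R => P (minus (F (fst ab)) (F (snd ab)))));
    [|exact (L P HP)].
  intros [u v] Huv. exists (minus (F u) (F v)).
  split; [apply HI|exact Huv].
Qed.

End ContourIntegral.

(** * Existence of contours *)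

(** Both coordinates grow like t^2 in modulus, so a rescaled curve has the prescribed limit
    directions. The rational term lifts the abscissa from -1 at t = 0 to about t^2 + 1, above the
    bound t^2 + 1/2 for the ordinate, which keeps the ends inside the sector. *)
Definition contour_x (t : R) : R := -1 + t ^ 2 + 2 * t ^ 2 / (1 + t ^ 2).
Definition contour_y (t : R) : R := t * sqrt (1 + t ^ 2).

Lemma contour_y_bounds e t : e = 1 \/ e = -1 -> 0 <= e * t ->
  t ^ 2 <= e * contour_y t <= t ^ 2 + / 2.
Proof.
  intros He Ht. unfold contour_y.
  assert (Hs : 0 <= sqrt (1 + t ^ 2)) by apply sqrt_pos.
  assert (Hss : sqrt (1 + t ^ 2) * sqrt (1 + t ^ 2) = 1 + t ^ 2).
  { apply sqrt_sqrt. pose proof (pow2_ge_0 t). lra. }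
  set (w := sqrt (1 + t ^ 2)) in *. set (s := e * t) in *.
  assert (Es : t ^ 2 = s ^ 2) by (unfold s; destruct He as [-> | ->]; ring).
  replace (e * (t * w)) with (s * w) by (unfold s; ring). rewrite Es in *.
  assert (s <= w) by (apply Rnot_lt_le; intros H; nra).
  split; nra.
Qed.

Lemma contour_x_bounds t : t ^ 2 - 1 <= contour_x t <= t ^ 2 + 1.
Proof.
  unfold contour_x. pose proof (pow2_ge_0 t) as H.
  assert (0 <= t ^ 2 / (1 + t ^ 2) <= 1).
  { split; [apply Rmult_le_pos; [lra|left; apply Rinv_0_lt_compat; lra]|].
    apply Rmult_le_reg_r with (1 + t ^ 2); [lra|].
    unfold Rdiv. rewrite Rmult_assoc, Rinv_l by lra. lra. }
  unfold Rdiv in *. lra.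
Qed.

Lemma contour_ratio_lim (F : (R -> Prop) -> Prop) {FF : Filter F} e :
  e = 1 \/ e = -1 -> (forall N, F (fun t => N < e * t)) ->
  filterlim (fun t => contour_y t / contour_x t) F (locally e).
Proof.
  intros He HF P [eps HP].
  pose proof (cond_pos eps) as Heps.
  assert (H2e : 0 < 2 / eps) by (apply Rdiv_lt_0_compat; lra).
  apply filter_imp with (2 := HF (2 / eps + 2)). intros t Ht. apply HP.
  change (Rabs (contour_y t / contour_x t - e) < eps).
  pose proof (contour_y_bounds e t He ltac:(lra)) as Hy.
  pose proof (contour_x_bounds t) as Hx.
  assert (Es : t ^ 2 = (e * t) ^ 2) by (destruct He as [-> | ->]; ring).
  assert (Hxl : 2 / eps < contour_x t) by nra.
  assert (E : contour_y t / contour_x t - e = e * ((e * contour_y t - contour_x t) / contour_x t)).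
  { replace (contour_y t) with (e * (e * contour_y t)) at 1 by (destruct He as [-> | ->]; ring).
    field. lra. }
  rewrite E, Rabs_mult.
  replace (Rabs e) with 1 by (destruct He as [-> | ->]; unfold Rabs; destruct Rcase_abs; lra).
  rewrite Rmult_1_l. unfold Rdiv. rewrite Rabs_mult, Rabs_inv, (Rabs_pos_eq (contour_x t)) by lra.
  apply Rmult_lt_reg_r with (contour_x t); [lra|].
  rewrite Rmult_assoc, Rinv_l, Rmult_1_r by lra.
  (* The difference lies between -1 and 3/2 by the two bounds, while the abscissa tends to
     infinity. *)
  assert (Rabs (e * contour_y t - contour_x t) < 2) by (apply Rabs_def1; lra).
  apply Rlt_trans with (1 := H).
  replace 2 with (eps * (2 / eps)) by (field; lra). now apply Rmult_lt_compat_l.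
Qed.

Lemma polar_direction (z : C) : z <> RtoC 0 -> (z / RtoC (Cmod z) = Ccis (Carg z))%C.
Proof.
  intros Hz. rewrite (polar_form z Hz) at 1. field.
  intros H. apply RtoC_inj in H. now apply Hz, Cmod_eq_0.
Qed.

Lemma contour_exists psi r0 : 0 < psi < PI / 2 -> 0 < r0 ->
  exists g dg, contour psi r0 g dg.
Proof.
  intros Hpsi Hr0. pose proof PI_RGT_0 as HPI.
  assert (Hsin : 0 < sin psi) by (apply sin_gt_0; lra).
  assert (Hcos : 0 < cos psi) by (apply cos_gt_0; lra).
  set (k := tan psi).
  assert (Hk : 0 < k) by (unfold k, tan; now apply Rdiv_lt_0_compat).
  (* For t^2 < 3 the coordinates are at most 4 and 7/2 in absolute value, so the modulus is at most
     c (4 + 7 k / 2) < r0. *)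
  set (c := r0 / (7 + 4 * k)).
  assert (Hc : 0 < c) by (apply Rdiv_lt_0_compat; lra).
  assert (Ec : c * (7 + 4 * k) = r0) by (unfold c; field; lra).
  set (g := fun t => (c * contour_x t, c * k * contour_y t) : C).
  set (dg := fun t => (c * (2 * t + 4 * t / (1 + t ^ 2) ^ 2),
                       c * k * (sqrt (1 + t ^ 2) + t ^ 2 / sqrt (1 + t ^ 2))) : C).
  assert (Hpos : forall t, 0 < 1 + t ^ 2) by (intros t; pose proof (pow2_ge_0 t); lra).
  assert (Hsq : forall t, 0 < sqrt (1 + t ^ 2)) by (intros t; now apply sqrt_lt_R0).
  assert (Hxb := contour_x_bounds).
  assert (Hatan : atan k = psi) by (apply atan_tan; lra).
  assert (Hcarg : forall t, 0 < contour_x t -> Carg (g t) = atan (k * (contour_y t / contour_x t))).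
  { intros t Ht. rewrite Carg_right; simpl; [f_equal; field; lra|nra]. }
  assert (Hinf : forall (F : (R -> Prop) -> Prop) {FF : Filter F} e, e = 1 \/ e = -1 ->
     (forall N, F (fun t => N < e * t)) ->
     F (fun t => 0 < contour_x t) /\ filterlim (fun t => Cmod (g t)) F (Rbar_locally p_infty)).
  { intros F FF e He HF.
    assert (HB : forall N, F (fun t => N < contour_x t)).
    { intros N. apply filter_imp with (2 := HF (Rabs N + 2)). intros t Ht.
      assert (Es : t ^ 2 = (e * t) ^ 2) by (destruct He as [-> | ->]; ring).
      specialize (Hxb t). pose proof (Rle_abs N). pose proof (Rabs_pos N). nra. }
    split; [apply HB|]. intros P [N HP].
    apply filter_imp with (2 := HB (N / c)). intros t Ht. apply HP.
    apply Rlt_le_trans with (2 := Re_le_Cmod (g t)).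
    apply Rlt_le_trans with (2 := Rle_abs _). simpl.
    replace N with (c * (N / c)) by (field; lra). now apply Rmult_lt_compat_l. }
  assert (Hdir : forall (F : (R -> Prop) -> Prop) {FF : Filter F} e, e = 1 \/ e = -1 ->
     (forall N, F (fun t => N < e * t)) ->
     filterlim (fun t => (g t / RtoC (Cmod (g t)))%C) F (locally (Ccis (e * psi)))).
  { intros F FF e He HF.
    assert (Hrat := contour_ratio_lim F e He HF).
    assert (Hang : filterlim (fun t => atan (k * (contour_y t / contour_x t))) F (locally (e * psi))).
    { replace (e * psi) with (atan (k * e)).
      2:{ destruct He as [-> | ->].
          - now rewrite Rmult_1_r, Hatan, Rmult_1_l.
          - replace (k * -1) with (- k) by ring. rewrite atan_opp, Hatan. ring. }
      apply (filterlim_comp _ _ _ _ (fun r => atan (k * r)) F (locally e)); [exact Hrat|].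
      apply (ex_derive_continuous (V := R_NormedModule) (fun r => atan (k * r)) e).
      auto_derive. easy. }
    apply filterlim_ext_loc with (fun t => Ccis (atan (k * (contour_y t / contour_x t)))).
    { apply filter_imp with (2 := proj1 (Hinf F FF e He HF)). intros t Ht.
      rewrite <- Hcarg by exact Ht. symmetry. apply polar_direction, off_cut_neq0.
      left. simpl. nra. }
    apply (filterlim_comp _ _ _ _ Ccis F (locally (e * psi))); [exact Hang|].
    intros P [eps HP].
    assert (C1 : continuous cos (e * psi)).
    { apply (ex_derive_continuous (V := R_NormedModule) cos). auto_derive. easy. }
    assert (C2 : continuous sin (e * psi)).
    { apply (ex_derive_continuous (V := R_NormedModule) sin). auto_derive. easy. }
    pose proof (C1 (fun y => ball (cos (e * psi)) eps y) (locally_ball _ eps)) as D1.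
    pose proof (C2 (fun y => ball (sin (e * psi)) eps y) (locally_ball _ eps)) as D2.
    unfold filtermap.
    apply (filter_imp (fun t => ball (cos (e * psi)) eps (cos t) /\ ball (sin (e * psi)) eps (sin t)));
      [|exact (filter_and (fun t => ball (cos (e * psi)) eps (cos t))
           (fun t => ball (sin (e * psi)) eps (sin t)) D1 D2)].
    intros t [H1 H2]. apply HP. now split. }
  assert (Hpinf : forall N, Rbar_locally p_infty (fun t => N < 1 * t)).
  { intros N. exists N. intros t Ht. lra. }
  assert (Hminf : forall N, Rbar_locally m_infty (fun t => N < -1 * t)).
  { intros N. exists (- N). intros t Ht. lra. }
  exists g, dg. split; [|split; [|split; [|split; [|split; [|split]]]]].
  - intros t. apply is_derive_C_R, deriv_C_intro.
    + change (is_derive (fun s => c * contour_x s) t (c * (2 * t + 4 * t / (1 + t ^ 2) ^ 2))).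
      unfold contour_x. auto_derive; [specialize (Hpos t); simpl in Hpos; lra|].
      simpl. field. specialize (Hpos t); simpl in Hpos; lra.
    + change (is_derive (fun s => c * k * contour_y s) t
        (c * k * (sqrt (1 + t ^ 2) + t ^ 2 / sqrt (1 + t ^ 2)))).
      unfold contour_y. auto_derive; [specialize (Hpos t); simpl in Hpos; lra|].
      simpl. field. specialize (Hsq t); simpl in Hsq; lra.
  - intros t.
    assert (C1 : continuous (fun t => c * (2 * t + 4 * t / (1 + t ^ 2) ^ 2)) t).
    { apply (ex_derive_continuous (V := R_NormedModule)). auto_derive.
      specialize (Hpos t). simpl in *. repeat split. nra. }
    assert (C2 : continuous (fun t => c * k * (sqrt (1 + t ^ 2) + t ^ 2 / sqrt (1 + t ^ 2))) t).
    { apply (ex_derive_continuous (V := R_NormedModule)). auto_derive.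
      specialize (Hpos t). specialize (Hsq t). simpl in *. repeat split; lra. }
    intros P [eps HP]. unfold filtermap.
    pose proof (C1 _ (locally_ball _ eps)) as D1. pose proof (C2 _ (locally_ball _ eps)) as D2.
    apply (filter_imp (fun s => ball (fst (dg t)) eps (fst (dg s))
                                /\ ball (snd (dg t)) eps (snd (dg s))));
      [|exact (filter_and (fun s => ball (fst (dg t)) eps (fst (dg s)))
           (fun s => ball (snd (dg t)) eps (snd (dg s))) D1 D2)].
    intros s [H1 H2]. apply HP. now split.
  - intros t. split.
    (* From t^2 = 3 on, the rational term is at least 3/2, so the abscissa dominates the ordinate
       and the angle is at most atan k = psi. The rest of the curve lies in the disc. *)
    + destruct (Rle_or_lt 3 (t ^ 2)) as [Ht|Ht]; [left|right].
      * assert (Hx1 : t ^ 2 + / 2 <= contour_x t).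
        { unfold contour_x. assert (3 / 4 <= t ^ 2 / (1 + t ^ 2)); [|unfold Rdiv in *; lra].
          apply Rmult_le_reg_r with (1 + t ^ 2); [lra|].
          unfold Rdiv at 2. rewrite Rmult_assoc, Rinv_l by lra. lra. }
        assert (Hy1 : Rabs (contour_y t) <= contour_x t).
        { destruct (Rle_or_lt 0 t) as [H0|H0].
          - pose proof (contour_y_bounds 1 t (or_introl eq_refl) ltac:(lra)).
            rewrite Rabs_pos_eq; nra.
          - pose proof (contour_y_bounds (-1) t (or_intror eq_refl) ltac:(lra)).
            rewrite Rabs_left1; nra. }
        assert (Hx0 : 0 < contour_x t) by lra.
        rewrite Hcarg by exact Hx0. apply Rabs_le_between in Hy1.
        assert (Hr : -1 <= contour_y t / contour_x t <= 1).
        { split; apply Rmult_le_reg_r with (contour_x t); trivial;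
            unfold Rdiv; rewrite Rmult_assoc, Rinv_l by lra; lra. }
        assert (Hmono : forall p q, p <= q -> atan p <= atan q).
        { intros p q [H|H]; [left; now apply atan_increasing|right; now rewrite H]. }
        apply Rabs_le_between. rewrite <- Hatan, <- atan_opp.
        split; apply Hmono; nra.
      * rewrite <- Ec.
        specialize (Hxb t).
        assert (Hy : Rabs (contour_y t) <= 7 / 2).
        { destruct (Rle_or_lt 0 t) as [H0|H0].
          - pose proof (contour_y_bounds 1 t (or_introl eq_refl) ltac:(lra)).
            pose proof (pow2_ge_0 t). rewrite Rabs_pos_eq; lra.
          - pose proof (contour_y_bounds (-1) t (or_intror eq_refl) ltac:(lra)).
            pose proof (pow2_ge_0 t). rewrite Rabs_left1; lra. }
        assert (Hx : Rabs (contour_x t) <= 4).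
        { pose proof (pow2_ge_0 t). apply Rabs_le. lra. }
        assert (E : g t = (RtoC (c * contour_x t) + RtoC (c * k * contour_y t) * Ci)%C).
        { unfold g, Cplus, Cmult, RtoC, Ci; simpl. f_equal; ring. }
        rewrite E. apply Rle_lt_trans with (1 := Cmod_triangle _ _).
        rewrite Cmod_mult, !Cmod_R.
        replace (Cmod Ci) with 1.
        2:{ unfold Cmod, Ci; simpl. replace (_ + _) with 1 by ring. now rewrite sqrt_1. }
        rewrite !Rabs_mult, (Rabs_pos_eq c), (Rabs_pos_eq k) by lra.
        assert (c * Rabs (contour_x t) <= c * 4) by (apply Rmult_le_compat_l; lra).
        assert (c * k * Rabs (contour_y t) <= c * k * (7 / 2))
          by (apply Rmult_le_compat_l; [nra|lra]).
        assert (0 < c * k) by nra. lra.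
    (* The curve meets the real axis only at t = 0, at the negative point - c. *)
    + intros [Hi Hr]. change (c * k * contour_y t = 0) in Hi. change (0 <= c * contour_x t) in Hr.
      assert (Ht : t = 0).
      { unfold contour_y in Hi. specialize (Hsq t).
        apply Rmult_integral in Hi. destruct Hi as [Hi|Hi]; [nra|].
        apply Rmult_integral in Hi. destruct Hi as [Hi|Hi]; [exact Hi|lra]. }
      rewrite Ht in Hr. unfold contour_x in Hr.
      replace (-1 + 0 ^ 2 + 2 * 0 ^ 2 / (1 + 0 ^ 2)) with (-1) in Hr by field. nra.
  - exact (proj2 (Hinf _ _ (-1) (or_intror eq_refl) Hminf)).
  - exact (proj2 (Hinf _ _ 1 (or_introl eq_refl) Hpinf)).
  - replace (- psi) with (-1 * psi) by ring. exact (Hdir _ _ (-1) (or_intror eq_refl) Hminf).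
  - rewrite <- (Rmult_1_l psi). exact (Hdir _ _ 1 (or_introl eq_refl) Hpinf).
Qed.

(** * The product of two fractional integrals *)

Lemma deriv_intro_loc {V : NormedModule C_AbsRing} (f phi : R -> V) t l :
  locally t (fun s => minus (f s) (f t) = scal (RtoC (s - t)) (phi s)) ->
  tends (locally t) phi l -> deriv f t l.
Proof.
  intros H1 H2. apply deriv_of_remainder. intros eps Heps.
  apply filter_imp with (2 := filter_and _ _ H1 (H2 eps Heps)). intros s [E Hs].
  apply Rle_trans with (norm (scal (RtoC (s - t)) (minus (phi s) l))).
  { right. rewrite E. apply (f_equal (norm (V := V))). lin_ring V. }
  apply Rle_trans with (1 := norm_scalR (V := V) _ _).
  rewrite (Rmult_comm eps). apply Rmult_le_compat_l; [apply Rabs_pos|lra].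
Qed.

(** Product rule for an operator family that is differentiable only on the vector y(t) and
    continuous only on dy; the uniform bound covers the cross term. *)
Lemma deriv_apply {V W : NormedModule C_AbsRing} (L : R -> V -> W) KL (y : R -> V) t dy l :
  locally t (fun s => forall u v, L s (minus u v) = minus (L s u) (L s v)) ->
  locally t (fun s => forall (c : C) v, L s (scal c v) = scal c (L s v)) ->
  locally t (fun s => forall v, norm (L s v) <= KL * norm v) ->
  tends (locally t) (fun s => L s dy) (L t dy) ->
  deriv y t dy -> deriv (fun s => L s (y t)) t l ->
  deriv (fun s => L s (y s)) t (plus (L t dy) l).
Proof.
  intros H1 H2 H3 H4 [p [Hp1 Hp2]] [q [Hq1 Hq2]].
  apply deriv_intro_loc with (fun s => plus (L s (p s)) (q s)).
  - apply filter_imp with (2 := filter_and _ _ H1 H2). intros s [E1 E2].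
    transitivity (plus (minus (L s (y s)) (L s (y t))) (minus (L s (y t)) (L t (y t)))).
    { lin_ring W. }
    rewrite <- E1, Hp1, E2, Hq1. lin_ring W.
  - apply (tends_plus (V := W)); [|exact Hq2].
    now apply (tends_apply L KL p dy).
Qed.

(** Integral bounds ask for the closed interval, whereas the decay estimate of the product kernel
    requires r < 1 and so fails to cover the end point 1. *)
Lemma closed_interval_norm_le {V : NormedModule C_AbsRing} (f : R -> V) K a b :
  a < b -> cts f -> (forall t, a < t < b -> norm (f t) <= K) ->
  forall t, a <= t <= b -> norm (f t) <= K.
Proof.
  intros Hab Hf H t Ht. apply Rnot_lt_le. intros Hlt.
  destruct (locally_R_elim _ _ (Hf t (norm (f t) - K) ltac:(lra))) as [d [Hd Hd2]].
  set (e := Rmin (d / 2) ((b - a) / 4)).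
  assert (He : 0 < e) by (apply Rmin_glb_lt; lra).
  assert (He1 : e <= d / 2) by apply Rmin_l.
  assert (He2 : e <= (b - a) / 4) by apply Rmin_r.
  assert (Hs : exists s, a < s < b /\ Rabs (s - t) < d).
  { destruct (Rle_or_lt t ((a + b) / 2)).
    - exists (t + e). split; [lra|]. rewrite Rabs_pos_eq; lra.
    - exists (t - e). split; [lra|]. rewrite Rabs_left1; lra. }
  destruct Hs as [s [Hs1 Hs2]].
  specialize (H s Hs1). specialize (Hd2 s Hs2).
  assert (norm (f t) <= norm (f s) + norm (minus (f s) (f t))); [|lra].
  apply Rle_trans with (norm (minus (f s) (minus (f s) (f t)))).
  - right. apply (f_equal (norm (V := V))). lin_ring V.
  - apply norm_minus_le.
Qed.

Lemma integral_swap {X : CompleteNormedModule C_AbsRing} (f : R -> X) a b :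
  cts f -> integral f a b = opp (integral f b a).
Proof.
  intros Hf. apply integral_unique.
  exact (is_RInt_swap (V := restrict_complete X) f a b _ (integral_correct f b a Hf)).
Qed.

(** The error depends on the Lipschitz constant only. This makes it uniform over a parameter, so the
    estimate can be integrated in [deriv_prod_mean]. *)
Lemma integral_lipschitz {X : CompleteNormedModule C_AbsRing} (w : R -> X) k t s :
  0 <= k -> cts w -> (forall a, norm (minus (w a) (w t)) <= k * Rabs (a - t)) ->
  norm (minus (integral w t s) (scal (RtoC (s - t)) (w t))) <= k * Rabs (s - t) ^ 2.
Proof.
  intros Hk Hw Hl.
  assert (Hc : cts (fun a => minus (w a) (w t))).
  { intros a. apply (tends_minus (V := X)); [apply Hw|apply tends_const]. }
  assert (E : minus (integral w t s) (scal (RtoC (s - t)) (w t))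
     = integral (fun a => minus (w a) (w t)) t s).
  { rewrite (integral_minus (X := X) w (fun _ => w t)); [|exact Hw|].
    - now rewrite integral_const.
    - intros a. apply tends_const. }
  rewrite E.
  destruct (Rle_or_lt t s) as [Hts|Hts].
  - replace (k * Rabs (s - t) ^ 2) with ((s - t) * (k * (s - t)))
      by (rewrite Rabs_pos_eq by lra; ring).
    apply norm_integral_le_const; [lra|exact Hc|]. intros a Ha.
    apply Rle_trans with (1 := Hl a). apply Rmult_le_compat_l; [exact Hk|].
    rewrite Rabs_pos_eq; lra.
  - rewrite (integral_swap (X := X)) by exact Hc. rewrite (norm_opp (V := X)).
    replace (k * Rabs (s - t) ^ 2) with ((t - s) * (k * (t - s)))
      by (rewrite Rabs_left by lra; ring).
    apply norm_integral_le_const; [lra|exact Hc|]. intros a Ha.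
    apply Rle_trans with (1 := Hl a). apply Rmult_le_compat_l; [exact Hk|].
    rewrite Rabs_left1; lra.
Qed.

(** R(a) R(r a) x for a >= 0, extended evenly to the line so that [cts] holds. *)
Definition prod_kernel {X : CompleteNormedModule C_AbsRing} (Rs : C -> X -> X)
    (x : X) (r a : R) : X := Rs (RtoC (Rabs a)) (Rs (RtoC (r * Rabs a)) x).

Definition prod_int {X : CompleteNormedModule C_AbsRing} (Rs : C -> X -> X)
    (x : X) (N r : R) : X := integral (prod_kernel Rs x r) 0 N.

(** The double integral of r^(b-1) R(a) R(r a) x over r in [0, 1] and a in [0, N], with t = r^b as
    in [frac_mean]. *)
Definition prod_mean {X : CompleteNormedModule C_AbsRing} (Rs : C -> X -> X)
    (b : R) (N : R) (x : X) : X :=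
  scal (RtoC (/ b)) (integral (fun t => prod_int Rs x N (pow01 (/ b) t)) 0 1).

Section ProductKernel.
Context {X : CompleteNormedModule C_AbsRing} {Om : C -> Prop} {Rs : C -> X -> X} {K : R}.
Hypothesis HR : resolvent_family Om Rs K.

Let HK : 0 < K := rf_pos _ _ _ HR.

Lemma Om_abs a : Om (RtoC (Rabs a)).
Proof. apply (rf_ray _ _ _ HR), Rabs_pos. Qed.

Lemma Om_mul_abs r a : 0 <= r -> Om (RtoC (r * Rabs a)).
Proof. intros Hr. apply (rf_ray _ _ _ HR). apply Rmult_le_pos; [exact Hr|apply Rabs_pos]. Qed.

Lemma tends_abs r t : tends (V := C_NormedModule) (locally t)
  (fun s => RtoC (r * Rabs s)) (RtoC (r * Rabs t)).
Proof.
  apply tends_RtoC; [|apply locally_filter]. intros eps Heps.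
  assert (H : 0 < eps / (Rabs r + 1)).
  { apply Rdiv_lt_0_compat; [exact Heps|]. pose proof (Rabs_pos r). lra. }
  apply locally_R_intro with (1 := H). intros s Hs.
  replace (r * Rabs s - r * Rabs t) with (r * (Rabs s - Rabs t)) by ring.
  rewrite Rabs_mult. pose proof (Rabs_triang_inv2 s t). pose proof (Rabs_pos r).
  pose proof (Rabs_pos (Rabs s - Rabs t)).
  apply (Rmult_lt_compat_l (Rabs r + 1)) in Hs; [|lra].
  replace ((Rabs r + 1) * (eps / (Rabs r + 1))) with eps in Hs by (field; lra). nra.
Qed.

Lemma cts_prod_kernel x r : 0 <= r -> cts (prod_kernel Rs x r).
Proof.
  intros Hr t. unfold prod_kernel.
  apply (rf_tends HR); [apply locally_filter| | | |].
  - apply filter_forall. intros s. apply Om_abs.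
  - apply Om_abs.
  - replace (RtoC (Rabs t)) with (RtoC (1 * Rabs t)) by (f_equal; ring).
    apply (tends_ext_all (V := C_NormedModule)) with (2 := tends_abs 1 t).
    intros s. f_equal; ring.
  - apply (rf_tends HR); [apply locally_filter| | | |].
    + apply filter_forall. intros s. now apply Om_mul_abs.
    + now apply Om_mul_abs.
    + apply tends_abs.
    + apply tends_const.
Qed.

Lemma prod_kernel_lipschitz x r a t : 0 <= r <= 1 ->
  norm (minus (prod_kernel Rs x r a) (prod_kernel Rs x r t))
  <= 2 * K ^ 3 * norm x * Rabs (a - t).
Proof.
  intros Hr. unfold prod_kernel. pose proof (norm_ge_0 x) as Hx.
  set (u := Rs (RtoC (r * Rabs a)) x). set (v := Rs (RtoC (r * Rabs t)) x).
  set (la := RtoC (Rabs a)). set (lt := RtoC (Rabs t)).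
  assert (Hd : Rabs (Rabs a - Rabs t) <= Rabs (a - t)) by apply Rabs_triang_inv2.
  assert (H1 : norm (minus (Rs la u) (Rs lt u)) <= Rabs (a - t) * (K ^ 2 * (K * norm x))).
  { apply Rle_trans with (1 := rf_lipschitz HR la lt u (Om_abs a) (Om_abs t)).
    apply Rmult_le_compat; [apply Cmod_ge_0| | |].
    - apply Rmult_le_pos; [apply pow2_ge_0|apply norm_ge_0].
    - unfold la, lt. rewrite <- RtoC_minus, Cmod_R, Rabs_minus_sym. exact Hd.
    - apply Rmult_le_compat_l; [apply pow2_ge_0|].
      apply (rf_bound_K HR), Om_mul_abs, Hr. }
  assert (H2 : norm (Rs lt (minus u v)) <= K * (Rabs (a - t) * (K ^ 2 * norm x))).
  { apply Rle_trans with (1 := rf_bound_K HR _ _ (Om_abs t)).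
    apply Rmult_le_compat_l; [lra|].
    apply Rle_trans with (1 := rf_lipschitz HR _ _ x (Om_mul_abs r a (proj1 Hr)) (Om_mul_abs r t (proj1 Hr))).
    apply Rmult_le_compat_r; [apply Rmult_le_pos; [apply pow2_ge_0|exact Hx]|].
    rewrite <- RtoC_minus, Cmod_R.
    replace (r * Rabs t - r * Rabs a) with (- (r * (Rabs a - Rabs t))) by ring.
    rewrite Rabs_Ropp, Rabs_mult, (Rabs_pos_eq r) by lra.
    pose proof (Rabs_pos (Rabs a - Rabs t)). nra. }
  apply Rle_trans with (norm (plus (minus (Rs la u) (Rs lt u)) (Rs lt (minus u v)))).
  { right. apply (f_equal (norm (V := X))). rewrite (rf_minus HR) by apply Om_abs. lin_ring X. }
  apply Rle_trans with (1 := norm_plus_le (V := X) _ _).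
  apply Rle_trans with (1 := Rplus_le_compat _ _ _ _ H1 H2). right. ring.
Qed.

Lemma prod_kernel_bound x r a : 0 <= r -> norm (prod_kernel Rs x r a) <= K ^ 2 * norm x / (1 + Rabs a).
Proof.
  intros Hr. unfold prod_kernel.
  apply Rle_trans with (1 := rf_bound _ _ _ HR _ _ (Om_abs a)).
  rewrite Cmod_R, Rabs_Rabsolu. pose proof (Rabs_pos a).
  replace (K ^ 2 * norm x / (1 + Rabs a)) with (K / (1 + Rabs a) * (K * norm x)) by (field; lra).
  apply Rmult_le_compat_l.
  - apply Rmult_le_pos; [lra|]. left. apply Rinv_0_lt_compat. lra.
  - apply (rf_bound_K HR), Om_mul_abs, Hr.
Qed.

Lemma prod_int_bound x N r : 0 <= N -> 0 <= r ->
  norm (prod_int Rs x N r) <= K ^ 2 * norm x * ln (1 + N).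
Proof.
  intros HN Hr.
  apply (norm_integral_le (X := X) _ (fun a => K ^ 2 * norm x / (1 + a))); [exact HN| | |].
  - now apply cts_prod_kernel.
  - intros a Ha. pose proof (prod_kernel_bound x r a Hr) as H.
    now rewrite (Rabs_pos_eq a) in H by lra.
  - replace (K ^ 2 * norm x * ln (1 + N))
      with (minus (K ^ 2 * norm x * ln (1 + N)) (K ^ 2 * norm x * ln (1 + 0))).
    2:{ rewrite Rplus_0_r, ln_1. unfold minus, plus, opp; simpl. ring. }
    apply (is_RInt_derive (V := R_CompleteNormedModule) (fun a => K ^ 2 * norm x * ln (1 + a))).
    + rewrite Rmin_left, Rmax_right by lra. intros a Ha.
      auto_derive; [lra|]. field. lra.
    + rewrite Rmin_left, Rmax_right by lra. intros a Ha.
      apply (ex_derive_continuous (V := R_NormedModule)). auto_derive. lra.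
Qed.

Lemma prod_int_diff x N r r' : 0 <= N -> 0 <= r -> 0 <= r' ->
  norm (minus (prod_int Rs x N r) (prod_int Rs x N r')) <= N * (K * (N * Rabs (r - r') * (K ^ 2 * norm x))).
Proof.
  intros HN Hr Hr'. unfold prod_int.
  rewrite <- (integral_minus (X := X)) by now apply cts_prod_kernel.
  rewrite <- (Rminus_0_r N) at 2.
  apply norm_integral_le_const; [exact HN| |].
  { intros t. apply (tends_minus (V := X)); now apply cts_prod_kernel. }
  intros a Ha. unfold prod_kernel. rewrite <- (rf_minus HR) by apply Om_abs.
  apply Rle_trans with (1 := rf_bound_K HR _ _ (Om_abs a)).
  apply Rmult_le_compat_l; [lra|].
  apply Rle_trans with (1 := rf_lipschitz HR _ _ x (Om_mul_abs r a Hr) (Om_mul_abs r' a Hr')).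
  apply Rmult_le_compat_r.
  { apply Rmult_le_pos; [apply pow2_ge_0|apply norm_ge_0]. }
  rewrite <- RtoC_minus, Cmod_R.
  replace (r' * Rabs a - r * Rabs a) with (- (Rabs a * (r - r'))) by ring.
  rewrite Rabs_Ropp, Rabs_mult, Rabs_Rabsolu, (Rabs_pos_eq a) by lra.
  apply Rmult_le_compat_r; [apply Rabs_pos|]. lra.
Qed.

Lemma cts_prod_int x N m : 0 <= N -> 0 < m -> cts (fun t => prod_int Rs x N (pow01 m t)).
Proof.
  intros HN Hm t.
  set (k := N * (K * (N * (K ^ 2 * norm x)))).
  assert (Hk : 0 <= k).
  { unfold k. pose proof (norm_ge_0 x). pose proof (pow2_ge_0 K).
    repeat apply Rmult_le_pos; lra. }
  apply (tends_le (V := X)) with (fun s => k * Rabs (pow01 m s - pow01 m t)).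
  - apply filter_forall. intros s.
    apply Rle_trans with (1 := prod_int_diff x N _ _ HN (proj1 (pow01_bounds m s Hm))
      (proj1 (pow01_bounds m t Hm))). unfold k. right. ring.
  - intros eps Heps.
    assert (H : 0 < eps / (k + 1)) by (apply Rdiv_lt_0_compat; lra).
    apply filter_imp with (2 := pow01_continuous m t Hm _ H). intros s Hs.
    pose proof (Rabs_pos (pow01 m s - pow01 m t)).
    apply (Rmult_lt_compat_l (k + 1)) in Hs; [|lra].
    replace ((k + 1) * (eps / (k + 1))) with eps in Hs by (field; lra). nra.
Qed.

Lemma prod_mean_bound b N x : 0 < b -> 0 <= N ->
  norm (prod_mean Rs b N x) <= / b * (K ^ 2 * norm x * ln (1 + N)).
Proof.
  intros Hb HN. unfold prod_mean.
  assert (Hb1 : 0 < / b) by now apply Rinv_0_lt_compat.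
  apply Rle_trans with (1 := norm_scalR (V := X) _ _).
  rewrite Rabs_pos_eq by lra. apply Rmult_le_compat_l; [lra|].
  rewrite <- (Rmult_1_l (K ^ 2 * norm x * ln (1 + N))).
  replace 1 with (1 - 0) at 2 by ring.
  apply norm_integral_le_const; [lra|now apply cts_prod_int|].
  intros t _. apply prod_int_bound; [exact HN|]. now apply pow01_bounds.
Qed.

(** Takes the place of Fubini's theorem: the derivative in the outer limit N is the r-integral at a
    = N, that is, R(N) H(N) x. *)
Lemma deriv_prod_mean b t x : 0 < b -> 0 < t ->
  deriv (fun s => prod_mean Rs b s x) t (Rs (RtoC t) (frac_mean Rs b (RtoC t) x)).
Proof.
  intros Hb Ht. assert (Hm : 0 < / b) by now apply Rinv_0_lt_compat.
  set (m := / b) in *.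
  assert (Hot : Om (RtoC t)) by (apply (rf_ray _ _ _ HR); lra).
  assert (Hcf : cts (fun s => Rs (RtoC (pow01 m s) * RtoC t)%C x)) by now apply (cts_frac_mean HR b).
  assert (Hck : cts (fun s => prod_kernel Rs x (pow01 m s) t)).
  { intros s. unfold prod_kernel. apply (rf_tends HR); [apply locally_filter| | | |].
    - apply filter_forall. intros u. apply Om_abs.
    - apply Om_abs.
    - apply tends_const.
    - apply (tends_ext_all (V := X)) with (fun u => Rs (RtoC (pow01 m u) * RtoC t)%C x).
      + intros u. rewrite <- RtoC_mult, (Rabs_pos_eq t) by lra. reflexivity.
      + replace (RtoC (pow01 m s * Rabs t)) with (RtoC (pow01 m s) * RtoC t)%C; [apply Hcf|].
        rewrite <- RtoC_mult, (Rabs_pos_eq t) by lra. reflexivity. }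
  assert (E : Rs (RtoC t) (frac_mean Rs b (RtoC t) x)
    = scal (RtoC m) (integral (fun s => prod_kernel Rs x (pow01 m s) t) 0 1)).
  { unfold frac_mean. fold m. rewrite (rf_scal _ _ _ HR) by exact Hot.
    apply (f_equal (scal (RtoC m))).
    rewrite <- (integral_linear (X := X) (Y := X) (Rs (RtoC t)) K); [|..|exact Hcf].
    - apply integral_ext. intros s _. unfold prod_kernel.
      rewrite (Rabs_pos_eq t) by lra. now rewrite RtoC_mult.
    - intros u v. now apply (rf_minus HR).
    - intros c u. now apply (rf_scal _ _ _ HR).
    - intros u. now apply (rf_bound_K HR).
    - lra. }
  apply (deriv_eq (V := X)) with (scal (RtoC 1) (Rs (RtoC t) (frac_mean Rs b (RtoC t) x)));
    [|lin_ring X].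
  apply (deriv_quadratic (V := X)) with (g := RtoC) (K := m * (2 * K ^ 3 * norm x));
    [apply deriv_RtoC|].
  apply locally_R_intro with (1 := Ht). intros s Hs. apply Rabs_def2 in Hs.
  assert (Hs0 : 0 < s) by lra.
  set (w := fun u => minus (minus (prod_int Rs x s (pow01 m u)) (prod_int Rs x t (pow01 m u)))
     (scal (RtoC (s - t)) (prod_kernel Rs x (pow01 m u) t))).
  assert (Hc1 : cts (fun u => prod_int Rs x s (pow01 m u))) by (apply cts_prod_int; lra).
  assert (Hc2 : cts (fun u => prod_int Rs x t (pow01 m u))) by (apply cts_prod_int; lra).
  assert (Hc3 : cts (fun u => minus (prod_int Rs x s (pow01 m u)) (prod_int Rs x t (pow01 m u)))).
  { intros u. apply (tends_minus (V := X)); [apply Hc1|apply Hc2]. }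
  assert (Hc4 : cts (fun u => scal (RtoC (s - t)) (prod_kernel Rs x (pow01 m u) t))).
  { intros u. apply (tends_scal (V := X)); [apply tends_const|apply Hck]. }
  assert (Hw : cts w).
  { intros u. apply (tends_minus (V := X)); [apply Hc3|apply Hc4]. }
  assert (Ew : integral w 0 1 = minus
     (minus (integral (fun u => prod_int Rs x s (pow01 m u)) 0 1)
            (integral (fun u => prod_int Rs x t (pow01 m u)) 0 1))
     (scal (RtoC (s - t)) (integral (fun u => prod_kernel Rs x (pow01 m u) t) 0 1))).
  { transitivity (minus
      (integral (fun u => minus (prod_int Rs x s (pow01 m u)) (prod_int Rs x t (pow01 m u))) 0 1)
      (integral (fun u => scal (RtoC (s - t)) (prod_kernel Rs x (pow01 m u) t)) 0 1)).
    { exact (integral_minus (X := X) _ _ 0 1 Hc3 Hc4). }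
    f_equal; [exact (integral_minus (X := X) _ _ 0 1 Hc1 Hc2)|].
    apply (integral_linear (X := X) (Y := X) (scal (RtoC (s - t))) (Cmod (RtoC (s - t)))
       (fun u => prod_kernel Rs x (pow01 m u) t)); try lra; try exact Hck.
    - intros u v. lin_ring X.
    - intros u v. lin_ring X.
    - intros u. apply (norm_scalC (V := X)). }
  apply Rle_trans with (norm (scal (RtoC m) (integral w 0 1))).
  { right. apply (f_equal (norm (V := X))). rewrite Ew, E. unfold prod_mean. fold m.
    lin_ring X. }
  apply Rle_trans with (1 := norm_scalR (V := X) _ _).
  rewrite Rabs_pos_eq, Rmult_assoc by lra. apply Rmult_le_compat_l; [lra|].
  rewrite <- RtoC_minus, Cmod_R.
  apply Rle_trans with ((1 - 0) * (2 * K ^ 3 * norm x * Rabs (s - t) ^ 2)); [|right; ring].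
  apply norm_integral_le_const; [lra|exact Hw|]. intros u _. unfold w, prod_int.
  pose proof (pow01_bounds m u Hm) as Hp.
  assert (Hck2 : cts (prod_kernel Rs x (pow01 m u))) by (apply cts_prod_kernel; lra).
  apply Rle_trans with (norm (minus (integral (prod_kernel Rs x (pow01 m u)) t s)
      (scal (RtoC (s - t)) (prod_kernel Rs x (pow01 m u) t)))).
  { right. apply (f_equal (norm (V := X))).
    rewrite <- (integral_Chasles (X := X) _ 0 t s Hck2). lin_ring X. }
  apply integral_lipschitz; [|exact Hck2|].
  - pose proof (norm_ge_0 x). pose proof (pow_lt K 3 HK). apply Rmult_le_pos; lra.
  - intros a. now apply prod_kernel_lipschitz.
Qed.

End ProductKernel.

Section ProductFormula.
Context {X : CompleteNormedModule C_AbsRing} {Om : C -> Prop} {Rs : C -> X -> X} {K : R}.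
Hypothesis HR : resolvent_family Om Rs K.
Context (b1 b2 : R) (Hb1 : 0 < b1 < 1) (Hb2 : 0 < b2 < 1) (Hb : b1 + b2 = 1).

Let HK : 0 < K := rf_pos _ _ _ HR.

Lemma frac_prim_plus b r x y : 0 < b < 1 -> 0 <= r ->
  frac_prim Rs b (RtoC r) (plus x y) = plus (frac_prim Rs b (RtoC r) x) (frac_prim Rs b (RtoC r) y).
Proof.
  intros Hbb Hr. unfold frac_prim.
  rewrite (frac_mean_plus HR b (proj1 Hbb)) by now apply (rf_ray _ _ _ HR). lin_ring X.
Qed.

Lemma frac_prim_scal b r c x : 0 < b < 1 -> 0 <= r ->
  frac_prim Rs b (RtoC r) (scal c x) = scal c (frac_prim Rs b (RtoC r) x).
Proof.
  intros Hbb Hr. unfold frac_prim.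
  rewrite (frac_mean_scal HR b (proj1 Hbb)) by now apply (rf_ray _ _ _ HR). lin_ring X.
Qed.

Lemma frac_prim_minus b r x y : 0 < b < 1 -> 0 <= r ->
  frac_prim Rs b (RtoC r) (minus x y) = minus (frac_prim Rs b (RtoC r) x) (frac_prim Rs b (RtoC r) y).
Proof.
  intros Hbb Hr. replace (minus x y) with (plus x (scal (RtoC (-1)) y)) by lin_ring X.
  rewrite frac_prim_plus, frac_prim_scal by easy. lin_ring X.
Qed.

Lemma frac_prim_small b r x : 0 < b < 1 -> 0 < r ->
  norm (frac_prim Rs b (RtoC r) x) <= Rpower r b * (/ b * K * norm x).
Proof.
  intros Hbb Hr. unfold frac_prim. rewrite Cpower_RtoC by exact Hr.
  apply Rle_trans with (1 := norm_scalR (V := X) _ _).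
  rewrite Rabs_pos_eq by (left; apply exp_pos).
  apply Rmult_le_compat_l; [left; apply exp_pos|].
  apply (frac_mean_bound HR b (proj1 Hbb)). apply (rf_ray _ _ _ HR). lra.
Qed.

(** Since b1 + b2 = 1, the powers t^(b2-1) t^b1 and t^(b1-1) t^b2 are both 1, and only R(t) H(t) is
    left of each term. *)
Lemma deriv_prim_prim t x : 0 < t ->
  deriv (fun s => frac_prim Rs b1 (RtoC s) (frac_prim Rs b2 (RtoC s) x)) t
    (plus (Rs (RtoC t) (frac_mean Rs b1 (RtoC t) x)) (Rs (RtoC t) (frac_mean Rs b2 (RtoC t) x))).
Proof.
  intros Ht. destruct (frac_int_bound HR b1 Hb1) as [KI [HKI [_ HKb]]].
  assert (Hot : Om (RtoC t)) by (apply (rf_ray _ _ _ HR); lra).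
  assert (Hpos : locally t (fun s => 0 < s)).
  { apply locally_R_intro with (1 := Ht). intros s Hs. apply Rabs_def2 in Hs. lra. }
  pose proof (deriv_frac_prim HR b2 Hb2 t x Ht) as H2.
  pose proof (deriv_frac_prim HR b1 Hb1 t (frac_prim Rs b2 (RtoC t) x) Ht) as H1.
  pose proof (deriv_frac_prim HR b1 Hb1 t (scal (RtoC (Rpower t (b2 - 1))) (Rs (RtoC t) x)) Ht) as H3.
  apply (deriv_eq (V := X)) with (1 := deriv_apply (V := X) (W := X)
    (fun s => frac_prim Rs b1 (RtoC s)) KI (fun s => frac_prim Rs b2 (RtoC s) x) t _ _
    (filter_imp _ _ (fun s Hs u v => frac_prim_minus b1 s u v Hb1 (Rlt_le _ _ Hs)) Hpos)
    (filter_imp _ _ (fun s Hs c v => frac_prim_scal b1 s c v Hb1 (Rlt_le _ _ Hs)) Hpos)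
    (filter_imp _ _ (fun s Hs v => HKb v s Hs) Hpos)
    (deriv_tends (V := X) _ _ _ H3) H2 H1).
  rewrite frac_prim_scal by (trivial; lra).
  unfold frac_prim. rewrite !Cpower_RtoC, (rf_scal _ _ _ HR) by easy.
  rewrite <- (frac_mean_linear HR b1 (proj1 Hb1) (Rs (RtoC t)) K Rs (RtoC t) x).
  - assert (E1 : (RtoC (Rpower t (b2 - 1)) * RtoC (Rpower t b1) = RtoC 1)%C).
    { rewrite <- RtoC_mult, <- Rpower_plus. replace (b2 - 1 + b1) with 0 by lra.
      now rewrite Rpower_O. }
    assert (E2 : (RtoC (Rpower t (b1 - 1)) * RtoC (Rpower t b2) = RtoC 1)%C).
    { rewrite <- RtoC_mult, <- Rpower_plus. replace (b1 - 1 + b2) with 0 by lra.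
      now rewrite Rpower_O. }
    lin_eq_in X ltac:(ring_simplify; rewrite ?E1, ?E2; ring).
  - intros u v. now apply (rf_minus HR).
  - intros c u. now apply (rf_scal _ _ _ HR).
  - intros u. now apply (rf_bound_K HR).
  - exact Hot.
  - intros s Hs. apply (rf_comm HR); [exact Hot|]. now apply (rf_star _ _ _ HR).
Qed.

(** Both sides have the same derivative on (0, oo) and tend to 0 at 0. The derivative is known for
    positive arguments only, so the value at N is compared with that at a small e. *)
Lemma frac_prim_product N x : 0 < N ->
  frac_prim Rs b1 (RtoC N) (frac_prim Rs b2 (RtoC N) x)
  = plus (prod_mean Rs b1 N x) (prod_mean Rs b2 N x).
Proof.
  intros HN. destruct (frac_int_bound HR b1 Hb1) as [KI [HKI [_ HKb]]].
  set (D := (fun s => minus (frac_prim Rs b1 (RtoC s) (frac_prim Rs b2 (RtoC s) x))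
    (plus (prod_mean Rs b1 s x) (prod_mean Rs b2 s x))) : R -> X).
  assert (HD : forall t, 0 < t -> deriv D t zero).
  { intros t Ht. unfold D.
    apply (deriv_eq (V := X)) with (1 := deriv_minus (V := X) _ _ _ _ _ (deriv_prim_prim t x Ht)
      (deriv_plus (V := X) _ _ _ _ _ (deriv_prod_mean HR b1 t x (proj1 Hb1) Ht)
         (deriv_prod_mean HR b2 t x (proj1 Hb2) Ht))).
    lin_ring X. }
  pose proof (norm_ge_0 x) as Hx.
  set (k1 := KI * (/ b2 * K * norm x)). set (k2 := (/ b1 + / b2) * (K ^ 2 * norm x)).
  assert (Hib1 : 0 < / b1) by now apply Rinv_0_lt_compat.
  assert (Hib2 : 0 < / b2) by now apply Rinv_0_lt_compat.
  assert (Hk1 : 0 <= k1).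
  { unfold k1. repeat apply Rmult_le_pos; lra. }
  assert (Hk2 : 0 <= k2).
  { unfold k2. pose proof (pow2_ge_0 K). repeat apply Rmult_le_pos; lra. }
  assert (Hsmall : forall e, 0 < e -> norm (D e) <= k1 * Rpower e b2 + k2 * e).
  { intros e He. unfold D. apply Rle_trans with (1 := norm_minus_le (V := X) _ _).
    apply Rplus_le_compat.
    - apply Rle_trans with (1 := HKb _ e He). unfold k1.
      pose proof (frac_prim_small b2 e x Hb2 He) as Hs.
      apply Rle_trans with (KI * (Rpower e b2 * (/ b2 * K * norm x))).
      + now apply Rmult_le_compat_l.
      + right. ring.
    - apply Rle_trans with (1 := norm_plus_le (V := X) _ _).
      pose proof (prod_mean_bound HR b1 e x (proj1 Hb1) (Rlt_le _ _ He)) as Q1.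
      pose proof (prod_mean_bound HR b2 e x (proj1 Hb2) (Rlt_le _ _ He)) as Q2.
      assert (Hln : ln (1 + e) <= e).
      { rewrite <- (ln_exp e) at 2. left. apply ln_increasing; [lra|]. apply exp_ineq1. lra. }
      apply Rle_trans with (1 := Rplus_le_compat _ _ _ _ Q1 Q2). unfold k2.
      replace (/ b1 * (K ^ 2 * norm x * ln (1 + e)) + / b2 * (K ^ 2 * norm x * ln (1 + e)))
        with ((/ b1 + / b2) * (K ^ 2 * norm x) * ln (1 + e)) by ring.
      apply Rmult_le_compat_l; [exact Hk2|exact Hln]. }
  apply (minus_eq (V := X)). change (D N = zero).
  apply (norm_eq_zero (V := X)). apply Rle_antisym; [|apply norm_ge_0].
  apply Rnot_lt_le. intros Hlt.
  (* With e <= e^b2 <= q, the bound at e gives |D N| <= (k1 + k2) q, at most half of |D N|. *)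
  set (q := norm (D N) / (2 * (k1 + k2 + 1))).
  assert (Hq : 0 < q) by (apply Rdiv_lt_0_compat; lra).
  set (e := Rmin 1 (Rpower q (/ b2))).
  assert (Hqp : 0 < Rpower q (/ b2)) by apply exp_pos.
  assert (He : 0 < e) by (apply Rmin_glb_lt; lra).
  assert (He1 : e <= 1) by apply Rmin_l.
  assert (Heb : Rpower e b2 <= q).
  { replace q with (Rpower (Rpower q (/ b2)) b2).
    2:{ rewrite Rpower_mult. replace (/ b2 * b2) with 1 by (field; lra). now apply Rpower_1. }
    apply Rle_Rpower_l; [lra|]. split; [exact He|apply Rmin_r]. }
  assert (Hee : e <= Rpower e b2).
  { rewrite <- (Rpower_1 e) at 1 by exact He. unfold Rpower.
    destruct (Req_dec e 1) as [E|E].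
    - rewrite E, ln_1, !Rmult_0_r. lra.
    - left. apply exp_increasing.
      assert (ln e < 0) by (rewrite <- ln_1; apply ln_increasing; lra). nra. }
  assert (EN : D e = D N).
  { apply deriv_zero_eq. intros t Ht. apply HD.
    apply Rlt_le_trans with (2 := proj1 Ht). now apply Rmin_glb_lt. }
  specialize (Hsmall e He). rewrite EN in Hsmall.
  assert (E : q * (2 * (k1 + k2 + 1)) = norm (D N)) by (unfold q; field; lra).
  assert (k1 * Rpower e b2 <= k1 * q) by now apply Rmult_le_compat_l.
  assert (k2 * e <= k2 * q) by (apply Rmult_le_compat_l; lra).
  apply (Rlt_irrefl (norm (D N))). apply Rle_lt_trans with (1 := Hsmall).
  rewrite <- E. nra.
Qed.

End ProductFormula.

(* The resolvent of the identity of [C], with which a general family is compared in the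
   product formula. *)
Definition Cres (l : C) (z : C) : C := (z / (1 + l))%C.

(** On the right half-plane |1 + l|^2 >= 1 + |l|^2, which is at least (1 + |l|)^2 / 2. It gives the
    constant 2 of [Cres_family]. *)
Lemma Cmod_1_plus l : 0 <= Re l -> 1 + Cmod l <= 2 * Cmod (1 + l)%C.
Proof.
  intros Hl. pose proof (Cmod_ge_0 l). pose proof (Cmod_ge_0 (1 + l)%C).
  apply Rnot_lt_le. intros Hlt.
  assert (H1 : Cmod (1 + l)%C ^ 2 = 1 + 2 * Re l + Cmod l ^ 2).
  { rewrite !Cmod_sq. unfold Re, Im. destruct l as [u v]; simpl. ring. }
  pose proof (pow2_ge_0 (Cmod l - 1)).
  assert ((2 * Cmod (1 + l)%C) ^ 2 < (1 + Cmod l) ^ 2) by (simpl; rewrite !Rmult_1_r; apply Rmult_le_0_lt_compat; lra).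
  nra.
Qed.

Lemma Cres_neq0 l : 0 <= Re l -> (1 + l <> 0)%C.
Proof.
  intros Hl E. pose proof (Cmod_1_plus l Hl) as H. rewrite E, Cmod_0 in H.
  pose proof (Cmod_ge_0 l). lra.
Qed.

Lemma Cres_family : resolvent_family (V := C_NormedModule) (fun l => 0 <= Re l) Cres 2.
Proof.
  constructor.
  - lra.
  - intros r Hr. exact Hr.
  - intros [u v] t Hl Ht. simpl in *. nra.
  - intros l x y Hl. change ((x + y) / (1 + l) = x / (1 + l) + y / (1 + l))%C.
    field. now apply Cres_neq0.
  - intros l c x Hl. change ((c * x) / (1 + l) = c * (x / (1 + l)))%C.
    field. now apply Cres_neq0.
  - intros l x Hl. change (Cmod (x / (1 + l)) <= 2 / (1 + Cmod l) * Cmod x).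
    pose proof (Cmod_1_plus l Hl). pose proof (Cmod_ge_0 l).
    rewrite Cmod_div by now apply Cres_neq0. rewrite Rmult_comm.
    apply Rmult_le_compat_l; [apply Cmod_ge_0|].
    apply Rmult_le_reg_r with (Cmod (1 + l)); [lra|]. rewrite Rinv_l by lra.
    apply Rmult_le_reg_r with (1 + Cmod l); [lra|].
    replace (2 / (1 + Cmod l) * Cmod (1 + l) * (1 + Cmod l)) with (2 * Cmod (1 + l))
      by (field; lra). lra.
  - intros l m x Hl Hm.
    change (x / (1 + l) - x / (1 + m) = (m - l) * (x / (1 + m) / (1 + l)))%C.
    field. split; now apply Cres_neq0.
Qed.

(** The integrand s^(b-1) / (1 + s) is positive, so the real part of the truncation increases
    strictly from its limit 0 at 0 and cannot return to 0 at infinity. *)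
Lemma frac_int_Cres_neq0 b : 0 < b < 1 ->
  frac_int (X := C_CompleteNormedModule) Cres b (RtoC 1) <> RtoC 0.
Proof.
  intros Hb E.
  set (P := fun r => frac_prim (X := C_CompleteNormedModule) Cres b (RtoC r) (RtoC 1) : C).
  assert (HP := frac_int_spec (X := C_CompleteNormedModule) Cres_family b Hb (RtoC 1)).
  fold P in HP. rewrite E in HP.
  assert (Hd : forall t, 0 < t -> is_derive (fun s => Re (P s)) t (Rpower t (b - 1) / (1 + t))).
  { intros t Ht.
    pose proof (deriv_frac_prim (X := C_CompleteNormedModule) Cres_family b Hb t (RtoC 1) Ht) as H.
    apply deriv_C_Re in H.
    replace (Rpower t (b - 1) / (1 + t))
      with (Re (RtoC (Rpower t (b - 1)) * Cres (RtoC t) (RtoC 1))%C); [exact H|].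
    unfold Cres, Cdiv. rewrite Cmult_1_l, <- RtoC_plus, <- RtoC_inv, <- RtoC_mult by lra.
    reflexivity. }
  assert (Hincr : forall r s, 0 < r -> r < s -> Re (P r) < Re (P s)).
  { intros r s Hr Hrs.
    apply (incr_function (fun t => Re (P t)) (Finite 0) p_infty
      (fun t => Rpower t (b - 1) / (1 + t))); simpl; trivial.
    - intros t Ht _. now apply Hd.
    - intros t Ht _. apply Rdiv_lt_0_compat; [apply exp_pos|lra]. }
  assert (Hsm : forall r, 0 < r -> Rabs (Re (P r)) <= Rpower r b * (/ b * 2)).
  { intros r Hr. apply Rle_trans with (1 := Re_le_Cmod _).
    pose proof (frac_prim_small (X := C_CompleteNormedModule) Cres_family b r (RtoC 1) Hb Hr) as H.
    change (Cmod (P r) <= Rpower r b * (/ b * 2 * Cmod (RtoC 1))) in H.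
    rewrite Cmod_1, Rmult_1_r in H. exact H. }
  assert (H1 : 0 <= Re (P 1)).
  { apply Rnot_lt_le. intros Hneg.
    set (q := - Re (P 1) / (/ b * 2)).
    assert (Hib : 0 < / b) by now apply Rinv_0_lt_compat.
    assert (Hq : 0 < q) by (apply Rdiv_lt_0_compat; lra).
    set (e := Rmin (/ 2) (Rpower q (/ b))).
    assert (He : 0 < e) by (apply Rmin_glb_lt; [lra|apply exp_pos]).
    assert (He1 : e <= / 2) by apply Rmin_l.
    assert (Heb : Rpower e b <= q).
    { replace q with (Rpower (Rpower q (/ b)) b).
      2:{ rewrite Rpower_mult. replace (/ b * b) with 1 by (field; lra). now apply Rpower_1. }
      apply Rle_Rpower_l; [lra|]. split; [exact He|apply Rmin_r]. }
    pose proof (Hincr e 1 He ltac:(lra)) as Hi. pose proof (Hsm e He) as Hs.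
    assert (Eq : q * (/ b * 2) = - Re (P 1)) by (unfold q; field; lra).
    rewrite Rabs_left in Hs by lra.
    assert (Rpower e b * (/ b * 2) <= q * (/ b * 2)) by (apply Rmult_le_compat_r; lra).
    lra. }
  pose proof (Hincr 1 2 ltac:(lra) ltac:(lra)) as H2.
  destruct (HP (Re (P 2)) ltac:(lra)) as [N HN].
  set (s := Rmax N 2 + 1).
  pose proof (Rmax_l N 2). pose proof (Rmax_r N 2).
  specialize (HN s ltac:(unfold s; lra)).
  change (Cmod (P s - RtoC 0) < Re (P 2)) in HN.
  replace (P s - RtoC 0)%C with (P s) in HN by ring.
  pose proof (Hincr 2 s ltac:(lra) ltac:(unfold s; lra)).
  pose proof (Re_le_Cmod (P s)). pose proof (Rle_abs (Re (P s))). lra.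
Qed.

(** Apply ln y <= y to y = (1 + N)^e; the factor 2 comes from (1 + N)^e <= (2 N)^e <= 2 N^e. *)
Lemma ln_1_plus_le_Rpower e N : 0 < e <= 1 -> 1 <= N -> ln (1 + N) <= 2 / e * Rpower N e.
Proof.
  intros He HN.
  assert (H1 : ln (1 + N) = / e * ln (Rpower (1 + N) e)).
  { unfold Rpower. rewrite ln_exp. field. lra. }
  assert (H2 : ln (Rpower (1 + N) e) <= Rpower (1 + N) e).
  { pose proof (exp_pos (e * ln (1 + N))) as Hp. fold (Rpower (1 + N) e) in Hp.
    set (y := Rpower (1 + N) e) in *. destruct (Rle_or_lt y 1).
    - apply Rle_trans with 0; [|lra]. rewrite <- ln_1.
      destruct (Req_dec y 1) as [->|]; [lra|]. left. apply ln_increasing; lra.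
    - pose proof (exp_ineq1 (ln y)) as Hi.
      assert (0 < ln y) by (rewrite <- ln_1; apply ln_increasing; lra).
      specialize (Hi ltac:(lra)). rewrite exp_ln in Hi by lra. lra. }
  assert (H3 : Rpower (1 + N) e <= 2 * Rpower N e).
  { apply Rle_trans with (Rpower (2 * N) e).
    - apply Rle_Rpower_l; lra.
    - rewrite <- Rpower_mult_distr by lra. apply Rmult_le_compat_r; [left; apply exp_pos|].
      rewrite <- (Rpower_1 2) at 2 by lra. apply Rle_Rpower; lra. }
  rewrite H1. unfold Rdiv.
  replace (2 * / e * Rpower N e) with (/ e * (2 * Rpower N e)) by ring.
  apply Rmult_le_compat_l; [left; apply Rinv_0_lt_compat; lra|lra].
Qed.

Ltac c_field :=
  unfold Cminus; repeat (progress rewrite <- ?RtoC_mult, <- ?RtoC_plus, <- ?RtoC_opp);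
  apply (f_equal RtoC); field.

(** * Comparison of the product with the scalar resolvent family *)

Section ScalarComparison.
Context {X : CompleteNormedModule C_AbsRing} {Om : C -> Prop} {Rs : C -> X -> X} {K : R}.
Hypothesis HR : resolvent_family Om Rs K.
Context (x : X).

Let HK : 0 < K := rf_pos _ _ _ HR.
Let x0 := Rs (RtoC 0) x.
Let CX := C_CompleteNormedModule.

(** For t > 0 this is (R(t) x - x0 / (1 + t)) / t, the Frullani integrand. The form through R(t) x0
    shows that it is continuous at 0. *)
Definition frullani_kernel (t : R) : X :=
  minus (scal (RtoC (/ (1 + Rabs t))) x0) (Rs (RtoC (Rabs t)) x0).

Lemma Om_0 : Om (RtoC 0).
Proof. apply (rf_ray _ _ _ HR). lra. Qed.

Lemma cts_frullani_kernel : cts frullani_kernel.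
Proof.
  intros t. apply (tends_minus (V := X)).
  - apply (tends_scal (V := X)); [|apply tends_const].
    apply tends_RtoC; [|apply locally_filter]. intros eps Heps.
    apply locally_R_intro with (1 := Heps). intros s Hs.
    pose proof (Rabs_pos s). pose proof (Rabs_pos t).
    replace (/ (1 + Rabs s) - / (1 + Rabs t))
      with ((Rabs t - Rabs s) * (/ (1 + Rabs s) * / (1 + Rabs t))) by (field; lra).
    rewrite Rabs_mult.
    pose proof (Rabs_triang_inv2 t s) as Hi. rewrite (Rabs_minus_sym t s) in Hi.
    assert (Hp : 0 <= / (1 + Rabs s) * / (1 + Rabs t) <= 1).
    { split; [apply Rmult_le_pos; left; apply Rinv_0_lt_compat; lra|].
      rewrite <- Rinv_mult. rewrite <- Rinv_1. apply Rinv_le_contravar; nra. }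
    rewrite (Rabs_pos_eq (/ (1 + Rabs s) * / (1 + Rabs t))) by lra.
    pose proof (Rabs_pos (Rabs t - Rabs s)). nra.
  - apply (rf_tends HR); [apply locally_filter| | | |].
    + apply filter_forall. intros s. apply (Om_abs HR).
    + apply (Om_abs HR).
    + replace (RtoC (Rabs t)) with (RtoC (1 * Rabs t)) by (f_equal; ring).
      apply (tends_ext_all (V := C_NormedModule)) with (2 := tends_abs 1 t).
      intros s. f_equal; ring.
    + apply tends_const.
Qed.

(* The resolvent identity, solved for the values of the resolvents at [x0 = Rs 0 x]. *)
Lemma resolvent_quotient a : 0 < a ->
  Rs (RtoC a) x0 = scal (RtoC (/ a)) (minus x0 (Rs (RtoC a) x)).
Proof.
  intros Ha. assert (Hoa : Om (RtoC a)) by (apply (rf_ray _ _ _ HR); lra).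
  pose proof (rf_id _ _ _ HR (RtoC a) (RtoC 0) x Hoa Om_0) as H. fold x0 in H.
  assert (H' : Rs (RtoC a) x = plus x0 (scal (RtoC 0 - RtoC a)%C (Rs (RtoC a) x0))).
  { transitivity (plus x0 (minus (Rs (RtoC a) x) x0)); [lin_ring X|].
    apply (f_equal (plus x0)). exact H. }
  rewrite H'.
  lin_eq_in X ltac:(c_field; lra).
Qed.

Lemma prod_kernel_quotient r a : 0 < r < 1 -> 0 < a ->
  prod_kernel Rs x r a
  = scal (RtoC (/ ((r - 1) * a))) (minus (Rs (RtoC a) x) (Rs (RtoC (r * a)) x)).
Proof.
  intros Hr Ha. assert (Hoa : Om (RtoC a)) by (apply (rf_ray _ _ _ HR); lra).
  assert (Hora : Om (RtoC (r * a))) by (apply (rf_ray _ _ _ HR); nra).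
  unfold prod_kernel. rewrite Rabs_pos_eq by lra.
  set (y := Rs (RtoC (r * a)) x).
  assert (H' : Rs (RtoC a) x = plus y (scal (RtoC (r * a) - RtoC a)%C (Rs (RtoC a) y))).
  { transitivity (plus y (minus (Rs (RtoC a) x) y)); [lin_ring X|].
    apply (f_equal (plus y)). exact (rf_id _ _ _ HR _ _ x Hoa Hora). }
  rewrite H'.
  lin_eq_in X ltac:(c_field; lra).
Qed.

Lemma Cres_kernel r a : 0 <= r ->
  prod_kernel (X := CX) Cres (RtoC 1) r a = RtoC (/ ((1 + Rabs a) * (1 + r * Rabs a))).
Proof.
  intros Hr. unfold prod_kernel, Cres. pose proof (Rabs_pos a).
  assert (0 <= r * Rabs a) by (now apply Rmult_le_pos).
  rewrite <- !RtoC_plus. unfold Cdiv. rewrite <- !RtoC_inv by lra.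
  rewrite <- !RtoC_mult. f_equal. field. lra.
Qed.

Definition prod_defect (N r : R) : X :=
  minus (prod_int Rs x N r) (scal (prod_int (X := CX) Cres (RtoC 1) N r) x0).

Lemma norm_x0 : norm x0 <= K * norm x.
Proof. apply (rf_bound_K HR), Om_0. Qed.

(** A crude bound that is uniform in r. It serves for small r, where the factor 1 / r^2 spoils the
    decay estimate. The 4 is the square of the constant of [Cres_family]. *)
Lemma prod_defect_log N r : 0 <= N -> 0 <= r ->
  norm (prod_defect N r) <= (K ^ 2 + 4 * K) * norm x * ln (1 + N).
Proof.
  intros HN Hr. unfold prod_defect.
  apply Rle_trans with (1 := norm_minus_le (V := X) _ _).
  pose proof (prod_int_bound HR x N r HN Hr) as H1.
  pose proof (prod_int_bound (X := CX) Cres_family (RtoC 1) N r HN Hr) as H2.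
  change (Cmod (prod_int (X := CX) Cres (RtoC 1) N r) <= 2 ^ 2 * Cmod (RtoC 1) * ln (1 + N)) in H2.
  rewrite Cmod_1 in H2.
  pose proof (norm_scalC (V := X) (prod_int (X := CX) Cres (RtoC 1) N r) x0) as H3.
  pose proof norm_x0 as H4. pose proof (norm_ge_0 x0) as H5.
  pose proof (Cmod_ge_0 (prod_int (X := CX) Cres (RtoC 1) N r)) as H6.
  assert (H7 : Cmod (prod_int (X := CX) Cres (RtoC 1) N r) * norm x0
    <= 2 ^ 2 * 1 * ln (1 + N) * (K * norm x)) by (apply Rmult_le_compat; assumption).
  apply Rle_trans with (1 := Rplus_le_compat _ _ _ _ H1 (Rle_trans _ _ _ H3 H7)).
  right. ring.
Qed.

Lemma frullani_kernel_bound t : 0 < t -> norm (frullani_kernel t) <= 2 * K * norm x / t ^ 2.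
Proof.
  intros Ht. assert (Hot : Om (RtoC t)) by (apply (rf_ray _ _ _ HR); lra).
  apply Rle_trans with (norm (scal (RtoC (/ t))
    (minus (Rs (RtoC t) x) (scal (RtoC (/ (1 + t))) x0)))).
  { right. apply (f_equal (norm (V := X))). unfold frullani_kernel.
    rewrite (Rabs_pos_eq t), resolvent_quotient by lra.
    lin_eq_in X ltac:(c_field; lra). }
  apply Rle_trans with (1 := norm_scalR (V := X) _ _).
  assert (Hti : 0 < / t) by now apply Rinv_0_lt_compat.
  rewrite Rabs_pos_eq by lra.
  replace (2 * K * norm x / t ^ 2) with (/ t * (K * norm x / t + K * norm x / t))
    by (field; lra).
  apply Rmult_le_compat_l; [lra|].
  pose proof (norm_ge_0 x) as Hx.
  assert (Hinv : / (1 + t) <= / t) by (apply Rinv_le_contravar; lra).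
  assert (Hinv0 : 0 < / (1 + t)) by (apply Rinv_0_lt_compat; lra).
  apply Rle_trans with (1 := norm_minus_le (V := X) _ _).
  apply Rplus_le_compat.
  - apply Rle_trans with (1 := rf_bound _ _ _ HR _ x Hot).
    rewrite Cmod_R, Rabs_pos_eq by lra. unfold Rdiv.
    replace (K * norm x * / t) with (K * / t * norm x) by ring.
    apply Rmult_le_compat_r; [exact Hx|]. apply Rmult_le_compat_l; lra.
  - apply Rle_trans with (1 := norm_scalR (V := X) _ _).
    rewrite Rabs_pos_eq by lra. unfold Rdiv. rewrite (Rmult_comm (K * norm x)).
    apply Rmult_le_compat; [lra|apply norm_ge_0|exact Hinv|exact norm_x0].
Qed.

(* Frullani: the defect is an integral of [frullani_kernel] over [r N, N]. *)
Lemma prod_defect_decay N r : 0 < N -> 0 < r < 1 ->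
  norm (prod_defect N r) <= 2 * K * norm x / (r ^ 2 * N).
Proof.
  intros HN Hr.
  set (kC := prod_kernel (X := CX) Cres (RtoC 1) r).
  assert (HkC : cts (V := C_NormedModule) kC) by (apply (cts_prod_kernel (X := CX) Cres_family); lra).
  assert (Hk : cts (prod_kernel Rs x r)) by (apply (cts_prod_kernel HR); lra).
  assert (Hkx : cts (fun a => scal (kC a) x0)).
  { intros a. apply (tends_scal (V := X)); [apply HkC|apply tends_const]. }
  set (w := fun a => minus (prod_kernel Rs x r a) (scal (kC a) x0)).
  assert (Hw : cts w).
  { intros a. apply (tends_minus (V := X)); [apply Hk|apply Hkx]. }
  assert (E1 : integral w 0 N = prod_defect N r).
  { transitivity (minus (integral (prod_kernel Rs x r) 0 N) (integral (fun a => scal (kC a) x0) 0 N)).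
    { exact (integral_minus (X := X) _ _ 0 N Hk Hkx). }
    unfold prod_defect. f_equal.
    apply (integral_linear (X := CX) (Y := X) (fun z : C => scal z x0) (norm x0) kC 0 N);
      [..|lra|exact HkC].
    - intros u v. change (scal (u - v)%C x0 = minus (scal u x0) (scal v x0)). lin_ring X.
    - intros c u. change (scal (c * u)%C x0 = scal c (scal u x0)). lin_ring X.
    - intros u. change (norm (scal u x0) <= norm x0 * Cmod u). rewrite Rmult_comm.
      apply (norm_scalC (V := X)). }
  set (Y := integral frullani_kernel 0).
  assert (HY : forall t, deriv Y t (frullani_kernel t)).
  { intros t. apply deriv_integral, cts_frullani_kernel. }
  assert (HYc : cts Y) by (intros t; exact (deriv_tends (V := X) _ _ _ (HY t))).
  assert (Hlin : forall t, deriv (V := C_NormedModule) (fun s => RtoC (r * s)) t (RtoC r)).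
  { intros t. exists (fun _ => RtoC r). split; [|apply tends_const].
    intros s. change (RtoC (r * s) - RtoC (r * t) = RtoC (s - t) * RtoC r)%C.
    rewrite <- RtoC_minus, <- RtoC_mult. f_equal. ring. }
  assert (HYr : forall t, deriv (fun s => Y (r * s)) t (scal (RtoC r) (frullani_kernel (r * t)))).
  { intros t. destruct (HY (r * t)) as [p [Hp1 Hp2]].
    exists (fun s => scal (RtoC r) (p (r * s))). split.
    - intros s. rewrite Hp1. replace (r * s - r * t) with ((s - t) * r) by ring. lin_ring X.
    - apply (tends_scal (V := X)); [apply tends_const|].
      apply (tends_comp (V := X) _ _ p (fun s => r * s) _ Hp2).
      intros P [eps HP].
      assert (He : 0 < eps / r) by (apply Rdiv_lt_0_compat; [apply cond_pos|lra]).
      apply locally_R_intro with (1 := He). intros s Hs. apply HP.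
      change (Rabs (r * s - r * t) < eps).
      replace (r * s - r * t) with (r * (s - t)) by ring.
      rewrite Rabs_mult, (Rabs_pos_eq r) by lra.
      replace (pos eps) with (r * (eps / r)) by (field; lra). apply Rmult_lt_compat_l; lra. }
  (* Multiplied by 1 - r, the difference of kernels at a is r phi(r a) - phi(a) with phi the
     Frullani kernel, that is, the derivative of Y(r a) - Y(a). *)
  assert (E2 : integral (fun a => scal (RtoC (1 - r)) (w a)) 0 N
     = minus (minus (Y (r * N)) (Y N)) (minus (Y (r * 0)) (Y 0))).
  { apply (integral_deriv_open (X := X) (fun a => minus (Y (r * a)) (Y a))); [lra| | |].
    - intros t Ht. apply (deriv_eq (V := X)) with
        (1 := deriv_minus (V := X) _ _ _ _ _ (HYr t) (HY t)).
      unfold w, kC. rewrite Cres_kernel, prod_kernel_quotient by lra.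
      assert (Hrt : 0 < r * t) by nra.
      unfold frullani_kernel. rewrite (Rabs_pos_eq t), (Rabs_pos_eq (r * t)) by lra.
      rewrite !resolvent_quotient by lra.
      lin_eq_in X ltac:(c_field; repeat split; nra).
    - intros t. apply (tends_minus (V := X)); [|apply HYc].
      exact (deriv_tends (V := X) _ _ _ (HYr t)).
    - intros t. apply (tends_scal (V := X)); [apply tends_const|apply Hw]. }
  assert (E3 : scal (RtoC (1 - r)) (prod_defect N r) = opp (integral frullani_kernel (r * N) N)).
  { rewrite <- E1.
    rewrite <- (integral_linear (X := X) (Y := X) (scal (RtoC (1 - r))) (Cmod (RtoC (1 - r))) w 0 N).
    - transitivity (minus (minus (Y (r * N)) (Y N)) (minus (Y (r * 0)) (Y 0))); [exact E2|].
      rewrite Rmult_0_r. unfold Y.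
      rewrite <- (integral_Chasles (X := X) _ 0 (r * N) N cts_frullani_kernel). lin_ring X.
    - intros u v. lin_ring X.
    - intros c u. lin_ring X.
    - intros u. apply (norm_scalC (V := X)).
    - lra.
    - exact Hw. }
  assert (Hrn : 0 < r * N) by nra.
  (* The length N - r N cancels the factor 1 / (1 - r), so the bound stays finite as r tends to
     1. *)
  assert (Hb : norm (integral frullani_kernel (r * N) N) <= (N - r * N) * (2 * K * norm x / (r * N) ^ 2)).
  { apply norm_integral_le_const; [nra|apply cts_frullani_kernel|].
    intros t Ht. apply Rle_trans with (1 := frullani_kernel_bound t ltac:(lra)).
    unfold Rdiv. apply Rmult_le_compat_l.
    - pose proof (norm_ge_0 x). nra.
    - apply Rinv_le_contravar; [now apply pow_lt|]. apply pow_incr. lra. }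
  apply Rle_trans with (norm (scal (RtoC (/ (1 - r))) (scal (RtoC (1 - r)) (prod_defect N r)))).
  { right. apply (f_equal (norm (V := X))). symmetry. apply (scal_inv_scal (V := X)). lra. }
  apply Rle_trans with (1 := norm_scalR (V := X) _ _).
  assert (Hi : 0 < / (1 - r)) by (apply Rinv_0_lt_compat; lra).
  rewrite Rabs_pos_eq by lra.
  rewrite E3, (norm_opp (V := X)).
  apply Rle_trans with (/ (1 - r) * ((N - r * N) * (2 * K * norm x / (r * N) ^ 2))).
  - apply Rmult_le_compat_l; [lra|exact Hb].
  - right. field. lra.
Qed.

Lemma prod_mean_defect b : 0 < b < 1 ->
  tends (Rbar_locally p_infty)
    (fun N => minus (prod_mean Rs b N x) (scal (prod_mean (X := CX) Cres b N (RtoC 1)) x0)) zero.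
Proof.
  intros Hb. assert (Hm : 0 < / b) by (apply Rinv_0_lt_compat; lra).
  pose proof (norm_ge_0 x) as Hx.
  set (k1 := (K ^ 2 + 4 * K) * norm x). set (k2 := 2 * K * norm x).
  assert (Hk1 : 0 <= k1).
  { unfold k1. apply Rmult_le_pos; [|exact Hx]. pose proof (pow2_ge_0 K). lra. }
  assert (Hk2 : 0 <= k2) by (unfold k2; nra).
  assert (Hmain : forall N, 1 < N ->
    norm (minus (minus (prod_mean Rs b N x) (scal (prod_mean (X := CX) Cres b N (RtoC 1)) x0)) zero)
    <= / b * (k1 * (16 / b)) * Rpower N (- (b / 8)) + / b * k2 * Rpower N (- (/ 2))).
  { intros N HN.
    set (m := / b) in *. assert (HN0 : 0 <= N) by lra.
    set (q := fun t => prod_int (X := CX) Cres (RtoC 1) N (pow01 m t)).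
    assert (Hq : cts (V := C_NormedModule) q)
      by exact (cts_prod_int (X := CX) Cres_family (RtoC 1) N m HN0 Hm).
    assert (Hp : cts (fun t => prod_int Rs x N (pow01 m t)))
      by exact (cts_prod_int HR x N m HN0 Hm).
    assert (Hqx : cts (fun t => scal (q t) x0)).
    { intros a. apply (tends_scal (V := X)); [apply Hq|apply tends_const]. }
    set (w := fun t => prod_defect N (pow01 m t)).
    assert (Hw : cts w).
    { intros a. apply (tends_minus (V := X)); [apply Hp|apply Hqx]. }
    assert (E : minus (minus (prod_mean Rs b N x) (scal (prod_mean (X := CX) Cres b N (RtoC 1)) x0)) zero
      = scal (RtoC m) (integral w 0 1)).
    { assert (E1 : integral w 0 1 = minus (integral (fun t => prod_int Rs x N (pow01 m t)) 0 1)
        (scal (integral (X := CX) q 0 1) x0)).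
      { transitivity (minus (integral (fun t => prod_int Rs x N (pow01 m t)) 0 1)
          (integral (fun t => scal (q t) x0) 0 1)).
        { exact (integral_minus (X := X) _ _ 0 1 Hp Hqx). }
        f_equal.
        apply (integral_linear (X := CX) (Y := X) (fun z : C => scal z x0) (norm x0) q 0 1);
          [..|lra|exact Hq].
        - intros u v. change (scal (u - v)%C x0 = minus (scal u x0) (scal v x0)). lin_ring X.
        - intros c u. change (scal (c * u)%C x0 = scal c (scal u x0)). lin_ring X.
        - intros u. change (norm (scal u x0) <= norm x0 * Cmod u). rewrite Rmult_comm.
          apply (norm_scalC (V := X)). }
      rewrite E1. unfold prod_mean. fold m. fold q.
      change (scal (RtoC m) (integral (X := CX) q 0 1)) with (RtoC m * integral (X := CX) q 0 1)%C.
      lin_ring X. }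
    rewrite E. apply Rle_trans with (1 := norm_scalR (V := X) _ _).
    rewrite Rabs_pos_eq by lra.
    (* Splitting point in t = r^b, corresponding to r = N^(-1/4). Below it the logarithmic bound
       gains the length d; above it r^2 N >= N^(1/2) in the decay estimate. *)
    set (d := Rpower N (- (b / 4))).
    assert (Hd : 0 < d < 1).
    { split; [apply exp_pos|]. unfold d.
      rewrite <- (Rpower_O N) by lra. apply Rpower_lt; lra. }
    assert (Hdm : Rpower d m = Rpower N (- / 4)).
    { unfold d. rewrite Rpower_mult. f_equal. unfold m. field. lra. }
    assert (Hfirst : norm (integral w 0 d) <= (d - 0) * (k1 * ln (1 + N))).
    { apply norm_integral_le_const; [lra|exact Hw|]. intros t _.
      apply prod_defect_log; [lra|]. now apply pow01_bounds. }
    assert (Hsecond : norm (integral w d 1) <= (1 - d) * (k2 / (Rpower d m ^ 2 * N))).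
    { apply norm_integral_le_const; [lra|exact Hw|].
      apply (closed_interval_norm_le (V := X)); [lra|exact Hw|]. intros t Ht.
      assert (Hpt : 0 < Rpower t m < 1).
      { split; [apply exp_pos|]. rewrite <- (Rpower_O t) by lra. unfold Rpower.
        apply exp_increasing.
        assert (ln t < 0) by (rewrite <- ln_1; apply ln_increasing; lra). nra. }
      unfold w. rewrite pow01_interior by lra.
      apply Rle_trans with (1 := prod_defect_decay N (Rpower t m) ltac:(lra) Hpt).
      fold k2. unfold Rdiv. apply Rmult_le_compat_l; [exact Hk2|].
      apply Rinv_le_contravar.
      - apply Rmult_lt_0_compat; [apply pow_lt, exp_pos|lra].
      - apply Rmult_le_compat_r; [lra|]. apply pow_incr. split; [left; apply exp_pos|].
        apply Rle_Rpower_l; lra. }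
    (* The exponent b / 8 is half of that of d, so d ln(1 + N) still decays like N^(- b / 8). *)
    assert (Hln : ln (1 + N) <= 16 / b * Rpower N (b / 8)).
    { pose proof (ln_1_plus_le_Rpower (b / 8) N ltac:(lra) ltac:(lra)) as H.
      replace (2 / (b / 8)) with (16 / b) in H by (field; lra). exact H. }
    assert (E4 : k2 / (Rpower d m ^ 2 * N) = k2 * Rpower N (- / 2)).
    { rewrite Hdm. simpl. rewrite Rmult_1_r, <- Rpower_plus.
      rewrite <- (Rpower_1 N) at 2 by lra. rewrite <- Rpower_plus.
      unfold Rdiv. rewrite <- Rpower_Ropp. f_equal. f_equal. field. }
    assert (E5 : d * Rpower N (b / 8) = Rpower N (- (b / 8))).
    { unfold d. rewrite <- Rpower_plus. f_equal. field. }
    rewrite E4 in Hsecond.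
    pose proof (exp_pos (- / 2 * ln N)) as Hp2. fold (Rpower N (- / 2)) in Hp2.
    replace (m * (k1 * (16 / b)) * Rpower N (- (b / 8)) + m * k2 * Rpower N (- / 2))
      with (m * (k1 * (16 / b) * Rpower N (- (b / 8)) + k2 * Rpower N (- / 2))) by ring.
    apply Rmult_le_compat_l; [lra|].
    rewrite <- (integral_Chasles (X := X) w 0 d 1 Hw).
    apply Rle_trans with (1 := norm_plus_le (V := X) _ _).
    apply Rle_trans with (1 := Rplus_le_compat _ _ _ _ Hfirst Hsecond).
    apply Rplus_le_compat.
    - rewrite <- E5.
      assert (k1 * ln (1 + N) <= k1 * (16 / b * Rpower N (b / 8))) by now apply Rmult_le_compat_l.
      assert (Hdd : d * (k1 * ln (1 + N)) <= d * (k1 * (16 / b * Rpower N (b / 8))))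
        by (apply Rmult_le_compat_l; lra).
      lra.
    - assert (0 <= k2 * Rpower N (- / 2)) by (apply Rmult_le_pos; lra). nra. }
  intros eps Heps.
  assert (Hb8 : 0 < b / 8) by lra. assert (H2 : 0 < / 2) by lra. assert (He2 : 0 < eps / 2) by lra.
  assert (H1N : Rbar_locally p_infty (fun N => 1 < N)) by (exists 1; intros; lra).
  pose proof (filter_and _ _ H1N (filter_and _ _
     (Rpower_neg_lim (/ b * (k1 * (16 / b))) (b / 8) Hb8 (eps / 2) He2)
     (Rpower_neg_lim (/ b * k2) (/ 2) H2 (eps / 2) He2))) as H.
  apply filter_imp with (2 := H). intros N [HN [[_ HN1] [_ HN2]]].
  apply Rle_lt_trans with (1 := Hmain N HN). lra.
Qed.

Lemma frac_int_product b1 b2 : 0 < b1 < 1 -> 0 < b2 < 1 -> b1 + b2 = 1 ->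
  frac_int Rs b1 (frac_int Rs b2 x)
  = scal (frac_int (X := CX) Cres b1 (frac_int (X := CX) Cres b2 (RtoC 1))) x0.
Proof.
  intros Hb1 Hb2 Hb.
  (* Stated for an arbitrary family because it is used twice, for [Rs] and for the scalar family. *)
  assert (Hgen : forall (Y : CompleteNormedModule C_AbsRing) OmY RY KY (y : Y),
     resolvent_family OmY RY KY ->
     tends (Rbar_locally p_infty) (fun N => plus (prod_mean RY b1 N y) (prod_mean RY b2 N y))
       (frac_int RY b1 (frac_int RY b2 y))).
  { intros Y OmY RY KY y HRY.
    destruct (frac_int_bound HRY b1 Hb1) as [KI [_ [_ HKI]]].
    assert (Hpos : Rbar_locally p_infty (fun N => 0 < N)) by (exists 0; intros; lra).
    apply (tends_ext (V := Y)) with (fun N => frac_prim RY b1 (RtoC N) (frac_prim RY b2 (RtoC N) y)).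
    - apply filter_imp with (2 := Hpos). intros N HN.
      exact (frac_prim_product HRY b1 b2 Hb1 Hb2 Hb N y HN).
    - apply (tends_apply (V := Y) (W := Y) (fun N => frac_prim RY b1 (RtoC N)) KI
        (fun N => frac_prim RY b2 (RtoC N) y) (frac_int RY b2 y)).
      + apply filter_imp with (2 := Hpos). intros N HN u v.
        apply (frac_prim_minus HRY); [exact Hb1|lra].
      + apply filter_imp with (2 := Hpos). intros N HN u. now apply HKI.
      + exact (frac_int_spec HRY b1 Hb1 _).
      + exact (frac_int_spec HRY b2 Hb2 _). }
  pose proof (Hgen X Om Rs K x HR) as H1.
  pose proof (Hgen CX _ _ _ (RtoC 1) Cres_family) as H2.
  apply (tends_unique (F := Rbar_locally p_infty) (V := X)) with
    (f := fun N => plus (prod_mean Rs b1 N x) (prod_mean Rs b2 N x)); [exact H1|].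
  apply (tends_ext_all (V := X)) with (fun N => plus
    (plus (minus (prod_mean Rs b1 N x) (scal (prod_mean (X := CX) Cres b1 N (RtoC 1)) x0))
          (minus (prod_mean Rs b2 N x) (scal (prod_mean (X := CX) Cres b2 N (RtoC 1)) x0)))
    (scal (plus (prod_mean (X := CX) Cres b1 N (RtoC 1)) (prod_mean (X := CX) Cres b2 N (RtoC 1))) x0)).
  { intros N.
    change (plus (prod_mean (X := CX) Cres b1 N (RtoC 1)) (prod_mean (X := CX) Cres b2 N (RtoC 1)))
      with (prod_mean (X := CX) Cres b1 N (RtoC 1) + prod_mean (X := CX) Cres b2 N (RtoC 1))%C.
    lin_ring X. }
  replace (scal _ x0) with (plus (plus zero zero)
    (scal (frac_int (X := CX) Cres b1 (frac_int (X := CX) Cres b2 (RtoC 1))) x0)) by lin_ring X.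
  apply (tends_plus (V := X)).
  - apply (tends_plus (V := X)); now apply prod_mean_defect.
  - apply (tends_scal (V := X)); [exact H2|apply tends_const].
Qed.

End ScalarComparison.

Lemma frac_int_Cres_product_neq0 b1 b2 : 0 < b1 < 1 -> 0 < b2 < 1 ->
  frac_int (X := C_CompleteNormedModule) Cres b1
    (frac_int (X := C_CompleteNormedModule) Cres b2 (RtoC 1)) <> RtoC 0.
Proof.
  intros Hb1 Hb2.
  set (z := frac_int (X := C_CompleteNormedModule) Cres b2 (RtoC 1) : C).
  replace z with (z * RtoC 1)%C by ring.
  change (z * RtoC 1)%C with (@scal C_Ring C_ModuleSpace z (RtoC 1)).
  pose proof (frac_int_scal (X := C_CompleteNormedModule) Cres_family b1 Hb1 z (RtoC 1)) as E.
  intros H.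
  assert (E2 : (z * frac_int (X := C_CompleteNormedModule) Cres b1 (RtoC 1))%C = RtoC 0).
  { transitivity (frac_int (X := C_CompleteNormedModule) Cres b1
      (@scal C_Ring C_ModuleSpace z (RtoC 1))); [symmetry; exact E|exact H]. }
  revert E2. apply Cmult_neq_0; now apply frac_int_Cres_neq0.
Qed.

(** * Commutation of the resolvents *)

(** The operator appears as a total function [a] that is meaningful on [D] only. This makes the
    commutator computations equational instead of relational. *)
Record resolvent_of {V : NormedModule C_AbsRing} (D : V -> Prop) (a : V -> V)
    (l : C) (Rl : V -> V) : Prop := {
  ro_dom : forall x, D (Rl x);
  ro_right : forall x, plus (scal l (Rl x)) (a (Rl x)) = x;
  ro_left : forall y, D y -> Rl (plus (scal l y) (a y)) = y;
  ro_plus : forall x y, Rl (plus x y) = plus (Rl x) (Rl y);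
  ro_scal : forall c x, Rl (scal c x) = scal c (Rl x) }.

Section Commutation.
Context {V : NormedModule C_AbsRing} (D : V -> Prop).

Lemma ro_minus a l Rl x y : resolvent_of D a l Rl -> Rl (minus x y) = minus (Rl x) (Rl y).
Proof.
  intros H. replace (minus x y) with (plus x (scal (RtoC (-1)) y)) by lin_ring V.
  rewrite (ro_plus _ _ _ _ H), (ro_scal _ _ _ _ H). lin_ring V.
Qed.

Lemma ro_commute a l Rl y : resolvent_of D a l Rl -> D y -> a (Rl y) = Rl (a y).
Proof.
  intros H Hy.
  pose proof (ro_right _ _ _ _ H y) as H1. pose proof (ro_left _ _ _ _ H y Hy) as H2.
  rewrite (ro_plus _ _ _ _ H), (ro_scal _ _ _ _ H) in H2.
  transitivity (minus (plus (scal l (Rl y)) (a (Rl y))) (scal l (Rl y))); [lin_ring V|].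
  rewrite H1. rewrite <- H2 at 1. lin_ring V.
Qed.

Context (a1 a2 a3 : V -> V) (l : C) (R1 : V -> V) (R2 R3 : R -> V -> V) (E : V -> V) (KE : R).
Hypothesis H1 : resolvent_of D a1 l R1.
Hypothesis H2 : forall s, 0 <= s -> resolvent_of D a2 (RtoC s) (R2 s).
Hypothesis H3 : forall s, 0 <= s -> resolvent_of D a3 (RtoC s) (R3 s).
Hypothesis C1 : forall y, D y -> minus (a2 (R1 y)) (a3 (R1 y)) = R1 (minus (a2 y) (a3 y)).
Hypothesis C2 : forall s y, 0 <= s -> D y ->
  minus (a1 (R2 s y)) (a3 (R2 s y)) = R2 s (minus (a1 y) (a3 y)).
Hypothesis C3 : forall s y, 0 <= s -> D y ->
  minus (a1 (R3 s y)) (a2 (R3 s y)) = R3 s (minus (a1 y) (a2 y)).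
Hypothesis E_dom : forall w, D (E w).
Hypothesis E_right : forall w, minus (a2 (E w)) (a3 (E w)) = w.
Hypothesis E_left : forall y, D y -> E (minus (a2 y) (a3 y)) = y.
Hypothesis E_plus : forall x y, E (plus x y) = plus (E x) (E y).
Hypothesis E_scal : forall c x, E (scal c x) = scal c (E x).
Hypothesis E_bound : forall x, norm (E x) <= KE * norm x.
Context (KR : R).
Hypothesis R1_bound : forall x, norm (R1 x) <= KR * norm x.
Hypothesis L2 : forall z, tends (Rbar_locally p_infty) (fun s => scal (RtoC s) (R2 s z)) z.
Hypothesis L3 : forall z, tends (Rbar_locally p_infty) (fun s => scal (RtoC s) (R3 s z)) z.

Lemma E_minus x y : E (minus x y) = minus (E x) (E y).
Proof.
  replace (minus x y) with (plus x (scal (RtoC (-1)) y)) by lin_ring V.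
  rewrite E_plus, E_scal. lin_ring V.
Qed.

(* Expand the commutator of [R1] with [Q], a resolvent of [b], when [a1 - c] commutes
   with [Q]. *)
Lemma commutator_expansion (b c : V -> V) (k : C) (Q : V -> V) x :
  resolvent_of D b k Q ->
  (forall y, D y -> minus (a1 (Q y)) (c (Q y)) = Q (minus (a1 y) (c y))) ->
  (forall y, D y -> minus (b (R1 y)) (c (R1 y)) = R1 (minus (b y) (c y))) -> D x ->
  minus (R1 (Q x)) (Q (R1 x))
  = minus (minus (b (R1 (Q (R1 x)))) (c (R1 (Q (R1 x)))))
          (R1 (Q (R1 (minus (b x) (c x))))).
Proof.
  intros HQ HC HB Hx. set (y := R1 x).
  assert (Hy : D y) by apply (ro_dom _ _ _ _ H1).
  assert (HQy : D (Q y)) by apply (ro_dom _ _ _ _ HQ).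
  rewrite (HB _ HQy), <- (HB x Hx). fold y.
  pose proof (ro_commute _ _ _ y HQ Hy) as Eb.
  pose proof (HC y Hy) as Ec.
  pose proof (ro_left _ _ _ _ H1 _ HQy) as El.
  pose proof (ro_right _ _ _ _ H1 x) as Er. fold y in Er.
  assert (Ec' : c (Q y) = minus (a1 (Q y)) (minus (Q (a1 y)) (Q (c y)))).
  { rewrite <- (ro_minus _ _ _ _ _ HQ), <- Ec. lin_ring V. }
  rewrite Eb, Ec'.
  rewrite !(ro_minus _ _ _ _ _ H1), (ro_minus _ _ _ _ _ HQ), !(ro_minus _ _ _ _ _ H1).
  rewrite (ro_plus _ _ _ _ H1), (ro_scal _ _ _ _ H1) in El.
  rewrite <- Er at 1.
  rewrite (ro_plus _ _ _ _ HQ), (ro_scal _ _ _ _ HQ), (ro_plus _ _ _ _ H1), (ro_scal _ _ _ _ H1).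
  rewrite <- El at 2. lin_ring V.
Qed.

Lemma E_R1 w : E (R1 w) = R1 (E w).
Proof.
  rewrite <- (E_right w) at 1. rewrite <- C1 by apply E_dom.
  apply E_left, (ro_dom _ _ _ _ H1).
Qed.

Lemma scaled_resolvent (a : V -> V) s Q y : resolvent_of D a (RtoC s) Q -> D y ->
  scal (RtoC s) (Q y) = minus y (Q (a y)).
Proof.
  intros HQ Hy. pose proof (ro_left _ _ _ _ HQ y Hy) as H.
  rewrite (ro_plus _ _ _ _ HQ), (ro_scal _ _ _ _ HQ) in H.
  rewrite <- H at 2. lin_ring V.
Qed.

Lemma R1_tends (f : R -> V) z : tends (Rbar_locally p_infty) f z ->
  tends (Rbar_locally p_infty) (fun s => R1 (f s)) (R1 z).
Proof.
  apply tends_linear with KR; [|exact R1_bound]. intros x y. apply (ro_minus _ _ _ _ _ H1).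
Qed.

Lemma E_tends (f : R -> V) z : tends (Rbar_locally p_infty) f z ->
  tends (Rbar_locally p_infty) (fun s => E (f s)) (E z).
Proof. apply tends_linear with KE; [exact E_minus|exact E_bound]. Qed.

(* Multiply the two expansions by [s^2] and let [s] tend to infinity: both commutators
   tend to [a2 R1 - R1 a2 = a3 R1 - R1 a3], while the right-hand sides cancel. *)
Lemma commutator_zero x : D x -> a3 (R1 x) = R1 (a3 x).
Proof.
  intros Hx. set (K := minus (a3 (R1 x)) (R1 (a3 x))).
  assert (Hy : D (R1 x)) by apply (ro_dom _ _ _ _ H1).
  set (d := minus (a2 x) (a3 x)).
  assert (HK2 : minus (a2 (R1 x)) (R1 (a2 x)) = K).
  { unfold K. pose proof (C1 x Hx) as E1. rewrite (ro_minus _ _ _ _ _ H1) in E1.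
    transitivity (plus (minus (a2 (R1 x)) (a3 (R1 x))) (minus (a3 (R1 x)) (R1 (a2 x)))).
    { lin_ring V. }
    rewrite E1. lin_ring V. }
  assert (Hpos : Rbar_locally p_infty (fun s => 0 <= s)) by (exists 0; intros; lra).
  (* From s Q y = y - Q (a y) on the domain, s^2 (R1 Q - Q R1) x = s Q (a R1 x) - R1 (s Q (a x)),
     and s Q tends strongly to the identity. *)
  assert (Hcomm : forall (a : V -> V) (Q : R -> V -> V),
     (forall s, 0 <= s -> resolvent_of D a (RtoC s) (Q s)) ->
     (forall z, tends (Rbar_locally p_infty) (fun s => scal (RtoC s) (Q s z)) z) ->
     tends (Rbar_locally p_infty)
       (fun s => scal (RtoC (s * s)) (minus (R1 (Q s x)) (Q s (R1 x))))
       (minus (a (R1 x)) (R1 (a x)))).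
  { intros a Q HQ LQ.
    apply tends_ext with (fun s => minus (scal (RtoC s) (Q s (a (R1 x))))
                                         (R1 (scal (RtoC s) (Q s (a x))))).
    - apply filter_imp with (2 := Hpos). intros s Hs.
      pose proof (scaled_resolvent a s (Q s) x (HQ s Hs) Hx) as E1.
      pose proof (scaled_resolvent a s (Q s) (R1 x) (HQ s Hs) Hy) as E2.
      transitivity (scal (RtoC s) (minus (R1 (scal (RtoC s) (Q s x))) (scal (RtoC s) (Q s (R1 x))))).
      + rewrite E1, E2, (ro_minus _ _ _ _ _ H1), (ro_scal _ _ _ _ H1). lin_ring V.
      + rewrite (ro_scal _ _ _ _ H1). lin_ring V.
    - apply tends_minus; [apply LQ|]. apply R1_tends, LQ. }
  assert (Hdiff : forall y, D y -> tends (Rbar_locally p_infty)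
     (fun s => scal (RtoC (s * s)) (minus (R2 s y) (R3 s y))) (minus (a3 y) (a2 y))).
  { intros y HDy.
    apply tends_ext with (fun s => minus (scal (RtoC s) (R3 s (a3 y))) (scal (RtoC s) (R2 s (a2 y)))).
    - apply filter_imp with (2 := Hpos). intros s Hs.
      pose proof (scaled_resolvent a2 s (R2 s) y (H2 s Hs) HDy) as E1.
      pose proof (scaled_resolvent a3 s (R3 s) y (H3 s Hs) HDy) as E2.
      transitivity (scal (RtoC s) (minus (scal (RtoC s) (R2 s y)) (scal (RtoC s) (R3 s y)))).
      + rewrite E1, E2. lin_ring V.
      + lin_ring V.
    - apply tends_minus; [apply L3|apply L2]. }
  assert (HR1d : D (R1 d)) by apply (ro_dom _ _ _ _ H1).
  (* The summed expansions contain the unbounded a2 - a3. Its bounded inverse [E] is applied first,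
     so that limits can be taken. *)
  assert (Hlim1 : tends (Rbar_locally p_infty)
    (fun s => E (plus (scal (RtoC (s * s)) (minus (R1 (R2 s x)) (R2 s (R1 x))))
                      (scal (RtoC (s * s)) (minus (R1 (R3 s x)) (R3 s (R1 x))))))
    (E (plus K K))).
  { apply E_tends, tends_plus.
    - rewrite <- HK2. now apply Hcomm.
    - now apply Hcomm. }
  assert (Hlim2 : tends (Rbar_locally p_infty)
    (fun s => E (plus (scal (RtoC (s * s)) (minus (R1 (R2 s x)) (R2 s (R1 x))))
                      (scal (RtoC (s * s)) (minus (R1 (R3 s x)) (R3 s (R1 x))))))
    (minus (R1 (minus (a3 (R1 x)) (a2 (R1 x))))
           (E (R1 (minus (a3 (R1 d)) (a2 (R1 d))))))).
  { apply tends_ext with (fun s =>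
      minus (R1 (scal (RtoC (s * s)) (minus (R2 s (R1 x)) (R3 s (R1 x)))))
            (E (R1 (scal (RtoC (s * s)) (minus (R2 s (R1 d)) (R3 s (R1 d))))))).
    - apply filter_imp with (2 := Hpos). intros s Hs.
      rewrite (commutator_expansion a2 a3 (RtoC s) (R2 s) x (H2 s Hs)
        (fun y Hyy => C2 s y Hs Hyy) C1 Hx).
      rewrite (commutator_expansion a3 a2 (RtoC s) (R3 s) x (H3 s Hs)
        (fun y Hyy => C3 s y Hs Hyy)); [|..|exact Hx].
      2:{ intros y HDy.
          transitivity (opp (minus (a2 (R1 y)) (a3 (R1 y)))); [lin_ring V|].
          rewrite (C1 y HDy), !(ro_minus _ _ _ _ _ H1). lin_ring V. }
      fold d.
      replace (minus (a3 x) (a2 x)) with (scal (RtoC (-1)) d) by (unfold d; lin_ring V).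
      set (u2 := R1 (R2 s (R1 x))). set (u3 := R1 (R3 s (R1 x))).
      replace (minus (a3 u3) (a2 u3)) with (scal (RtoC (-1)) (minus (a2 u3) (a3 u3))) by lin_ring V.
      assert (Hu2 : D u2) by apply (ro_dom _ _ _ _ H1).
      assert (Hu3 : D u3) by apply (ro_dom _ _ _ _ H1).
      rewrite !(ro_scal _ _ _ _ H1), !(ro_scal _ _ _ _ (H3 s Hs)), !(ro_scal _ _ _ _ H1).
      rewrite E_plus, !E_scal, (E_minus (minus (a2 u2) (a3 u2))),
        (E_minus (scal (RtoC (-1)) (minus (a2 u3) (a3 u3)))), !E_scal,
        (E_left u2 Hu2), (E_left u3 Hu3).
      rewrite !(ro_minus _ _ _ _ _ H1), !E_minus.
      unfold u2, u3. lin_ring V.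
    - apply tends_minus; [apply R1_tends, Hdiff, Hy|].
      apply E_tends, R1_tends, Hdiff, HR1d. }
  (* Both terms of the second limit reduce to R1 R1 d up to sign, by (a2 - a3) R1 x = R1 d and
     because [E] commutes with [R1]. *)
  assert (HE : E (plus K K) = zero).
  { rewrite (tends_unique _ _ _ Hlim1 Hlim2).
    replace (minus (a3 (R1 d)) (a2 (R1 d))) with (scal (RtoC (-1)) (minus (a2 (R1 d)) (a3 (R1 d))))
      by lin_ring V.
    replace (minus (a3 (R1 x)) (a2 (R1 x))) with (scal (RtoC (-1)) (minus (a2 (R1 x)) (a3 (R1 x))))
      by lin_ring V.
    rewrite (C1 x Hx). fold d.
    rewrite !(ro_scal _ _ _ _ H1), E_scal.
    rewrite E_R1, (E_left _ HR1d). lin_ring V. }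
  assert (HKK : plus K K = zero).
  { assert (EZ : E zero = zero).
    { transitivity (E (scal (RtoC 0) x)).
      - f_equal. lin_ring V.
      - rewrite E_scal. lin_ring V. }
    rewrite <- (E_right (plus K K)), HE. rewrite <- EZ at 1 2. apply E_right. }
  assert (HK0 : K = zero).
  { transitivity (scal (RtoC (/ 2)) (plus K K)).
    - rewrite <- (scal_inv_scal 2 K) at 1 by lra. apply f_equal.
      replace (RtoC 2) with (RtoC 1 + RtoC 1)%C; [lin_ring V|].
      rewrite <- RtoC_plus. apply f_equal. ring.
    - rewrite HKK. lin_ring V. }
  now apply minus_eq.
Qed.

End Commutation.

(** * Positive operators *)

Section Resolvents.
Context {V : NormedModule C_AbsRing}.
Implicit Types T : operator V.

Definition res T (l : C) (x : V) : V := op_app (resolvent T l) x.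

Lemma resolvent_iff T l x y : resolvent T l x y <-> exists z, T y z /\ x = plus (scal l y) z.
Proof.
  split.
  - intros [y1 [y2 [H1 [H2 H3]]]]. exists y2. split; [exact H2|]. now rewrite <- H1.
  - intros [z [H1 H2]]. now exists (scal l y), z.
Qed.

Lemma resolvent_set_iff T l : resolvent_set (op_opp T) l <-> bounded_operator (resolvent T l).
Proof.
  unfold resolvent_set, invertible, resolvent.
  replace (op_sub (op_scalar l) (op_opp T)) with (op_add (op_scalar l) T); [reflexivity|].
  apply functional_extensionality; intros x. apply functional_extensionality; intros z.
  apply propositional_extensionality. split.
  - intros [y1 [y2 [H1 [H2 H3]]]]. exists y1, y2. repeat split; trivial.
    exists (opp y2). split; [now exists y2|]. now rewrite opp_opp.
  - intros [y1 [y2 [H1 [[y3 [[y4 [H2 H4]] H5]] H3]]]]. exists y1, y2. repeat split; trivial.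
    rewrite H5, H4, opp_opp. exact H2.
Qed.

Lemma op_app_spec T x : op_dom T x -> T x (op_app T x).
Proof. intros H. exact (epsilon_spec (inhabits zero) (T x) H). Qed.

Lemma linear_unique T x y y' : linear_operator T -> T x y -> T x y' -> y = y'.
Proof. intros [_ [_ [_ H]]]. apply H. Qed.

Lemma op_app_eq T x y : linear_operator T -> T x y -> op_app T x = y.
Proof.
  intros HT H. apply (linear_unique T x); [exact HT| |exact H].
  apply (op_app_spec T x). now exists y.
Qed.

Definition regular T l : Prop := bounded_operator (resolvent T l).

Lemma res_spec T l x : regular T l -> resolvent T l x (res T l x).
Proof. intros [_ [H _]]. exact (op_app_spec (resolvent T l) x (H x)). Qed.

Lemma res_eq T l x y : regular T l -> resolvent T l x y -> res T l x = y.
Proof. intros [H _]. now apply op_app_eq. Qed.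

Lemma res_dom T l x : regular T l -> exists z, T (res T l x) z /\ x = plus (scal l (res T l x)) z.
Proof. intros H. now apply resolvent_iff, res_spec. Qed.

Lemma res_plus T l x y : regular T l -> res T l (plus x y) = plus (res T l x) (res T l y).
Proof.
  intros H. apply res_eq; [exact H|].
  apply (proj1 (proj2 (proj1 H))); now apply res_spec.
Qed.

Lemma res_scal T l c x : regular T l -> res T l (scal c x) = scal c (res T l x).
Proof.
  intros H. apply res_eq; [exact H|].
  apply (proj1 (proj2 (proj2 (proj1 H)))). now apply res_spec.
Qed.

Lemma res_minus T l x y : regular T l -> res T l (minus x y) = minus (res T l x) (res T l y).
Proof.
  intros H. replace (minus x y) with (plus x (scal (RtoC (-1)) y)) by lin_ring V.
  rewrite res_plus, res_scal by exact H. lin_ring V.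
Qed.

Lemma res_left T l y z : regular T l -> T y z -> res T l (plus (scal l y) z) = y.
Proof. intros H Hy. apply res_eq; [exact H|]. apply resolvent_iff. now exists z. Qed.

(** Reads the equation at l as a perturbed equation at s; this drives the a priori bound and the
    Neumann series. *)
Lemma resolvent_shift T l s x y :
  resolvent T l x y <-> resolvent T s (minus x (scal (l - s)%C y)) y.
Proof.
  rewrite !resolvent_iff.
  split; intros [z [Hz E]]; exists z; split; trivial.
  - rewrite E. lin_ring V.
  - transitivity (plus (minus x (scal (l - s)%C y)) (scal (l - s)%C y)); [lin_ring V|].
    rewrite E. lin_ring V.
Qed.

Lemma linear_resolvent T l : linear_operator T ->
  resolvent T l zero zero
  /\ (forall x x' y y', resolvent T l x y -> resolvent T l x' y' ->
        resolvent T l (plus x x') (plus y y'))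
  /\ (forall (c : C) x y, resolvent T l x y -> resolvent T l (scal c x) (scal c y)).
Proof.
  intros [H0 [Hp [Hs _]]]. repeat split.
  - apply resolvent_iff. exists zero. split; [exact H0|]. lin_ring V.
  - intros x x' y y' H H'. apply resolvent_iff in H. apply resolvent_iff in H'.
    destruct H as [z [Hz E]], H' as [z' [Hz' E']]. apply resolvent_iff.
    exists (plus z z'). split; [now apply Hp|]. rewrite E, E'. lin_ring V.
  - intros c x y H. apply resolvent_iff in H. destruct H as [z [Hz E]]. apply resolvent_iff.
    exists (scal c z). split; [now apply Hs|]. rewrite E. lin_ring V.
Qed.

(** The estimate also yields single-valuedness, when applied to the pair (0, y - y'). *)
Lemma regular_intro T l K : linear_operator T -> (forall x, exists y, resolvent T l x y) ->
  (forall x y, resolvent T l x y -> norm y <= K * norm x) -> regular T l.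
Proof.
  intros HT Hex Hb. destruct (linear_resolvent T l HT) as [H0 [Hp Hs]].
  split; [|split; [exact Hex|now exists K]].
  split; [exact H0|]. split; [exact Hp|]. split; [exact Hs|].
  intros x y y' H H'.
  assert (Hd : resolvent T l zero (minus y y')).
  { replace (@zero V) with (plus x (scal (RtoC (-1)) x)) by lin_ring V.
    replace (minus y y') with (plus y (scal (RtoC (-1)) y')) by lin_ring V.
    apply Hp; [exact H|]. now apply Hs. }
  apply Hb in Hd. rewrite norm_zero, Rmult_0_r in Hd.
  apply minus_eq, norm_eq_zero. apply Rle_antisym; [exact Hd|apply norm_ge_0].
Qed.

Lemma regular_resolvent_of T l : linear_operator T -> regular T l ->
  resolvent_of (op_dom T) (op_app T) l (res T l).
Proof.
  intros HT H. constructor.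
  - intros x. destruct (res_dom T l x H) as [z [Hz _]]. now exists z.
  - intros x. destruct (res_dom T l x H) as [z [Hz E]].
    rewrite (op_app_eq T _ z HT Hz). now symmetry.
  - intros y Hy. apply res_left; [exact H|]. now apply (op_app_spec T y).
  - intros x y. now apply res_plus.
  - intros c x. now apply res_scal.
Qed.

(* The constant [3/5] lies above the [1/2] needed to cover the contour region, and below the
   [1] needed for the Neumann series at [s] to converge. *)
Definition res_region (M : R) (l : C) : Prop :=
  exists s, 0 <= s /\ M * Cmod (l - RtoC s) <= 3 / 5 * (1 + s).

Lemma positivity_regular T M s : positivity_constant T M -> 0 <= s -> regular T (RtoC s).
Proof. intros [_ [H _]] Hs. apply resolvent_set_iff. now apply H. Qed.

Lemma positivity_bound T M s x : linear_operator T -> positivity_constant T M -> 0 <= s ->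
  norm (res T (RtoC s) x) <= M / (1 + s) * norm x.
Proof.
  intros HT HM Hs. pose proof (proj1 HM) as HM1.
  assert (Hpos : forall r u, 0 < r -> (1 + r) * norm (res T (RtoC r) u) <= M * norm u).
  { intros r u Hr. apply (proj2 (proj2 HM) r Hr). apply res_spec.
    apply (positivity_regular T M); [exact HM|lra]. }
  assert (Hm : (1 + s) * norm (res T (RtoC s) x) <= M * norm x).
  (* [positivity_constant] bounds the resolvent for s > 0 only. At 0, the solution y is also the
     solution at a small r with right-hand side x + r y, and r tends to 0. *)
  { destruct (Req_dec s 0) as [->|Hs0]; [|apply Hpos; lra].
    pose proof (positivity_regular T M 0 HM (Rle_refl 0)) as H0.
    set (y := res T (RtoC 0) x).
    pose proof (norm_ge_0 y) as Hy. pose proof (norm_ge_0 x) as Hx.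
    rewrite Rplus_0_r, Rmult_1_l.
    apply le_epsilon. intros e He.
    set (r := e / (M * norm y + 1)).
    assert (HMy : 0 <= M * norm y) by (apply Rmult_le_pos; lra).
    assert (Hr : 0 < r) by (apply Rdiv_lt_0_compat; lra).
    assert (E : res T (RtoC r) (minus x (scal (RtoC 0 - RtoC r)%C y)) = y).
    { apply res_eq; [apply (positivity_regular T M); [exact HM|lra]|].
      apply resolvent_shift. now apply res_spec. }
    pose proof (Hpos r (minus x (scal (RtoC 0 - RtoC r)%C y)) Hr) as H. rewrite E in H.
    assert (Hn : norm (minus x (scal (RtoC 0 - RtoC r)%C y)) <= norm x + r * norm y).
    { apply Rle_trans with (1 := norm_minus_le _ _). apply Rplus_le_compat_l.
      apply Rle_trans with (1 := norm_scalC _ _).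
      rewrite <- RtoC_minus, Cmod_R, Rabs_left by lra. lra. }
    assert (Er : r * (M * norm y + 1) = e) by (unfold r; field; lra).
    assert (M * norm (minus x (scal (RtoC 0 - RtoC r)%C y)) <= M * (norm x + r * norm y))
      by (apply Rmult_le_compat_l; lra).
    assert (0 <= r * norm y) by (apply Rmult_le_pos; lra). nra. }
  apply Rmult_le_reg_l with (1 + s); [lra|].
  replace ((1 + s) * (M / (1 + s) * norm x)) with (M * norm x) by (field; lra). exact Hm.
Qed.

End Resolvents.

Section ResolventRegion.
Context {X : CompleteNormedModule C_AbsRing} (T : operator X) (M : R).
Hypothesis HT : linear_operator T.
Hypothesis HM : positivity_constant T M.

(** The perturbation contributes at most 3/5 of |y|, which is absorbed; 5/2 is 1 / (1 - 3/5). *)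
Lemma region_bound l s x y : 0 <= s -> M * Cmod (l - RtoC s) <= 3 / 5 * (1 + s) ->
  resolvent T l x y -> norm y <= 5 / 2 * (M / (1 + s)) * norm x.
Proof.
  intros Hs Hl Hy. pose proof (proj1 HM) as HM1.
  apply (resolvent_shift T l (RtoC s)) in Hy.
  pose proof (positivity_bound T M s (minus x (scal (l - RtoC s)%C y)) HT HM Hs) as Hb.
  rewrite (res_eq (V := X) T (RtoC s) _ y (positivity_regular T M s HM Hs) Hy) in Hb.
  set (n := norm y) in *. set (c := Cmod (l - RtoC s)) in *.
  assert (Hn : norm (minus x (scal (l - RtoC s)%C y)) <= norm x + c * n).
  { apply Rle_trans with (1 := norm_minus_le (V := X) _ _). apply Rplus_le_compat_l.
    apply (norm_scalC (V := X)). }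
  assert (H1 : M / (1 + s) * c <= 3 / 5).
  { apply Rmult_le_reg_r with (1 + s); [lra|].
    replace (M / (1 + s) * c * (1 + s)) with (M * c) by (field; lra). exact Hl. }
  assert (H2 : 0 < M / (1 + s)) by (apply Rdiv_lt_0_compat; lra).
  assert (H3 : 0 <= n) by apply (norm_ge_0 (V := X)).
  assert (H4 : n <= M / (1 + s) * (norm x + c * n)).
  { apply Rle_trans with (1 := Hb). apply Rmult_le_compat_l; [lra|exact Hn]. }
  assert (H5 : M / (1 + s) * c * n <= 3 / 5 * n) by (apply Rmult_le_compat_r; lra).
  lra.
Qed.

(* Neumann series. *)
Lemma region_exists l s x : 0 <= s -> M * Cmod (l - RtoC s) <= 3 / 5 * (1 + s) ->
  exists y, resolvent T l x y.
Proof.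
  intros Hs Hl. pose proof (proj1 HM) as HM1.
  pose proof (positivity_regular T M s HM Hs) as Hreg.
  set (Q := res T (RtoC s)). set (k := (- (l - RtoC s))%C).
  set (d := fix d (n : nat) : X := match n with O => Q x | S n' => scal k (Q (d n')) end).
  assert (Hk : forall u, norm (scal k (Q u)) <= 3 / 5 * norm u).
  { intros u. apply Rle_trans with (1 := norm_scalC (V := X) _ _).
    unfold k. rewrite Cmod_opp.
    pose proof (positivity_bound T M s u HT HM Hs) as Hb. fold Q in Hb.
    apply Rle_trans with (Cmod (l - RtoC s) * (M / (1 + s) * norm u)).
    - apply Rmult_le_compat_l; [apply Cmod_ge_0|exact Hb].
    - rewrite <- Rmult_assoc. apply Rmult_le_compat_r; [apply (norm_ge_0 (V := X))|].
      apply Rmult_le_reg_r with (1 + s); [lra|].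
      replace (Cmod (l - RtoC s) * (M / (1 + s)) * (1 + s)) with (M * Cmod (l - RtoC s))
        by (field; lra). exact Hl. }
  assert (Hd : forall n, norm (d n) <= norm (Q x) * (3 / 5) ^ n).
  { induction n as [|n IH]; [simpl; lra|].
    apply Rle_trans with (1 := Hk (d n)). simpl. lra. }
  assert (Hser : ex_series d).
  { apply (ex_series_le (K := C_AbsRing) (V := X) d (fun n => norm (Q x) * (3 / 5) ^ n) Hd).
    apply (ex_series_scal_l (K := R_AbsRing) (norm (Q x)) (fun n => (3 / 5) ^ n)).
    apply ex_series_geom. rewrite Rabs_pos_eq; lra. }
  destruct Hser as [y Hy].
  assert (Hsum : forall n, sum_n d (S n) = plus (Q x) (scal k (Q (sum_n d n)))).
  { induction n as [|n IH].
    - rewrite sum_Sn, !sum_O. reflexivity.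
    - rewrite (sum_Sn d (S n)). rewrite IH at 1. rewrite (sum_Sn d n).
      assert (EQ : Q (plus (sum_n d n) (d (S n))) = plus (Q (sum_n d n)) (Q (d (S n))))
        by (apply (res_plus (V := X)); exact Hreg).
      transitivity (plus (Q x) (scal k (plus (Q (sum_n d n)) (Q (d (S n)))))); [|now rewrite <- EQ].
      change (d (S (S n))) with (scal k (Q (d (S n)))). lin_ring X. }
  assert (Ht : tends eventually (fun n => sum_n d n) y).
  { apply (tends_filterlim (V := X)). exact Hy. }
  assert (Ht2 : tends eventually (fun n => sum_n d (S n)) y).
  { intros eps Heps. destruct (Ht eps Heps) as [N HN]. exists N. intros n Hn. apply HN. lia. }
  assert (Ht3 : tends eventually (fun n => sum_n d (S n)) (plus (Q x) (scal k (Q y)))).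
  { apply (tends_ext_all (V := X)) with (fun n => plus (Q x) (scal k (Q (sum_n d n)))).
    { intros n. symmetry. apply Hsum. }
    apply (tends_plus (V := X)); [apply tends_const|].
    apply (tends_linear (V := X) (W := X) (fun u => scal k (Q u)) (3 / 5)); [|exact Hk|exact Ht].
    intros u v. unfold Q. rewrite (res_minus (V := X)) by exact Hreg. lin_ring X. }
  pose proof (tends_unique (V := X) _ _ _ Ht2 Ht3) as E.
  exists y. apply (resolvent_shift T l (RtoC s)).
  (* The sum of the series solves this fixed-point equation, which is the shifted resolvent
     equation. *)
  assert (E2 : y = Q (minus x (scal (l - RtoC s)%C y))).
  { rewrite E at 1. unfold Q, k. rewrite (res_minus (V := X)), (res_scal (V := X)) by exact Hreg.
    lin_ring X. }
  pose proof (res_spec (V := X) T (RtoC s) (minus x (scal (l - RtoC s)%C y)) Hreg) as Hres.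
  fold Q in Hres. rewrite <- E2 in Hres. exact Hres.
Qed.

Lemma region_regular l : res_region M l -> regular T l.
Proof.
  intros [s [Hs Hl]]. apply (regular_intro (V := X)) with (5 / 2 * (M / (1 + s))); [exact HT| |].
  - intros x. now apply (region_exists l s).
  - intros x y Hy. now apply (region_bound l s).
Qed.

Lemma positive_resolvent_family :
  resolvent_family (res_region M) (res T) (4 * M).
Proof.
  pose proof (proj1 HM) as HM1.
  constructor.
  - lra.
  - intros r Hr. exists r. split; [exact Hr|].
    replace (RtoC r - RtoC r)%C with (RtoC 0) by ring. rewrite Cmod_0. lra.
  (* Scaling the centre along with the point works because t (1 + s) <= 1 + t s for t <= 1. *)
  - intros l t [s [Hs Hl]] Ht. exists (t * s). split; [apply Rmult_le_pos; lra|].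
    replace (RtoC t * l - RtoC (t * s))%C with (RtoC t * (l - RtoC s))%C
      by (rewrite RtoC_mult; ring).
    rewrite Cmod_mult, Cmod_R, Rabs_pos_eq by lra.
    replace (M * (t * Cmod (l - RtoC s))) with (t * (M * Cmod (l - RtoC s))) by ring.
    apply Rle_trans with (t * (3 / 5 * (1 + s))); [apply Rmult_le_compat_l; lra|]. lra.
  - intros l x y Hl. apply (res_plus (V := X)), region_regular, Hl.
  - intros l c x Hl. apply (res_scal (V := X)), region_regular, Hl.
  (* In the region 1 + |l| <= 8/5 (1 + s), and 5/2 times 8/5 is the 4 in the constant. *)
  - intros l x Hl. pose proof (res_spec (V := X) T l x (region_regular l Hl)) as Hy.
    destruct Hl as [s [Hs Hl]].
    apply Rle_trans with (1 := region_bound l s x _ Hs Hl Hy).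
    apply Rmult_le_compat_r; [apply (norm_ge_0 (V := X))|].
    pose proof (Cmod_ge_0 l) as Hl0. pose proof (Cmod_ge_0 (l - RtoC s)) as Hls0.
    assert (H1 : Cmod l <= Cmod (l - RtoC s) + s).
    { replace l with ((l - RtoC s) + RtoC s)%C at 1 by ring.
      apply Rle_trans with (1 := Cmod_triangle _ _). rewrite Cmod_R, (Rabs_pos_eq s); lra. }
    assert (H2 : Cmod (l - RtoC s) <= 3 / 5 * (1 + s)) by nra.
    apply Rmult_le_reg_r with ((1 + s) * (1 + Cmod l)); [apply Rmult_lt_0_compat; lra|].
    replace (5 / 2 * (M / (1 + s)) * ((1 + s) * (1 + Cmod l))) with (5 / 2 * M * (1 + Cmod l))
      by (field; lra).
    replace (4 * M / (1 + Cmod l) * ((1 + s) * (1 + Cmod l))) with (4 * M * (1 + s))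
      by (field; lra).
    nra.
  - intros l m x Hl Hm.
    pose proof (region_regular l Hl) as Rl. pose proof (region_regular m Hm) as Rm.
    set (w := res T m x).
    destruct (res_dom (V := X) T m x Rm) as [z [Hz Ez]]. fold w in Hz, Ez.
    assert (E : res T l x = plus w (scal (m - l)%C (res T l w))).
    { apply (f_equal (res T l)) in Ez.
      transitivity (res T l (plus (plus (scal l w) z) (scal (m - l)%C w))).
      - rewrite Ez. apply f_equal. lin_ring X.
      - rewrite (res_plus (V := X)), (res_scal (V := X)), (res_left (V := X)) by assumption.
        reflexivity. }
    rewrite E. lin_ring X.
Qed.

(** On the domain s R(s) y - y = - R(s) T y, which is O(1/s). The uniform bound M on s R(s) extends
    the limit to the closure of the domain. *)
Lemma scaled_resolvent_lim z : densely_defined T ->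
  tends (Rbar_locally p_infty) (fun s => scal (RtoC s) (res T (RtoC s) z)) z.
Proof.
  intros Hden eps Heps. pose proof (proj1 HM) as HM1.
  assert (He : 0 < eps / (3 * (M + 1))) by (apply Rdiv_lt_0_compat; lra).
  set (nf := @norm_factor C_AbsRing X).
  assert (Hnf : 0 < nf) by apply norm_factor_gt_0.
  destruct (Hden z (mkposreal _ (Rdiv_lt_0_compat _ _ He Hnf))) as [y [[w Hy] Hball]].
  apply (norm_compat2 (V := X)) in Hball. simpl in Hball. fold nf in Hball.
  replace (nf * (eps / (3 * (M + 1)) / nf)) with (eps / (3 * (M + 1))) in Hball by (field; lra).
  exists (3 * M * (norm w + 1) / eps). intros s Hs.
  pose proof (norm_ge_0 (V := X) w) as Hw.
  assert (Hs0 : 0 < s).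
  { apply Rle_lt_trans with (2 := Hs). apply Rmult_le_pos; [nra|].
    left. now apply Rinv_0_lt_compat. }
  pose proof (positivity_regular T M s HM (Rlt_le _ _ Hs0)) as Hreg.
  pose proof (positivity_bound T M s w HT HM (Rlt_le _ _ Hs0)) as Hbw.
  pose proof (positivity_bound T M s (minus z y) HT HM (Rlt_le _ _ Hs0)) as Hbz.
  pose proof (res_left (V := X) T (RtoC s) y w Hreg Hy) as El.
  rewrite (res_plus (V := X)), (res_scal (V := X)) in El by exact Hreg.
  set (Q := res T (RtoC s)) in *.
  assert (E : minus (scal (RtoC s) (Q z)) z
    = plus (plus (scal (RtoC s) (Q (minus z y))) (opp (Q w))) (minus y z)).
  { assert (Ew : Q w = minus y (scal (RtoC s) (Q y))).
    { transitivity (minus (plus (scal (RtoC s) (Q y)) (Q w)) (scal (RtoC s) (Q y))); [lin_ring X|].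
      apply (f_equal (fun u => minus u (scal (RtoC s) (Q y)))). exact El. }
    rewrite Ew. unfold Q. rewrite (res_minus (V := X)) by exact Hreg. lin_ring X. }
  assert (Hzy : norm (minus z y) < eps / (3 * (M + 1))) by (rewrite (norm_minus_sym (V := X)); exact Hball).
  assert (E3 : eps / (3 * (M + 1)) * (M + 1) = eps / 3) by (field; lra).
  assert (HA : norm (scal (RtoC s) (Q (minus z y))) <= M * norm (minus z y)).
  { apply Rle_trans with (1 := norm_scalR (V := X) _ _). rewrite Rabs_pos_eq by lra.
    apply Rle_trans with (s * (M / (1 + s) * norm (minus z y))).
    - apply Rmult_le_compat_l; [lra|exact Hbz].
    - rewrite <- Rmult_assoc. apply Rmult_le_compat_r; [apply (norm_ge_0 (V := X))|].
      apply Rmult_le_reg_r with (1 + s); [lra|].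
      replace (s * (M / (1 + s)) * (1 + s)) with (M * s) by (field; lra). nra. }
  assert (HB : norm (Q w) < eps / 3).
  { apply Rle_lt_trans with (1 := Hbw).
    apply Rmult_lt_reg_r with (1 + s); [lra|].
    replace (M / (1 + s) * norm w * (1 + s)) with (M * norm w) by (field; lra).
    apply (Rmult_lt_compat_r (eps / 3)) in Hs; [|lra].
    replace (3 * M * (norm w + 1) / eps * (eps / 3)) with (M * (norm w + 1)) in Hs by (field; lra).
    lra. }
  apply Rle_lt_trans with (norm (plus (plus (scal (RtoC s) (Q (minus z y))) (opp (Q w))) (minus y z))).
  { right. apply (f_equal (norm (V := X))). exact E. }
  apply Rle_lt_trans with (1 := norm_plus_le (V := X) _ _).
  pose proof (norm_plus_le (V := X) (scal (RtoC s) (Q (minus z y))) (opp (Q w))) as HAB.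
  rewrite (norm_opp (V := X)) in HAB.
  pose proof (norm_ge_0 (V := X) (minus z y)) as Hn0.
  assert (HC : norm (minus y z) < eps / (3 * (M + 1))) by exact Hball.
  apply Rle_lt_trans with (M * (eps / (3 * (M + 1))) + eps / 3 + eps / (3 * (M + 1))); [|lra].
  apply Rplus_le_compat; [|left; exact HC].
  apply Rle_trans with (1 := HAB). apply Rplus_le_compat; [|left; exact HB].
  apply Rle_trans with (1 := HA). apply Rmult_le_compat_l; [lra|left; exact Hzy].
Qed.

End ResolventRegion.

(** * Admissible contours, and the fractional powers of one operator *)

Lemma admissible_angle M psi : 1 <= M -> 0 < psi < asin (1 / (2 * M)) ->
  psi < PI / 4 /\ sin psi < 1 / (2 * M) /\ 5 / 6 <= cos psi.
Proof.
  intros HM Hpsi.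
  assert (Hq : 0 < 1 / (2 * M) <= / 2).
  { split; [apply Rdiv_lt_0_compat; lra|].
    unfold Rdiv. rewrite Rmult_1_l. apply Rinv_le_contravar; lra. }
  pose proof (asin_bound (1 / (2 * M))) as Hb. pose proof PI_RGT_0.
  assert (Hs : sin psi < 1 / (2 * M)).
  { rewrite <- (sin_asin (1 / (2 * M))) by lra. apply sin_increasing_1; lra. }
  assert (Hs0 : 0 < sin psi) by (apply sin_gt_0; lra).
  (* Since sin psi < 1/2. The value 5/6 is chosen to match the region: 3/5 times 5/6 is the bound
     1/2 on M sin psi. *)
  assert (Hc : 5 / 6 <= cos psi).
  { assert (Hc0 : 0 <= cos psi) by (apply cos_ge_0; lra).
    pose proof (sin2_cos2 psi) as E. unfold Rsqr in E. nra. }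
  repeat split; trivial.
  apply Rnot_le_lt. intros H4.
  assert (H1 : sin (PI / 4) <= sin psi) by (apply sin_incr_1; lra).
  assert (H2 : cos psi <= cos (PI / 4)) by (apply cos_decr_1; lra).
  rewrite cos_PI4 in H2. rewrite sin_PI4 in H1. lra.
Qed.

(** A point of the sector is compared with its real part, a point of the disc with 0. *)
Lemma contour_region_subset M psi r0 z : 1 <= M ->
  0 < psi < asin (1 / (2 * M)) -> 0 < r0 < 1 / (2 * M) ->
  contour_region psi r0 z -> res_region M z.
Proof.
  intros HM Hpsi Hr0 [[Ha|Hb] Hz].
  - destruct (admissible_angle M psi HM Hpsi) as [H4 [Hs Hc]].
    assert (Hz0 : z <> RtoC 0) by (intros E; apply Hz; rewrite E; simpl; lra).
    pose proof (proj1 (Cmod_gt_0 z) Hz0) as Hm.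
    pose proof (polar_form z Hz0) as Ep. pose proof PI_RGT_0.
    assert (ER : Re z = Cmod z * cos (Carg z)).
    { rewrite Ep at 1. unfold Ccis; simpl. ring. }
    assert (EI : Im z = Cmod z * sin (Carg z)).
    { rewrite Ep at 1. unfold Ccis; simpl. ring. }
    assert (Hcc : cos psi <= cos (Carg z)).
    { replace (cos (Carg z)) with (cos (Rabs (Carg z))).
      - apply cos_decr_1; try lra; pose proof (Rabs_pos (Carg z)); lra.
      - unfold Rabs. destruct Rcase_abs; [apply cos_neg|reflexivity]. }
    assert (Hss : Rabs (sin (Carg z)) <= sin psi).
    { apply Rabs_le_between in Ha. apply Rabs_le_between. split.
      - rewrite <- sin_neg. apply sin_incr_1; lra.
      - apply sin_incr_1; lra. }
    exists (Re z). split; [nra|].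
    replace (z - RtoC (Re z))%C with (RtoC (Im z) * Ci)%C.
    2:{ apply injective_projections; simpl; unfold Re, Im; ring. }
    rewrite Cmod_mult, Cmod_R.
    replace (Cmod Ci) with 1.
    2:{ unfold Cmod, Ci; simpl. replace (_ + _) with 1 by ring. now rewrite sqrt_1. }
    rewrite Rmult_1_r, EI, Rabs_mult, (Rabs_pos_eq (Cmod z)) by lra.
    assert (Hms : M * sin psi <= / 2).
    { apply Rmult_le_reg_l with (/ M); [apply Rinv_0_lt_compat; lra|].
      rewrite <- Rmult_assoc, Rinv_l, Rmult_1_l by lra.
      replace (/ M * / 2) with (1 / (2 * M)) by (field; lra). lra. }
    pose proof (Rabs_pos (sin (Carg z))).
    assert (H5 : M * (Cmod z * Rabs (sin (Carg z))) <= Cmod z * / 2).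
    { apply Rle_trans with (Cmod z * (M * sin psi)); [|apply Rmult_le_compat_l; lra].
      replace (M * (Cmod z * Rabs (sin (Carg z)))) with (Cmod z * (M * Rabs (sin (Carg z)))) by ring.
      apply Rmult_le_compat_l; [lra|]. apply Rmult_le_compat_l; lra. }
    assert (H6 : Cmod z * (5 / 6) <= Re z) by (rewrite ER; apply Rmult_le_compat_l; lra).
    lra.
  - exists 0. split; [lra|]. replace (z - RtoC 0)%C with z by ring.
    assert (M * r0 <= / 2); [|pose proof (Cmod_ge_0 z); nra].
    apply Rmult_le_reg_l with (/ M); [apply Rinv_0_lt_compat; lra|].
    rewrite <- Rmult_assoc, Rinv_l, Rmult_1_l by lra.
    replace (/ M * / 2) with (1 / (2 * M)) by (field; lra). lra.
Qed.

Lemma is_contour_integral_unique {V : NormedModule C_AbsRing} g dg (f : C -> V) u v :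
  is_contour_integral g dg f u -> is_contour_integral g dg f v -> u = v.
Proof.
  intros Hu Hv.
  apply (@filterlimi_locally_unique _ R_AbsRing (restrict_scalars V)
    (filter_prod (Rbar_locally m_infty) (Rbar_locally p_infty)) _
    (fun ab : R * R => is_RInt (V := restrict_scalars V) (fun t => scal (dg t) (f (g t))) (fst ab) (snd ab))
    u v); [|exact Hu|exact Hv].
  apply filter_forall. intros [a b] y1 y2 H1 H2.
  exact (@filterlim_locally_unique _ R_AbsRing (restrict_scalars V) _
    (Proper_StrongProper _ (Riemann_fine_filter a b)) _ _ _ H1 H2).
Qed.

(** If y = c x, the assumed integrals verify the definition for every contour. Conversely, one
    concrete contour determines y; it is built with half the limiting angle and half the limiting
    radius. *)
Lemma neg_power_iff_of_integral {V : NormedModule C_AbsRing} (T : operator V) a (c : V -> V) :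
  positive_operator T ->
  (forall M psi r0 g dg x, positivity_constant T M -> 0 < psi < asin (1 / (2 * M)) ->
     0 < r0 < 1 / (2 * M) -> contour psi r0 g dg ->
     is_contour_integral g dg
       (fun l => scal (Cpower (Copp l) (- a)) (op_app (resolvent T l) x))
       (scal (RtoC (2 * PI) * Ci)%C (c x))) ->
  forall x y, neg_power T a x y <-> y = c x.
Proof.
  intros HT Hint x y. pose proof PI_RGT_0 as HPI.
  assert (Hinv : forall u : V, scal (Cinv (RtoC (2 * PI) * Ci)%C) (scal (RtoC (2 * PI) * Ci)%C u) = u).
  { intros u. transitivity (scal (Cinv (RtoC (2 * PI) * Ci) * (RtoC (2 * PI) * Ci))%C u); [lin_ring V|].
    rewrite Cinv_l; [lin_ring V|].
    apply Cmult_neq_0.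
    - intros E. apply RtoC_inj in E. lra.
    - intros E. apply (f_equal Im) in E. simpl in E. lra. }
  split.
  - intros [_ H]. destruct HT as [_ [_ [_ [M HM]]]]. pose proof (proj1 HM) as HM1.
    assert (Hq : 0 < 1 / (2 * M) <= / 2).
    { split; [apply Rdiv_lt_0_compat; lra|].
      unfold Rdiv. rewrite Rmult_1_l. apply Rinv_le_contravar; lra. }
    assert (Hasin : 0 < asin (1 / (2 * M)) < PI).
    { pose proof (asin_bound (1 / (2 * M))) as Hab. split; [|lra].
      apply Rnot_le_lt. intros Hle.
      pose proof (sin_incr_1 (asin (1 / (2 * M))) 0 ltac:(lra) ltac:(lra) ltac:(lra) ltac:(lra) Hle).
      rewrite sin_asin, sin_0 in H0 by lra. lra. }
    set (psi := asin (1 / (2 * M)) / 2). set (r0 := 1 / (2 * M) / 2).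
    assert (Hpsi : 0 < psi < asin (1 / (2 * M))) by (unfold psi; lra).
    assert (Hr0 : 0 < r0 < 1 / (2 * M)) by (unfold r0; lra).
    destruct (admissible_angle M psi HM1 Hpsi) as [H4 _].
    destruct (contour_exists psi r0 ltac:(lra) (proj1 Hr0)) as [g [dg Hg]].
    destruct (H M psi r0 g dg HM Hpsi Hr0 Hg) as [v [Hv ->]].
    rewrite (is_contour_integral_unique _ _ _ _ _ Hv (Hint M psi r0 g dg x HM Hpsi Hr0 Hg)).
    apply Hinv.
  - intros ->. split; [exact HT|]. intros M psi r0 g dg HM Hpsi Hr0 Hg.
    exists (scal (RtoC (2 * PI) * Ci)%C (c x)). split; [now apply (Hint M psi r0)|].
    symmetry. apply Hinv.
Qed.

(** The factor is 2 i sin(b pi) / (2 pi i) with b = 1 - a, so this is the real-line formula for the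
    power, as sin(b pi) = sin(a pi). *)
Definition frac_neg {X : CompleteNormedModule C_AbsRing} (T : operator X) (a : R) (x : X) : X :=
  scal (RtoC (sin ((1 - a) * PI) / PI)) (frac_int (res T) (1 - a) x).

Section OneOperator.
Context {X : CompleteNormedModule C_AbsRing} (T : operator X) (a : R).
Hypothesis HT : positive_operator T.
Hypothesis Ha : 0 < a < 1.

Let Hb : 0 < 1 - a < 1.
Proof. lra. Qed.

Lemma sin_coef_neq0 : RtoC (sin ((1 - a) * PI) / PI) <> RtoC 0.
Proof.
  pose proof PI_RGT_0. intros E. apply RtoC_inj in E.
  assert (0 < sin ((1 - a) * PI) / PI); [|lra].
  apply Rdiv_lt_0_compat; [|lra]. apply sin_gt_0; nra.
Qed.

Lemma frac_neg_integral M psi r0 g dg x :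
  linear_operator T -> positivity_constant T M -> 0 < psi < asin (1 / (2 * M)) ->
  0 < r0 < 1 / (2 * M) -> contour psi r0 g dg ->
  is_contour_integral g dg (fun l => scal (Cpower (Copp l) (- a)) (res T l x))
    (scal (RtoC (2 * PI) * Ci)%C (frac_neg T a x)).
Proof.
  intros HL HM Hpsi Hr0 Hg. pose proof (proj1 HM) as HM1. pose proof PI_RGT_0.
  destruct (admissible_angle M psi HM1 Hpsi) as [H4 _].
  pose proof (contour_integral_frac_int (positive_resolvent_family T M HL HM) (1 - a) Hb
    psi r0 g dg x ltac:(lra) (proj1 Hr0)
    (fun z => contour_region_subset M psi r0 z HM1 Hpsi Hr0) Hg) as H1.
  replace (1 - a - 1) with (- a) in H1 by ring.
  replace (scal (RtoC (2 * PI) * Ci)%C (frac_neg T a x)) with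
    (scal (RtoC (2 * sin ((1 - a) * PI)) * Ci)%C (frac_int (res T) (1 - a) x)); [exact H1|].
  unfold frac_neg.
  replace (RtoC (2 * sin ((1 - a) * PI))) with (RtoC (2 * PI) * RtoC (sin ((1 - a) * PI) / PI))%C.
  - lin_eq_in X ltac:(ring).
  - rewrite <- RtoC_mult. apply f_equal. field. lra.
Qed.

Lemma neg_power_iff x y : neg_power T a x y <-> y = frac_neg T a x.
Proof.
  apply neg_power_iff_of_integral; [exact HT|].
  intros M psi r0 g dg u HM Hpsi Hr0 Hg. destruct HT as [HL _].
  now apply (frac_neg_integral M psi r0).
Qed.

Lemma positive_family : exists M, resolvent_family (res_region M) (res T) (4 * M).
Proof.
  destruct HT as [HL [_ [_ [M HM]]]]. exists M. now apply positive_resolvent_family.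
Qed.

Lemma frac_neg_plus x y : frac_neg T a (plus x y) = plus (frac_neg T a x) (frac_neg T a y).
Proof.
  destruct positive_family as [M HR]. unfold frac_neg.
  rewrite (frac_int_plus HR _ Hb). lin_ring X.
Qed.

Lemma frac_neg_scal c x : frac_neg T a (scal c x) = scal c (frac_neg T a x).
Proof.
  destruct positive_family as [M HR]. unfold frac_neg.
  rewrite (frac_int_scal HR _ Hb). lin_ring X.
Qed.

Lemma frac_neg_minus x y : frac_neg T a (minus x y) = minus (frac_neg T a x) (frac_neg T a y).
Proof.
  destruct positive_family as [M HR]. unfold frac_neg.
  rewrite (frac_int_minus HR _ Hb). lin_ring X.
Qed.

Lemma frac_neg_bound : exists k, 0 <= k /\ forall x, norm (frac_neg T a x) <= k * norm x.
Proof.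
  destruct positive_family as [M HR].
  destruct (frac_int_bound HR _ Hb) as [KI [HKI [HI _]]].
  exists (Cmod (RtoC (sin ((1 - a) * PI) / PI)) * KI). split.
  - apply Rmult_le_pos; [apply Cmod_ge_0|exact HKI].
  - intros x. apply Rle_trans with (1 := norm_scalC (V := X) _ _).
    rewrite Rmult_assoc. apply Rmult_le_compat_l; [apply Cmod_ge_0|apply HI].
Qed.

Lemma regular_0 : regular T (RtoC 0).
Proof.
  destruct HT as [_ [_ [_ [M HM]]]]. apply (positivity_regular T M 0 HM). lra.
Qed.

Lemma res_0_injective x : res T (RtoC 0) x = zero -> x = zero.
Proof.
  intros E. destruct (res_dom (V := X) T _ x regular_0) as [z [Hz Ez]].
  rewrite E in Hz, Ez. destruct HT as [HL _].
  rewrite (linear_unique (V := X) T zero z zero HL Hz (proj1 HL)) in Ez. rewrite Ez. lin_ring X.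
Qed.

(** The product formula is used with the integral of this power as the inner factor: if it kills u,
    then k A^-1 u = 0. *)
Lemma frac_neg_injective x y : frac_neg T a x = frac_neg T a y -> x = y.
Proof.
  intros E. apply (minus_eq (V := X)). set (u := minus x y).
  assert (E0 : frac_neg T a u = zero).
  { unfold u. rewrite frac_neg_minus, E. lin_ring X. }
  destruct positive_family as [M HR].
  assert (EI : frac_int (res T) (1 - a) u = zero).
  { unfold frac_neg in E0. set (c := RtoC (sin ((1 - a) * PI) / PI)) in *.
    transitivity (scal (/ c)%C (scal c (frac_int (res T) (1 - a) u))).
    - transitivity (scal (/ c * c)%C (frac_int (res T) (1 - a) u)); [|lin_ring X].
      rewrite Cinv_l by apply sin_coef_neq0. lin_ring X.
    - rewrite E0. lin_ring X. }
  pose proof (frac_int_product HR u a (1 - a) Ha Hb ltac:(ring)) as Ep.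
  rewrite EI in Ep.
  set (k := frac_int (X := C_CompleteNormedModule) Cres a _) in Ep.
  assert (Hk : k <> RtoC 0) by now apply frac_int_Cres_product_neq0.
  assert (E1 : frac_int (res T) a zero = zero).
  { transitivity (frac_int (res T) a (scal (RtoC 0) u)); [f_equal; lin_ring X|].
    rewrite (frac_int_scal HR _ Ha). lin_ring X. }
  rewrite E1 in Ep. change (u = zero). apply res_0_injective.
  transitivity (scal (/ k)%C (scal k (res T (RtoC 0) u))).
  - transitivity (scal (/ k * k)%C (res T (RtoC 0) u)); [|lin_ring X].
    rewrite Cinv_l by exact Hk. lin_ring X.
  - transitivity (scal (/ k)%C (@zero X)); [|lin_ring X].
    apply (f_equal (scal (/ k)%C)). symmetry. exact Ep.
Qed.

(** Here the integral of this power is the outer factor, so that k A^-1 z is exhibited as one of its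
    values. *)
Lemma dom_in_range y : op_dom T y -> exists x, frac_neg T a x = y.
Proof.
  intros [z Hz]. destruct positive_family as [M HR].
  assert (Ey : y = res T (RtoC 0) z).
  { pose proof (res_left (V := X) T (RtoC 0) y z regular_0 Hz) as E. rewrite <- E at 1.
    f_equal. lin_ring X. }
  pose proof (frac_int_product HR z (1 - a) a Hb Ha ltac:(ring)) as Ep.
  set (k := frac_int (X := C_CompleteNormedModule) Cres (1 - a) _) in Ep.
  assert (Hk : k <> RtoC 0) by now apply frac_int_Cres_product_neq0.
  set (c := RtoC (sin ((1 - a) * PI) / PI)).
  exists (scal (/ (c * k))%C (frac_int (res T) a z)).
  rewrite frac_neg_scal. unfold frac_neg. fold c.
  rewrite Ep, Ey.
  transitivity (scal (/ (c * k) * (c * k))%C (res T (RtoC 0) z)); [lin_ring X|].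
  rewrite Cinv_l; [lin_ring X|]. apply Cmult_neq_0; [apply sin_coef_neq0|exact Hk].
Qed.

(** Commutation on the ray [0, oo) is enough, since every truncation integrates resolvents at real
    points only. *)
Lemma frac_neg_commute (L : X -> X) KL x :
  (forall u v, L (minus u v) = minus (L u) (L v)) ->
  (forall c u, L (scal c u) = scal c (L u)) ->
  (forall u, norm (L u) <= KL * norm u) ->
  (forall s u, 0 <= s -> L (res T (RtoC s) u) = res T (RtoC s) (L u)) ->
  L (frac_neg T a x) = frac_neg T a (L x).
Proof.
  intros H1 H2 H3 HL. destruct positive_family as [M HR]. unfold frac_neg. rewrite H2.
  apply f_equal. symmetry. apply (frac_int_unique HR _ Hb).
  apply (tends_ext (V := X)) with (fun r => L (frac_prim (res T) (1 - a) (RtoC r) x)).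
  - apply filter_imp with (2 := Rbar_locally_ge). intros r Hr. unfold frac_prim. rewrite H2.
    apply f_equal. apply (frac_mean_linear HR (1 - a) (proj1 Hb) L KL); trivial.
    + now apply (rf_ray _ _ _ HR).
    + intros t Ht. rewrite <- RtoC_mult. apply HL. apply Rmult_le_pos; lra.
  - apply (tends_linear (V := X) (W := X) L KL); trivial.
    apply (frac_int_spec HR _ Hb).
Qed.

End OneOperator.

(** * The operator matrix *)

Section PairNorm.
Context {U V : NormedModule C_AbsRing}.

Lemma norm_pair (u : U) (v : V) :
  norm ((u, v) : prod_NormedModule C_AbsRing U V) = sqrt (norm u ^ 2 + norm v ^ 2).
Proof. reflexivity. Qed.

Lemma norm_fst_le (u : U) (v : V) : norm u <= norm ((u, v) : prod_NormedModule C_AbsRing U V).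
Proof.
  rewrite norm_pair. rewrite <- (sqrt_pow2 (norm u)) at 1 by apply norm_ge_0.
  apply sqrt_le_1_alt. pose proof (pow2_ge_0 (norm v)). lra.
Qed.

Lemma norm_snd_le (u : U) (v : V) : norm v <= norm ((u, v) : prod_NormedModule C_AbsRing U V).
Proof.
  rewrite norm_pair. rewrite <- (sqrt_pow2 (norm v)) at 1 by apply norm_ge_0.
  apply sqrt_le_1_alt. pose proof (pow2_ge_0 (norm u)). lra.
Qed.

Lemma norm_pair_le (u : U) (v : V) :
  norm ((u, v) : prod_NormedModule C_AbsRing U V) <= norm u + norm v.
Proof.
  rewrite norm_pair. pose proof (norm_ge_0 u). pose proof (norm_ge_0 v).
  rewrite <- (sqrt_pow2 (norm u + norm v)) by lra.
  apply sqrt_le_1_alt. nra.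
Qed.

Lemma is_contour_integral_pair g dg (f : C -> U) (h : C -> V) u v :
  is_contour_integral g dg f u -> is_contour_integral g dg h v ->
  is_contour_integral (X := prod_NormedModule C_AbsRing U V) g dg
    (fun l => (f l, h l)) (u, v).
Proof.
  intros Hf Hh P [eps HP].
  assert (Hu : locally (u : restrict_scalars U) (ball u eps)) by apply locally_ball.
  assert (Hv : locally (v : restrict_scalars V) (ball v eps)) by apply locally_ball.
  pose proof (Hf _ Hu) as H1. pose proof (Hh _ Hv) as H2.
  unfold filtermapi in *.
  apply filter_imp with (2 := filter_and _ _ H1 H2).
  intros ab [[y1 [I1 B1]] [y2 [I2 B2]]]. exists (y1, y2). split.
  - exact (is_RInt_fct_extend_pair (U := restrict_scalars U) (V := restrict_scalars V)
      (fun t => (scal (dg t) (f (g t)), scal (dg t) (h (g t)))) (fst ab) (snd ab) y1 y2 I1 I2).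
  - apply HP. now split.
Qed.

End PairNorm.

Lemma is_contour_integral_plus {V : NormedModule C_AbsRing} g dg (f h : C -> V) u v :
  is_contour_integral g dg f u -> is_contour_integral g dg h v ->
  is_contour_integral g dg (fun l => plus (f l) (h l)) (plus u v).
Proof.
  intros Hf Hh.
  pose proof (is_RInt_gen_plus (V := restrict_scalars V) _ _ _ _ Hf Hh) as H.
  apply (is_RInt_gen_ext (V := restrict_scalars V)) with (2 := H).
  apply filter_forall. intros ab t _.
  change (plus (scal (dg t) (f (g t))) (scal (dg t) (h (g t)))
    = scal (dg t) (plus (f (g t)) (h (g t)))). lin_ring V.
Qed.

Lemma is_contour_integral_minus {V : NormedModule C_AbsRing} g dg (f h : C -> V) u v :
  is_contour_integral g dg f u -> is_contour_integral g dg h v ->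
  is_contour_integral g dg (fun l => minus (f l) (h l)) (minus u v).
Proof.
  intros Hf Hh.
  pose proof (is_RInt_gen_minus (V := restrict_scalars V) _ _ _ _ Hf Hh) as H.
  apply (is_RInt_gen_ext (V := restrict_scalars V)) with (2 := H).
  apply filter_forall. intros ab t _.
  change (minus (scal (dg t) (f (g t))) (scal (dg t) (h (g t)))
    = scal (dg t) (minus (f (g t)) (h (g t)))). lin_ring V.
Qed.

Lemma is_contour_integral_ext {V : NormedModule C_AbsRing} g dg (f h : C -> V) u :
  (forall t, f (g t) = h (g t)) ->
  is_contour_integral g dg f u -> is_contour_integral g dg h u.
Proof.
  intros E H. apply (is_RInt_gen_ext (V := restrict_scalars V)) with (2 := H).
  apply filter_forall. intros ab t _. now rewrite E.
Qed.

(** The graph is the zero set of x - B y. As [closed] is stated by a double negation, it is shown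
    that a positive gap at a point persists on a ball around it. *)
Lemma closed_of_bounded_inverse {V : NormedModule C_AbsRing} (T : operator V) (B : V -> V) K :
  (forall x y, T x y <-> x = B y) -> (forall x y, B (minus x y) = minus (B x) (B y)) ->
  (forall x, norm (B x) <= K * norm x) -> closed_operator T.
Proof.
  intros HT HB HK [x y] Hn. apply HT. simpl.
  apply norm_small_eq. intros eps Heps. apply Rnot_lt_le. intros Hlt. apply Hn.
  set (nf := @norm_factor C_AbsRing V). assert (Hnf : 0 < nf) by apply norm_factor_gt_0.
  assert (HKp : 0 < 1 + Rabs K) by (pose proof (Rabs_pos K); lra).
  assert (He : 0 < eps / (1 + Rabs K) / nf) by (repeat apply Rdiv_lt_0_compat; lra).
  exists (mkposreal _ He). intros [x' y'] [B1 B2] HT'. simpl in HT'.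
  apply HT in HT'.
  apply (norm_compat2 (V := V) x x' (mkposreal _ He)) in B1.
  apply (norm_compat2 (V := V) y y' (mkposreal _ He)) in B2.
  simpl in B1, B2. fold nf in B1, B2.
  replace (nf * (eps / (1 + Rabs K) / nf)) with (eps / (1 + Rabs K)) in B1, B2 by (field; lra).
  apply (Rlt_irrefl eps). apply Rlt_le_trans with (1 := Hlt).
  apply Rle_trans with (norm (minus (B (minus y' y)) (minus x' x))).
  { right. apply f_equal. rewrite HB, <- HT'. lin_ring V. }
  apply Rle_trans with (1 := norm_minus_le _ _).
  specialize (HK (minus y' y)). pose proof (Rle_abs K).
  pose proof (norm_ge_0 (minus y' y)).
  replace eps with (Rabs K * (eps / (1 + Rabs K)) + eps / (1 + Rabs K)) by (field; lra).
  apply Rplus_le_compat; [|lra].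
  apply Rle_trans with (1 := HK).
  apply Rle_trans with (Rabs K * norm (minus y' y)); [apply Rmult_le_compat_r; lra|].
  apply Rmult_le_compat_l; [apply Rabs_pos|lra].
Qed.

Lemma op_sub_iff {V : NormedModule C_AbsRing} (S T : operator V) x z :
  op_sub S T x z <-> exists u v, S x u /\ T x v /\ z = minus u v.
Proof.
  split.
  - intros [y1 [y2 [H1 [[y3 [H2 H3]] H4]]]]. exists y1, y3. repeat split; trivial.
    now rewrite H4, H3.
  - intros [u [v [H1 [H2 H3]]]]. exists u, (opp v). repeat split; trivial. now exists v.
Qed.

Section Main.
Context {X : CompleteNormedModule C_AbsRing} (A : index3 -> operator X) (X1 : X -> Prop).
Hypothesis A_pos : forall i, positive_operator (A i).
Hypothesis A_dom : forall i x, op_dom (A i) x <-> X1 x.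
Hypothesis A_sub : forall i j k, i <> j -> j <> k -> i <> k ->
       invertible (op_sub (A i) (A j))
       /\ commutes_with_resolvent (op_sub (A i) (A j)) (A k).

Let ap i := op_app (A i).
Let inv_sub i j := op_app (op_inv (op_sub (A i) (A j))).

Lemma A_linear i : linear_operator (A i).
Proof. exact (proj1 (A_pos i)). Qed.

Lemma A_app i x : X1 x -> A i x (ap i x).
Proof. intros Hx. apply (op_app_spec (A i) x). now apply A_dom. Qed.

Lemma A_app_eq i x y : A i x y -> ap i x = y.
Proof. apply op_app_eq, A_linear. Qed.

Lemma A_in_dom i x y : A i x y -> X1 x.
Proof. intros H. apply (A_dom i). now exists y. Qed.

Lemma A_resolvent_of i l : regular (A i) l -> resolvent_of X1 (ap i) l (res (A i) l).
Proof.
  intros H. pose proof (regular_resolvent_of (A i) l (A_linear i) H) as Hr.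
  replace X1 with (op_dom (A i)); [exact Hr|].
  apply functional_extensionality; intros x. apply propositional_extensionality, A_dom.
Qed.

Lemma sub_iff i j x z : op_sub (A i) (A j) x z <-> X1 x /\ z = minus (ap i x) (ap j x).
Proof.
  rewrite op_sub_iff. split.
  - intros [u [v [H1 [H2 H3]]]]. split; [now apply (A_in_dom i x u)|].
    now rewrite (A_app_eq i x u H1), (A_app_eq j x v H2).
  - intros [Hx E]. exists (ap i x), (ap j x). repeat split; trivial; now apply A_app.
Qed.

Lemma sub_commute i j k l y : i <> j -> j <> k -> i <> k -> regular (A k) l -> X1 y ->
  minus (ap i (res (A k) l y)) (ap j (res (A k) l y)) = res (A k) l (minus (ap i y) (ap j y)).
Proof.
  intros Hij Hjk Hik Hreg Hy.
  destruct (A_sub i j k Hij Hjk Hik) as [_ Hc].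
  destruct (Hc l (proj2 (resolvent_set_iff (A k) l) Hreg) y
    (res (A k) l (minus (ap i y) (ap j y)))) as [w [Hw1 Hw2]].
  - exists (minus (ap i y) (ap j y)). split.
    + now apply sub_iff.
    + now apply res_spec.
  - apply (res_eq (V := X) (A k) l y w Hreg) in Hw1. subst w.
    apply sub_iff in Hw2. now symmetry.
Qed.

Section Difference.
Context (i j k : index3) (Hij : i <> j) (Hjk : j <> k) (Hik : i <> k).

Let Hinv : bounded_operator (op_inv (op_sub (A i) (A j))).
Proof. exact (proj1 (A_sub i j k Hij Hjk Hik)). Qed.

Lemma inv_sub_iff w y : op_inv (op_sub (A i) (A j)) w y <-> y = inv_sub i j w.
Proof.
  split.
  - intros H. symmetry. now apply op_app_eq; [apply Hinv|].
  - intros ->. exact (op_app_spec (op_inv (op_sub (A i) (A j))) w (proj1 (proj2 Hinv) w)).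
Qed.

Lemma inv_sub_dom w : X1 (inv_sub i j w).
Proof. pose proof (proj2 (inv_sub_iff w _) eq_refl) as H. now apply sub_iff in H. Qed.

Lemma inv_sub_right w : minus (ap i (inv_sub i j w)) (ap j (inv_sub i j w)) = w.
Proof.
  pose proof (proj2 (inv_sub_iff w _) eq_refl) as H. apply sub_iff in H. now symmetry.
Qed.

Lemma inv_sub_left y : X1 y -> inv_sub i j (minus (ap i y) (ap j y)) = y.
Proof. intros Hy. symmetry. apply inv_sub_iff. now apply sub_iff. Qed.

Lemma inv_sub_plus x y : inv_sub i j (plus x y) = plus (inv_sub i j x) (inv_sub i j y).
Proof.
  symmetry. apply inv_sub_iff. apply (proj1 (proj2 (proj1 Hinv))); now apply inv_sub_iff.
Qed.

Lemma inv_sub_scal c x : inv_sub i j (scal c x) = scal c (inv_sub i j x).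
Proof.
  symmetry. apply inv_sub_iff. apply (proj1 (proj2 (proj2 (proj1 Hinv)))). now apply inv_sub_iff.
Qed.

Lemma inv_sub_minus x y : inv_sub i j (minus x y) = minus (inv_sub i j x) (inv_sub i j y).
Proof.
  replace (minus x y) with (plus x (scal (RtoC (-1)) y)) by lin_ring X.
  rewrite inv_sub_plus, inv_sub_scal. lin_ring X.
Qed.

Lemma inv_sub_bound : exists KE, forall x, norm (inv_sub i j x) <= KE * norm x.
Proof.
  destruct (proj2 (proj2 Hinv)) as [KE HKE]. exists KE. intros x. apply HKE. now apply inv_sub_iff.
Qed.

End Difference.

Lemma A_regular_pos i s : 0 <= s -> regular (A i) (RtoC s).
Proof.
  intros Hs. destruct (A_pos i) as [_ [_ [_ [M HM]]]]. now apply (positivity_regular (A i) M).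
Qed.

Lemma A_scaled_lim i z :
  tends (Rbar_locally p_infty) (fun s => scal (RtoC s) (res (A i) (RtoC s) z)) z.
Proof.
  destruct (A_pos i) as [HL [_ [Hd [M HM]]]]. now apply (scaled_resolvent_lim (A i) M).
Qed.

Lemma app3_res1 l x : regular (A one3) l -> X1 x ->
  ap three3 (res (A one3) l x) = res (A one3) l (ap three3 x).
Proof.
  intros Hl Hx.
  destruct (inv_sub_bound two3 three3 one3 ltac:(easy) ltac:(easy) ltac:(easy)) as [KE HKE].
  destruct (proj2 (proj2 Hl)) as [KR HKR].
  apply (commutator_zero (V := X) X1 (ap one3) (ap two3) (ap three3) l (res (A one3) l)
    (fun s => res (A two3) (RtoC s)) (fun s => res (A three3) (RtoC s))
    (inv_sub two3 three3) KE) with (KR := KR); try exact Hx; try exact HKE.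
  - now apply A_resolvent_of.
  - intros s Hs. now apply A_resolvent_of, A_regular_pos.
  - intros s Hs. now apply A_resolvent_of, A_regular_pos.
  - intros y Hy. now apply sub_commute.
  - intros s y Hs Hy. apply sub_commute; try easy. now apply A_regular_pos.
  - intros s y Hs Hy. apply sub_commute; try easy. now apply A_regular_pos.
  - intros w. now apply (inv_sub_dom two3 three3 one3).
  - intros w. now apply (inv_sub_right two3 three3 one3).
  - intros y Hy. now apply (inv_sub_left two3 three3 one3).
  - intros u v. now apply (inv_sub_plus two3 three3 one3).
  - intros c u. now apply (inv_sub_scal two3 three3 one3).
  - intros u. apply HKR. now apply res_spec.
  - intros z. apply A_scaled_lim.
  - intros z. apply A_scaled_lim.
Qed.

Lemma res1_res3 l m x : regular (A one3) l -> regular (A three3) m ->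
  res (A three3) m (res (A one3) l x) = res (A one3) l (res (A three3) m x).
Proof.
  intros Hl Hm.
  pose proof (A_resolvent_of three3 m Hm) as R3. pose proof (A_resolvent_of one3 l Hl) as R1.
  assert (H3 : X1 (res (A three3) m x)) by apply (ro_dom _ _ _ _ R3).
  assert (H1 : X1 (res (A one3) l (res (A three3) m x))) by apply (ro_dom _ _ _ _ R1).
  rewrite <- (ro_left _ _ _ _ R3 _ H1). f_equal.
  rewrite (app3_res1 l _ Hl H3).
  rewrite <- (ro_right _ _ _ _ R3 x) at 1.
  rewrite (ro_plus _ _ _ _ R1), (ro_scal _ _ _ _ R1). reflexivity.
Qed.

(** The mirror image of [app3_res1] needs no second limit: u is written as a resolvent value of A1
    at 0, and the resolvents already commute. *)
Lemma app1_res3 m u : regular (A three3) m -> X1 u ->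
  ap one3 (res (A three3) m u) = res (A three3) m (ap one3 u).
Proof.
  intros Hm Hu. pose proof (A_regular_pos one3 0 (Rle_refl 0)) as Hl.
  pose proof (A_resolvent_of three3 m Hm) as R3. pose proof (A_resolvent_of one3 _ Hl) as R1.
  set (v := ap one3 u).
  assert (Eu : u = res (A one3) (RtoC 0) v).
  { rewrite <- (ro_left _ _ _ _ R1 u Hu) at 1. fold v. f_equal. lin_ring X. }
  rewrite Eu, (res1_res3 _ _ _ Hl Hm).
  pose proof (ro_right _ _ _ _ R1 (res (A three3) m v)) as E.
  rewrite <- E at 2. lin_ring X.
Qed.

Let E13 := inv_sub one3 three3.

Lemma E13_facts : (forall w, X1 (E13 w))
  /\ (forall w, minus (ap one3 (E13 w)) (ap three3 (E13 w)) = w)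
  /\ (forall y, X1 y -> E13 (minus (ap one3 y) (ap three3 y)) = y).
Proof.
  repeat split; intros w.
  - now apply (inv_sub_dom one3 three3 two3).
  - now apply (inv_sub_right one3 three3 two3).
  - intros Hw. now apply (inv_sub_left one3 three3 two3).
Qed.

Lemma E13_res1 l w : regular (A one3) l -> E13 (res (A one3) l w) = res (A one3) l (E13 w).
Proof.
  intros Hl. destruct E13_facts as [Hd [Hr Hf]].
  pose proof (A_resolvent_of one3 l Hl) as R1.
  rewrite <- (Hr w) at 1. rewrite (ro_minus _ _ _ _ _ _ R1).
  rewrite <- (ro_commute _ _ _ _ _ R1) by apply Hd.
  rewrite <- (app3_res1 l _ Hl) by apply Hd.
  apply Hf, (ro_dom _ _ _ _ R1).
Qed.

Lemma E13_res3 m w : regular (A three3) m -> E13 (res (A three3) m w) = res (A three3) m (E13 w).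
Proof.
  intros Hm. destruct E13_facts as [Hd [Hr Hf]].
  pose proof (A_resolvent_of three3 m Hm) as R3.
  rewrite <- (Hr w) at 1. rewrite (ro_minus _ _ _ _ _ _ R3).
  rewrite <- (ro_commute _ _ _ _ _ R3) by apply Hd.
  rewrite <- (app1_res3 m _ Hm) by apply Hd.
  apply Hf, (ro_dom _ _ _ _ R3).
Qed.

(* [-R3 R1 = E13 (R1 - R3)], the resolvent form of the (3,1) entry. *)
Lemma res_entry31 l f : regular (A one3) l -> regular (A three3) l ->
  res (A three3) l (res (A one3) l f)
  = minus (res (A three3) l (E13 f)) (res (A one3) l (E13 f)).
Proof.
  intros Hl Hm. destruct E13_facts as [Hd [Hr Hf]].
  pose proof (A_resolvent_of three3 l Hm) as R3. pose proof (A_resolvent_of one3 l Hl) as R1.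
  set (u := E13 f). assert (Hu : X1 u) by apply Hd.
  pose proof (ro_left _ _ _ _ R1 u Hu) as E1.
  pose proof (ro_left _ _ _ _ R3 u Hu) as E3.
  rewrite <- (Hr f). fold u.
  assert (Q1 : ap one3 u = minus (plus (scal l u) (ap one3 u)) (scal l u)) by lin_ring X.
  assert (Q3 : ap three3 u = minus (plus (scal l u) (ap three3 u)) (scal l u)) by lin_ring X.
  rewrite Q1, Q3, !(ro_minus _ _ _ _ _ _ R1), E1.
  rewrite !(ro_minus _ _ _ _ _ _ R3), !(res1_res3 l l) by assumption.
  rewrite E3. lin_ring X.
Qed.

(** * Resolvent and positivity of the block matrix *)

Lemma Lambda_iff x1 x2 x3 y1 y2 y3 :
  Lambda3 A (x1, x2, x3) (y1, y2, y3) <->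
  A one3 x1 y1 /\ A two3 x2 y2 /\ exists z, A three3 x3 z /\ y3 = plus x1 z.
Proof.
  unfold Lambda3, op_matrix, op_row, op_zero, op_id, op_scalar. split.
  - intros [[p1 [p2 [p3 [P1 [P2 [P3 P4]]]]]] [[q1 [q2 [q3 [Q1 [Q2 [Q3 Q4]]]]]]
      [r1 [r2 [r3 [S1 [S2 [S3 S4]]]]]]]].
    subst. split; [|split].
    + replace (plus (plus p1 zero) zero) with p1 by lin_ring X. exact P1.
    + replace (plus (plus zero q2) zero) with q2 by lin_ring X. exact Q2.
    + exists r3. split; [exact S3|]. lin_ring X.
  - intros [H1 [H2 [z [H3 ->]]]]. split; [|split].
    + exists y1, zero, zero. repeat split; trivial. lin_ring X.
    + exists zero, y2, zero. repeat split; trivial. lin_ring X.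
    + exists x1, zero, z. repeat split; trivial; lin_ring X.
Qed.

Lemma Lambda_linear : linear_operator (Lambda3 A).
Proof.
  pose proof (A_linear one3) as [Z1 [P1 [S1 U1]]].
  pose proof (A_linear two3) as [Z2 [P2 [S2 U2]]].
  pose proof (A_linear three3) as [Z3 [P3 [S3 U3]]].
  split; [|split; [|split]].
  - apply (Lambda_iff zero zero zero zero zero zero). repeat split; trivial.
    exists zero. split; [exact Z3|]. lin_ring X.
  - intros [[x1 x2] x3] [[u1 u2] u3] [[y1 y2] y3] [[v1 v2] v3] H H'.
    apply Lambda_iff in H. apply Lambda_iff in H'.
    destruct H as [H1 [H2 [z [H3 E]]]], H' as [H1' [H2' [z' [H3' E']]]].
    apply (Lambda_iff (plus x1 u1) (plus x2 u2) (plus x3 u3) (plus y1 v1) (plus y2 v2) (plus y3 v3)).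
    split; [now apply P1|]. split; [now apply P2|].
    exists (plus z z'). split; [now apply P3|]. rewrite E, E'. lin_ring X.
  - intros c [[x1 x2] x3] [[y1 y2] y3] H. apply Lambda_iff in H.
    destruct H as [H1 [H2 [z [H3 E]]]].
    apply (Lambda_iff (scal c x1) (scal c x2) (scal c x3) (scal c y1) (scal c y2) (scal c y3)).
    split; [now apply S1|]. split; [now apply S2|].
    exists (scal c z). split; [now apply S3|]. rewrite E. lin_ring X.
  - intros [[x1 x2] x3] [[y1 y2] y3] [[v1 v2] v3] H H'.
    apply Lambda_iff in H. apply Lambda_iff in H'.
    destruct H as [H1 [H2 [z [H3 E]]]], H' as [H1' [H2' [z' [H3' E']]]].
    rewrite (U1 _ _ _ H1 H1'), (U2 _ _ _ H2 H2').
    rewrite (U3 _ _ _ H3 H3') in E. now rewrite E, E'.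
Qed.

(** Forward substitution in a lower triangular system. *)
Lemma Lambda_resolvent l f g h (y : cube X) : (forall i, regular (A i) l) ->
  resolvent (Lambda3 A) l (f, g, h) y <->
  y = (res (A one3) l f, res (A two3) l g,
       res (A three3) l (minus h (res (A one3) l f))).
Proof.
  intros Hreg. rewrite (resolvent_iff (V := cube X)). split.
  - destruct y as [[y1 y2] y3]. intros [[[z1 z2] z3] [Hz E]].
    apply Lambda_iff in Hz. destruct Hz as [H1 [H2 [z [H3 Ez]]]].
    change ((f, g, h) = (plus (scal l y1) z1, plus (scal l y2) z2, plus (scal l y3) z3)) in E.
    injection E as E1 E2 E3. subst f g h z3.
    rewrite (res_left (V := X) _ l y1 z1), (res_left (V := X) _ l y2 z2) by trivial.
    assert (E3 : res (A three3) l (minus (plus (scal l y3) (plus y1 z)) y1) = y3).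
    { transitivity (res (A three3) l (plus (scal l y3) z)); [|now apply (res_left (V := X))].
      apply f_equal. lin_ring X. }
    apply injective_projections; [reflexivity|]. symmetry. exact E3.
  - intros ->.
    destruct (res_dom (V := X) (A one3) l f (Hreg one3)) as [z1 [Hz1 E1]].
    destruct (res_dom (V := X) (A two3) l g (Hreg two3)) as [z2 [Hz2 E2]].
    destruct (res_dom (V := X) (A three3) l (minus h (res (A one3) l f)) (Hreg three3))
      as [z3 [Hz3 E3]].
    exists (z1, z2, plus (res (A one3) l f) z3). split.
    + apply Lambda_iff. repeat split; trivial. now exists z3.
    + set (u1 := res (A one3) l f) in *. set (u2 := res (A two3) l g) in *.
      set (u3 := res (A three3) l (minus h u1)) in *.
      change ((f, g, h) = (plus (scal l u1) z1, plus (scal l u2) z2, plus (scal l u3) (plus u1 z3))).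
      rewrite <- E1, <- E2. f_equal.
      transitivity (plus (minus h u1) u1); [lin_ring X|]. rewrite E3. lin_ring X.
Qed.

Lemma Lambda_res l f g h : (forall i, regular (A i) l) ->
  op_app (resolvent (Lambda3 A) l) (f, g, h)
  = (res (A one3) l f, res (A two3) l g, res (A three3) l (minus h (res (A one3) l f))).
Proof.
  intros Hreg. apply (Lambda_resolvent l f g h _ Hreg).
  apply (op_app_spec (V := cube X) (resolvent (Lambda3 A) l) (f, g, h)).
  eexists. now apply Lambda_resolvent.
Qed.

Lemma common_constant : exists M, forall i, positivity_constant (A i) M.
Proof.
  assert (H : forall i, exists M, positivity_constant (A i) M).
  { intros i. exact (proj2 (proj2 (proj2 (A_pos i)))). }
  destruct (H one3) as [M1 H1], (H two3) as [M2 H2], (H three3) as [M3 H3].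
  assert (Hmono : forall i M M', positivity_constant (A i) M -> M <= M' ->
    positivity_constant (A i) M').
  { intros i M M' [Ha [Hb Hc]] HM. split; [lra|]. split; [exact Hb|].
    intros s Hs x y Hy. apply Rle_trans with (1 := Hc s Hs x y Hy).
    apply Rmult_le_compat_r; [apply (norm_ge_0 (V := X))|exact HM]. }
  exists (Rmax M1 (Rmax M2 M3)). intros [ | | ].
  - apply Hmono with M1; [exact H1|apply Rmax_l].
  - apply Hmono with M2; [exact H2|]. eapply Rle_trans; [apply Rmax_l|apply Rmax_r].
  - apply Hmono with M3; [exact H3|]. eapply Rle_trans; [apply Rmax_r|apply Rmax_r].
Qed.

Lemma norm_triple_le (u v w : X) : norm ((u, v, w) : cube X) <= norm u + norm v + norm w.
Proof.
  apply Rle_trans with (1 := norm_pair_le (U := prod_NormedModule C_AbsRing X X) (V := X) (u, v) w).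
  apply Rplus_le_compat_r. apply norm_pair_le.
Qed.

Lemma norm_triple_ge (u v w : X) : norm u <= norm ((u, v, w) : cube X)
  /\ norm v <= norm ((u, v, w) : cube X) /\ norm w <= norm ((u, v, w) : cube X).
Proof.
  pose proof (norm_fst_le (U := prod_NormedModule C_AbsRing X X) (V := X) (u, v) w) as H.
  split; [|split].
  - apply Rle_trans with (2 := H). apply norm_fst_le.
  - apply Rle_trans with (2 := H). apply norm_snd_le.
  - apply (norm_snd_le (U := prod_NormedModule C_AbsRing X X) (V := X)).
Qed.

(** In 3 + M, each component contributes 1, and the coupling term of the third contributes M, since
    the resolvent of A1 has norm at most M. *)
Lemma Lambda_res_bound M s f g h : (forall i, positivity_constant (A i) M) -> 0 <= s ->
  norm ((res (A one3) (RtoC s) f, res (A two3) (RtoC s) g,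
         res (A three3) (RtoC s) (minus h (res (A one3) (RtoC s) f))) : cube X)
  <= M * (3 + M) / (1 + s) * norm ((f, g, h) : cube X).
Proof.
  intros HM Hs. pose proof (proj1 (HM one3)) as HM1.
  pose proof (fun i x => positivity_bound (A i) M s x (A_linear i) (HM i) Hs) as Hb.
  set (q := M / (1 + s)) in Hb.
  assert (Hq : 0 < q) by (apply Rdiv_lt_0_compat; lra).
  assert (HqM : q <= M).
  { unfold q. apply Rmult_le_reg_r with (1 + s); [lra|].
    unfold Rdiv. rewrite Rmult_assoc, Rinv_l by lra. nra. }
  set (u := res (A one3) (RtoC s) f).
  pose proof (Hb one3 f) as B1. pose proof (Hb two3 g) as B2.
  pose proof (Hb three3 (minus h u)) as B3. fold u in B1.
  destruct (norm_triple_ge f g h) as [Nf [Ng Nh]].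
  set (n := norm ((f, g, h) : cube X)) in *.
  pose proof (norm_minus_le (V := X) h u) as B4.
  pose proof (norm_ge_0 (V := X) f) as Pf.
  assert (Hu : norm u <= M * n).
  { apply Rle_trans with (1 := B1).
    exact (Rmult_le_compat _ _ _ _ (Rlt_le _ _ Hq) Pf HqM Nf). }
  apply Rle_trans with (1 := norm_triple_le _ _ _).
  replace (M * (3 + M) / (1 + s) * n) with (q * n + q * n + q * (n + M * n))
    by (unfold q, Rdiv; ring).
  apply Rplus_le_compat; [apply Rplus_le_compat|].
  - apply Rle_trans with (1 := B1). exact (Rmult_le_compat_l _ _ _ (Rlt_le _ _ Hq) Nf).
  - apply Rle_trans with (1 := B2). exact (Rmult_le_compat_l _ _ _ (Rlt_le _ _ Hq) Ng).
  - apply Rle_trans with (1 := B3). apply Rmult_le_compat_l; [lra|].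
    apply Rle_trans with (1 := B4). exact (Rplus_le_compat _ _ _ _ Nh Hu).
Qed.

Lemma Lambda_regular s : 0 <= s -> regular (V := cube X) (Lambda3 A) (RtoC s).
Proof.
  intros Hs. destruct common_constant as [M HM].
  assert (Hreg : forall i, regular (A i) (RtoC s)) by (intros i; now apply A_regular_pos).
  apply (regular_intro (V := cube X)) with (M * (3 + M) / (1 + s)); [exact Lambda_linear| |].
  - intros [[f g] h]. eexists. now apply Lambda_resolvent.
  - intros [[f g] h] y Hy. apply (Lambda_resolvent _ f g h y Hreg) in Hy. subst y.
    now apply Lambda_res_bound.
Qed.

Lemma Lambda_positive : positive_operator (Lambda3 A).
Proof.
  destruct common_constant as [M HM]. pose proof (proj1 (HM one3)) as HM1.
  split; [exact Lambda_linear|]. split; [|split].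
  - pose proof (Lambda_regular 0 (Rle_refl 0)) as H0.
    destruct (proj2 (proj2 H0)) as [K HK].
    apply (closed_of_bounded_inverse (V := cube X) (Lambda3 A) (res (Lambda3 A) (RtoC 0)) K).
    + intros x y. split.
      * intros H. rewrite <- (res_left (V := cube X) (Lambda3 A) (RtoC 0) x y H0 H).
        apply f_equal. lin_ring (cube X).
      * intros ->. destruct (res_dom (V := cube X) (Lambda3 A) (RtoC 0) y H0) as [z [Hz E]].
        replace y with z at 2; [exact Hz|]. rewrite E at 1. lin_ring (cube X).
    + intros x y. now apply (res_minus (V := cube X)).
    + intros x. apply HK. now apply (res_spec (V := cube X)).
  - intros [[x1 x2] x3] eps.
    assert (Hd : forall x : X, exists y, X1 y /\ ball x eps y).
    { intros x. destruct (proj1 (proj2 (proj2 (A_pos one3))) x eps) as [y [Hy Hb]].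
      exists y. split; [now apply (A_dom one3)|exact Hb]. }
    destruct (Hd x1) as [y1 [D1 B1]], (Hd x2) as [y2 [D2 B2]], (Hd x3) as [y3 [D3 B3]].
    exists (y1, y2, y3). split; [|now repeat split].
    exists (ap one3 y1, ap two3 y2, plus y1 (ap three3 y3)).
    apply Lambda_iff. split; [now apply A_app|]. split; [now apply A_app|].
    exists (ap three3 y3). split; [now apply A_app|reflexivity].
  - exists (M * (3 + M)). split; [nra|]. split.
    + intros s Hs. apply (resolvent_set_iff (V := cube X)). now apply Lambda_regular.
    + intros s Hs [[f g] h] y Hy.
      apply (Lambda_resolvent _ f g h y) in Hy; [|intros i; apply A_regular_pos; lra].
      subst y.
      apply Rle_trans with ((1 + s) * (M * (3 + M) / (1 + s) * norm ((f, g, h) : cube X))).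
      * apply Rmult_le_compat_l; [lra|]. apply Lambda_res_bound; [exact HM|lra].
      * right. assert (Q : forall n, (1 + s) * (M * (3 + M) / (1 + s) * n) = M * (3 + M) * n)
          by (intros n; field; lra).
        apply Q.
Qed.

(* The resolvents of the [A i] are compressions of the resolvent of the matrix. *)
Lemma Lambda_constant M i : positivity_constant (Lambda3 A) M -> positivity_constant (A i) M.
Proof.
  intros [HM [_ Hb]]. split; [exact HM|]. split.
  { intros s Hs. apply resolvent_set_iff. now apply A_regular_pos. }
  intros s Hs x y Hy.
  assert (Hreg : forall j, regular (A j) (RtoC s)) by (intros j; apply A_regular_pos; lra).
  apply (res_eq (V := X) (A i) (RtoC s) x y (Hreg i)) in Hy. subst y.
  assert (Hgen : forall f g h, norm f + norm g + norm h = norm x ->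
      norm (res (A i) (RtoC s) x) <= norm ((res (A one3) (RtoC s) f, res (A two3) (RtoC s) g,
         res (A three3) (RtoC s) (minus h (res (A one3) (RtoC s) f))) : cube X) ->
      (1 + s) * norm (res (A i) (RtoC s) x) <= M * norm x).
  { intros f g h Hn Hle. rewrite <- Hn.
    apply Rle_trans with (M * norm ((f, g, h) : cube X));
      [|apply Rmult_le_compat_l; [lra|]; apply norm_triple_le].
    eapply Rle_trans; [apply Rmult_le_compat_l; [lra|exact Hle]|].
    apply (Hb s Hs (f, g, h)). now apply Lambda_resolvent. }
  assert (Hn0 : norm (@zero X) = 0) by apply (norm_zero (V := X)).
  destruct i.
  - apply (Hgen x zero zero); [|apply norm_triple_ge].
    transitivity (norm x + 0 + 0); [|ring]. now apply f_equal2; [apply f_equal2|].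
  - apply (Hgen zero x zero); [|apply (proj1 (proj2 (norm_triple_ge _ _ _)))].
    transitivity (0 + norm x + 0); [|ring]. now apply f_equal2; [apply f_equal2|].
  - apply (Hgen zero zero x).
    { transitivity (0 + 0 + norm x); [|ring]. now apply f_equal2; [apply f_equal2|]. }
    eapply Rle_trans; [|apply (proj2 (proj2 (norm_triple_ge _ _ _)))].
    right. apply f_equal, f_equal.
    assert (E0 : res (A one3) (RtoC s) (@zero X) = zero).
    { transitivity (res (A one3) (RtoC s) (scal (RtoC 0) (@zero X))); [apply f_equal; lin_ring X|].
      etransitivity; [now apply (res_scal (V := X))|]. lin_ring X. }
    transitivity (minus x (@zero X)); [lin_ring X|]. exact (f_equal (minus x) (eq_sym E0)).
Qed.

(** * Fractional powers of the block matrix *)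

Context (alpha : R) (Halpha : 0 < alpha < 1).

Let I i := frac_neg (A i) alpha.

(** The difference inverse stands inside the powers because [res_entry31] produces it under the
    integral; [entry31_I] moves it outside. *)
Definition Lambda_frac (x : cube X) : cube X :=
  let '(f, g, h) := x in
  (I one3 f, I two3 g, plus (minus (I one3 (E13 f)) (I three3 (E13 f))) (I three3 h)).

Lemma Lambda_neg_power x y : neg_power (Lambda3 A) alpha x y <-> y = Lambda_frac x.
Proof.
  apply (neg_power_iff_of_integral (V := cube X)); [exact Lambda_positive|].
  intros M psi r0 g dg [[f1 f2] f3] HM Hpsi Hr0 Hg. pose proof (proj1 HM) as HM1.
  (* A contour is admissible for the matrix relative to a constant of the matrix; the same constant
     must serve each A i for the entrywise integrals to be available. *)
  assert (HMi : forall i, positivity_constant (A i) M) by (intros i; now apply Lambda_constant).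
  assert (Hreg : forall t i, regular (A i) (g t)).
  { intros t i. apply (region_regular (A i) M (A_linear i) (HMi i)).
    apply (contour_region_subset M psi r0); trivial. apply Hg. }
  pose proof (fun i x => frac_neg_integral (A i) alpha Halpha M psi r0 g dg x (A_linear i) (HMi i)
    Hpsi Hr0 Hg) as Hint.
  apply (is_contour_integral_ext (V := cube X)) with (f := fun l =>
    ((scal (Cpower (Copp l) (- alpha)) (res (A one3) l f1),
      scal (Cpower (Copp l) (- alpha)) (res (A two3) l f2)),
     plus (minus (scal (Cpower (Copp l) (- alpha)) (res (A one3) l (E13 f1)))
                 (scal (Cpower (Copp l) (- alpha)) (res (A three3) l (E13 f1))))
          (scal (Cpower (Copp l) (- alpha)) (res (A three3) l f3)))).
  { intros t. set (c := Cpower (- g t)%C (- alpha)).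
    transitivity (scal c ((res (A one3) (g t) f1, res (A two3) (g t) f2,
      res (A three3) (g t) (minus f3 (res (A one3) (g t) f1))) : cube X));
      [|exact (f_equal (scal c) (eq_sym (Lambda_res (g t) f1 f2 f3 (Hreg t))))].
    apply injective_projections; [reflexivity|].
    transitivity (scal c (minus (res (A three3) (g t) f3)
         (minus (res (A three3) (g t) (E13 f1)) (res (A one3) (g t) (E13 f1))))).
    - change (plus (minus (scal c (res (A one3) (g t) (E13 f1)))
          (scal c (res (A three3) (g t) (E13 f1)))) (scal c (res (A three3) (g t) f3))
        = scal c (minus (res (A three3) (g t) f3)
         (minus (res (A three3) (g t) (E13 f1)) (res (A one3) (g t) (E13 f1))))).
      lin_ring X.
    - apply (f_equal (scal c)). symmetry.
      rewrite <- res_entry31 by apply Hreg. apply (res_minus (V := X)), Hreg. }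
  set (k := (RtoC (2 * PI) * Ci)%C).
  assert (E : ((scal k (I one3 f1), scal k (I two3 f2)),
      plus (minus (scal k (I one3 (E13 f1))) (scal k (I three3 (E13 f1)))) (scal k (I three3 f3)))
    = scal k (Lambda_frac (f1, f2, f3))).
  { apply injective_projections; [reflexivity|].
    change (plus (minus (scal k (I one3 (E13 f1))) (scal k (I three3 (E13 f1)))) (scal k (I three3 f3))
      = scal k (plus (minus (I one3 (E13 f1)) (I three3 (E13 f1))) (I three3 f3))).
    lin_ring X. }
  refine (eq_rect _ (is_contour_integral (X := cube X) g dg _) _ _ E).
  apply (is_contour_integral_pair (U := prod_NormedModule C_AbsRing X X) (V := X)).
  - exact (is_contour_integral_pair (U := X) (V := X) g dg _ _ _ _ (Hint one3 f1) (Hint two3 f2)).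
  - exact (is_contour_integral_plus (V := X) g dg _ _ _ _
      (is_contour_integral_minus (V := X) g dg _ _ _ _ (Hint one3 (E13 f1)) (Hint three3 (E13 f1)))
      (Hint three3 f3)).
Qed.

Lemma I_E13 i x : i = one3 \/ i = three3 -> E13 (I i x) = I i (E13 x).
Proof.
  intros Hi. destruct (inv_sub_bound one3 three3 two3 ltac:(easy) ltac:(easy) ltac:(easy)) as [KE HKE].
  apply (frac_neg_commute (A i) alpha (A_pos i) Halpha E13 KE).
  - intros u v. now apply (inv_sub_minus one3 three3 two3).
  - intros c u. now apply (inv_sub_scal one3 three3 two3).
  - exact HKE.
  - intros s u Hs. destruct Hi as [-> | ->].
    + now apply E13_res1, A_regular_pos.
    + now apply E13_res3, A_regular_pos.
Qed.

Lemma entry31_I f : minus (I one3 (E13 f)) (I three3 (E13 f)) = E13 (minus (I one3 f) (I three3 f)).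
Proof.
  unfold E13. rewrite (inv_sub_minus one3 three3 two3) by easy. fold E13.
  rewrite !I_E13 by auto. reflexivity.
Qed.

(** The entry takes values in D(A3), hence in D(A3^alpha). So it does not disturb the third
    component, and the domain of the positive power is a product. *)
Lemma entry31_range f : exists k, I three3 k = minus (I one3 (E13 f)) (I three3 (E13 f)).
Proof.
  rewrite entry31_I. apply (dom_in_range (A three3) alpha (A_pos three3) Halpha).
  apply A_dom. now apply (inv_sub_dom one3 three3 two3).
Qed.

Lemma A_neg_power i x y : neg_power (A i) alpha x y <-> y = I i x.
Proof. exact (neg_power_iff (A i) alpha (A_pos i) Halpha x y). Qed.

Lemma Lambda_frac_bounded : bounded_operator (neg_power (Lambda3 A) alpha).
Proof.
  assert (HP : forall i x y, I i (plus x y) = plus (I i x) (I i y)).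
  { intros i x y. apply (frac_neg_plus (A i) alpha (A_pos i) Halpha). }
  assert (HS : forall i c x, I i (scal c x) = scal c (I i x)).
  { intros i c x. apply (frac_neg_scal (A i) alpha (A_pos i) Halpha). }
  assert (HEP : forall x y, E13 (plus x y) = plus (E13 x) (E13 y)).
  { intros x y. now apply (inv_sub_plus one3 three3 two3). }
  assert (HES : forall c x, E13 (scal c x) = scal c (E13 x)).
  { intros c x. now apply (inv_sub_scal one3 three3 two3). }
  assert (HLp : forall x y, Lambda_frac (plus x y) = plus (Lambda_frac x) (Lambda_frac y)).
  { intros [[f g] h] [[f' g'] h'].
    change ((I one3 (plus f f'), I two3 (plus g g'),
      plus (minus (I one3 (E13 (plus f f'))) (I three3 (E13 (plus f f')))) (I three3 (plus h h')))
      = (plus (I one3 f) (I one3 f'), plus (I two3 g) (I two3 g'),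
         plus (plus (minus (I one3 (E13 f)) (I three3 (E13 f))) (I three3 h))
              (plus (minus (I one3 (E13 f')) (I three3 (E13 f'))) (I three3 h')))).
    rewrite HEP, !HP. f_equal. lin_ring X. }
  assert (HLs : forall c x, Lambda_frac (scal c x) = scal c (Lambda_frac x)).
  { intros c [[f g] h].
    change ((I one3 (scal c f), I two3 (scal c g),
      plus (minus (I one3 (E13 (scal c f))) (I three3 (E13 (scal c f)))) (I three3 (scal c h)))
      = (scal c (I one3 f), scal c (I two3 g),
         scal c (plus (minus (I one3 (E13 f)) (I three3 (E13 f))) (I three3 h)))).
    rewrite HES, !HS. f_equal. lin_ring X. }
  split; [|split].
  - split; [|split; [|split]].
    + apply Lambda_neg_power.
      transitivity (scal (RtoC 0) (Lambda_frac zero)); [lin_ring (cube X)|].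
      rewrite <- HLs. apply f_equal. lin_ring (cube X).
    + intros x x' y y' H H'. apply Lambda_neg_power in H. apply Lambda_neg_power in H'.
      apply Lambda_neg_power. now rewrite HLp, H, H'.
    + intros c x y H. apply Lambda_neg_power in H. apply Lambda_neg_power. now rewrite HLs, H.
    + intros x y y' H H'. apply Lambda_neg_power in H. apply Lambda_neg_power in H'. now rewrite H, H'.
  - intros x. exists (Lambda_frac x). now apply Lambda_neg_power.
  - destruct (frac_neg_bound (A one3) alpha (A_pos one3) Halpha) as [k1 [K1 B1]].
    destruct (frac_neg_bound (A two3) alpha (A_pos two3) Halpha) as [k2 [K2 B2]].
    destruct (frac_neg_bound (A three3) alpha (A_pos three3) Halpha) as [k3 [K3 B3]].
    destruct (inv_sub_bound one3 three3 two3 ltac:(easy) ltac:(easy) ltac:(easy)) as [KE HKE].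
    pose proof (Rle_abs KE) as HKa. pose proof (Rabs_pos KE) as HKp.
    exists (k1 + k2 + ((k1 * Rabs KE + k3 * Rabs KE) + k3)).
    intros [[f g] h] y H. apply Lambda_neg_power in H. subst y.
    destruct (norm_triple_ge f g h) as [Nf [Ng Nh]].
    set (n := norm ((f, g, h) : cube X)) in *.
    pose proof (norm_ge_0 (V := X) f) as Pf.
    assert (HE : norm (E13 f) <= Rabs KE * n).
    { apply Rle_trans with (1 := HKE f). apply Rle_trans with (Rabs KE * norm f).
      - exact (Rmult_le_compat_r _ _ _ Pf HKa).
      - exact (Rmult_le_compat_l _ _ _ HKp Nf). }
    apply Rle_trans with (1 := norm_triple_le _ _ _).
    pose proof (norm_plus_le (V := X) (minus (I one3 (E13 f)) (I three3 (E13 f))) (I three3 h)) as T1.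
    pose proof (norm_minus_le (V := X) (I one3 (E13 f)) (I three3 (E13 f))) as T2.
    pose proof (Rle_trans _ _ _ (B1 f) (Rmult_le_compat_l _ _ _ K1 Nf)) as S1.
    pose proof (Rle_trans _ _ _ (B2 g) (Rmult_le_compat_l _ _ _ K2 Ng)) as S2.
    pose proof (Rle_trans _ _ _ (B3 h) (Rmult_le_compat_l _ _ _ K3 Nh)) as S3.
    pose proof (Rle_trans _ _ _ (B1 (E13 f)) (Rmult_le_compat_l _ _ _ K1 HE)) as S4.
    pose proof (Rle_trans _ _ _ (B3 (E13 f)) (Rmult_le_compat_l _ _ _ K3 HE)) as S5.
    assert (Q : k1 * n + k2 * n + (k1 * (Rabs KE * n) + k3 * (Rabs KE * n) + k3 * n)
      = (k1 + k2 + (k1 * Rabs KE + k3 * Rabs KE + k3)) * n) by ring.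
    refine (Rle_trans _ _ _ _ (Req_le _ _ Q)).
    apply Rplus_le_compat; [apply Rplus_le_compat; [exact S1|exact S2]|].
    apply Rle_trans with (1 := T1). apply Rplus_le_compat; [|exact S3].
    apply Rle_trans with (1 := T2). now apply Rplus_le_compat.
Qed.

End Main.

(** The natural domain of the matrix [Mp] asks its first component to lie in both D(A1^alpha) and
    D(A3^alpha). Hence the inclusion of [Mp] in the power, and the product form of the domain, are
    stated without further assumption, and equality under the convention that one set X^alpha is the
    domain of all three powers. *)
Theorem theorem3p17 (X : CompleteNormedModule C_AbsRing)
    (A : index3 -> operator X) (X1 : X -> Prop)
    (A_pos : forall i, positive_operator (A i))
    (A_dom : forall i x, op_dom (A i) x <-> X1 x)
    (A_sub : forall i j k, i <> j -> j <> k -> i <> k ->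
       invertible (op_sub (A i) (A j))
       /\ commutes_with_resolvent (op_sub (A i) (A j)) (A k))
    (alpha : R) (alpha_range : 0 < alpha < 1) :
  let D13inv := op_inv (op_sub (A one3) (A three3)) in
  let An := fun i => neg_power (A i) alpha in
  let Ap := fun i => frac_power (A i) alpha in
  let Mp := op_matrix
    (Ap one3) op_zero op_zero
    op_zero (Ap two3) op_zero
    (op_comp D13inv (op_sub (Ap one3) (Ap three3))) op_zero (Ap three3) in
  bounded_operator (neg_power (Lambda3 A) alpha)
  /\ op_eq (neg_power (Lambda3 A) alpha)
       (op_matrix
          (An one3) op_zero op_zero
          op_zero (An two3) op_zero
          (op_comp D13inv (op_sub (An one3) (An three3))) op_zero (An three3))
  /\ (forall u v w : X,
        op_dom (frac_power (Lambda3 A) alpha) (u, v, w)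
        <-> op_dom (Ap one3) u /\ op_dom (Ap two3) v /\ op_dom (Ap three3) w)
  /\ op_incl Mp (frac_power (Lambda3 A) alpha)
  /\ (forall Xa : X -> Prop,
        (forall i x, op_dom (Ap i) x <-> Xa x) ->
        op_eq (frac_power (Lambda3 A) alpha) Mp
        /\ forall u v w : X,
             op_dom (frac_power (Lambda3 A) alpha) (u, v, w)
             <-> Xa u /\ Xa v /\ Xa w).
Proof.
  intros D13inv An Ap Mp.
  set (I := fun i => frac_neg (A i) alpha).
  set (E := op_app D13inv).
  assert (HAn : forall i x y, An i x y <-> y = I i x).
  { intros i x y. apply (A_neg_power A A_pos alpha alpha_range). }
  assert (HAp : forall i x y, Ap i x y <-> x = I i y) by (intros i x y; apply HAn).
  assert (HD : forall w y, D13inv w y <-> y = E w).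
  { intros w y. now apply (inv_sub_iff A A_sub one3 three3 two3). }
  assert (HL : forall x y, neg_power (Lambda3 A) alpha x y <-> y = Lambda_frac A alpha x).
  { intros x y. exact (Lambda_neg_power A X1 A_pos A_dom A_sub alpha alpha_range x y). }
  assert (HE31 : forall f, minus (I one3 (E f)) (I three3 (E f)) = E (minus (I one3 f) (I three3 f))).
  { intros f. exact (entry31_I A X1 A_pos A_dom A_sub alpha alpha_range f). }
  assert (HI3E : forall f, E (I three3 f) = I three3 (E f)).
  { intros f. apply (I_E13 A X1 A_pos A_dom A_sub alpha alpha_range three3 f). now right. }
  assert (HIm : forall i x y, I i (minus x y) = minus (I i x) (I i y)).
  { intros i x y. apply (frac_neg_minus (A i) alpha (A_pos i) alpha_range). }
  assert (HIp : forall i x y, I i (plus x y) = plus (I i x) (I i y)).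
  { intros i x y. apply (frac_neg_plus (A i) alpha (A_pos i) alpha_range). }
  assert (HEm : forall x y, E (minus x y) = minus (E x) (E y)).
  { intros x y. now apply (inv_sub_minus A A_sub one3 three3 two3). }
  assert (Hinj : forall i x y, I i x = I i y -> x = y).
  { intros i x y. apply (frac_neg_injective (A i) alpha (A_pos i) alpha_range). }
  assert (HLe : forall f g h u v w, neg_power (Lambda3 A) alpha (f, g, h) (u, v, w) <->
     u = I one3 f /\ v = I two3 g /\ w = plus (E (minus (I one3 f) (I three3 f))) (I three3 h)).
  { intros f g h u v w. rewrite HL, <- HE31. split.
    - intros H. injection H as H1 H2 H3. now repeat split.
    - now intros [-> [-> ->]]. }
  assert (Hdom : forall u v w : X,
        op_dom (frac_power (Lambda3 A) alpha) (u, v, w)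
        <-> op_dom (Ap one3) u /\ op_dom (Ap two3) v /\ op_dom (Ap three3) w).
  { intros u v w. split.
    - intros [[[f g] h] H]. apply HLe in H. destruct H as [H1 [H2 H3]].
      split; [exists f; now apply HAp|]. split; [exists g; now apply HAp|].
      destruct (entry31_range A X1 A_pos A_dom A_sub alpha alpha_range f) as [k Hk].
      exists (plus k h). apply HAp. rewrite HIp, H3, <- HE31.
      apply (f_equal (fun z => plus z (I three3 h))). symmetry. exact Hk.
    - intros [[f Hf] [[g Hg] [h Hh]]]. apply HAp in Hf. apply HAp in Hg. apply HAp in Hh.
      destruct (entry31_range A X1 A_pos A_dom A_sub alpha alpha_range f) as [k Hk].
      (* The off-diagonal entry is A3^-alpha k, so subtracting k from the third component
         compensates for it. *)
      exists (f, g, minus h k). apply HLe. split; [exact Hf|]. split; [exact Hg|].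
      rewrite <- HE31, HIm, Hh.
      transitivity (plus (I three3 k) (minus (I three3 h) (I three3 k))); [lin_ring X|].
      apply (f_equal (fun z => plus z (minus (I three3 h) (I three3 k)))). exact Hk. }
  (* The separate witness [f3] records that u must also be in D(A3^alpha) for the lower left entry
     to be defined. *)
  assert (HMp : forall u v w f g h, Mp (u, v, w) (f, g, h) <->
     u = I one3 f /\ v = I two3 g /\
     exists f3 h3, u = I three3 f3 /\ w = I three3 h3 /\ h = plus (E (minus f f3)) h3).
  { intros u v w f g h. unfold Mp, op_matrix, op_row, op_zero. split.
    - intros [[p1 [p2 [p3 [P1 [P2 [P3 P4]]]]]] [[q1 [q2 [q3 [Q1 [Q2 [Q3 Q4]]]]]]
        [r1 [r2 [r3 [[z [S1 S1']] [S2 [S3 S4]]]]]]]].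
      apply HAp in P1. apply HAp in Q2. apply HAp in S3. apply HD in S1'.
      apply op_sub_iff in S1. destruct S1 as [f1 [f3 [T1 [T3 T4]]]].
      apply HAp in T1. apply HAp in T3. subst p2 p3 q1 q3 r2.
      assert (Ef : f = p1) by (rewrite P4; lin_ring X).
      assert (Eg : g = q2) by (rewrite Q4; lin_ring X).
      split; [now rewrite Ef|]. split; [now rewrite Eg|].
      exists f3, r3. split; [exact T3|]. split; [exact S3|].
      (* A1^alpha u occurs in two entries; injectivity of A1^-alpha identifies the two values. *)
      assert (E1 : f1 = f) by (apply (Hinj one3); now rewrite <- T1, P1, Ef).
      rewrite S4, S1', T4, E1. lin_ring X.
    - intros [H1 [H2 [f3 [h3 [H3 [H4 H5]]]]]]. split; [|split].
      + exists f, zero, zero. split; [now apply HAp|]. split; [easy|]. split; [easy|]. lin_ring X.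
      + exists zero, g, zero. split; [easy|]. split; [now apply HAp|]. split; [easy|]. lin_ring X.
      + exists (E (minus f f3)), zero, h3. split; [|split; [reflexivity|split; [now apply HAp|]]].
        * exists (minus f f3). split; [|now apply HD].
          apply op_sub_iff. exists f, f3. split; [now apply HAp|]. now split; [apply HAp|].
        * rewrite H5. lin_ring X. }
  assert (Hkey : forall f f3, I one3 f = I three3 f3 ->
     E (minus (I one3 f) (I three3 f)) = opp (I three3 (E (minus f f3)))).
  { intros f f3 H. rewrite H, <- HIm, HI3E, !HEm, !HIm. lin_ring X. }
  split; [exact (Lambda_frac_bounded A X1 A_pos A_dom A_sub alpha alpha_range)|].
  split; [|split; [exact Hdom|split]].
  - intros [[f g] h] [[u v] w]. rewrite HLe. unfold op_matrix, op_row, op_zero. split.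
    + intros [H1 [H2 H3]]. split; [|split].
      * exists u, zero, zero. split; [now apply HAn|]. split; [easy|]. split; [easy|]. lin_ring X.
      * exists zero, v, zero. split; [easy|]. split; [now apply HAn|]. split; [easy|]. lin_ring X.
      * exists (E (minus (I one3 f) (I three3 f))), zero, (I three3 h).
        split; [|split; [reflexivity|split; [now apply HAn|]]].
        -- exists (minus (I one3 f) (I three3 f)). split; [|now apply HD].
           apply op_sub_iff. exists (I one3 f), (I three3 f). split; [now apply HAn|]. now split; [apply HAn|].
        -- rewrite H3. lin_ring X.
    + intros [[p1 [p2 [p3 [P1 [P2 [P3 P4]]]]]] [[q1 [q2 [q3 [Q1 [Q2 [Q3 Q4]]]]]]
        [r1 [r2 [r3 [[z [S1 S1']] [S2 [S3 S4]]]]]]]].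
      apply HAn in P1. apply HAn in Q2. apply HAn in S3. apply HD in S1'.
      apply op_sub_iff in S1. destruct S1 as [f1 [f3 [T1 [T3 T4]]]].
      apply HAn in T1. apply HAn in T3. subst p2 p3 q1 q3 r2.
      split; [rewrite P4, P1; lin_ring X|]. split; [rewrite Q4, Q2; lin_ring X|].
      rewrite S4, S1', T4, T1, T3, S3.
      assert (PZ : forall x y : X, plus (plus x zero) y = plus x y) by (intros x y; lin_ring X).
      apply PZ.
  - intros [[u v] w] [[f g] h] H. apply HMp in H.
    destruct H as [H1 [H2 [f3 [h3 [H3 [H4 H5]]]]]].
    apply HLe. split; [exact H1|]. split; [exact H2|].
    rewrite (Hkey f f3) by now rewrite <- H1. rewrite H5, HIp, H4.
    assert (PC : forall x y : X, y = plus (opp x) (plus x y)) by (intros x y; lin_ring X).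
    apply PC.
  - intros Xa HXa. split; [|intros u v w; now rewrite Hdom, !HXa].
    intros [[u v] w] [[f g] h]. rewrite HMp. unfold frac_power, op_inv. rewrite HLe. split.
    + intros [H1 [H2 H3]]. split; [exact H1|]. split; [exact H2|].
      (* The common domain carries u from D(A1^alpha) to D(A3^alpha). *)
      assert (Hu : op_dom (Ap three3) u).
      { apply HXa, (HXa one3). exists f. now apply HAp. }
      destruct Hu as [f3 Hf3]. apply HAp in Hf3.
      (* The third component of the equation forces this value of A3^alpha w, namely h minus the
         off-diagonal contribution. *)
      exists f3, (minus h (E (minus f f3))). split; [exact Hf3|]. split.
      * rewrite H3, (Hkey f f3) by now rewrite <- H1. rewrite HIm.
        assert (PC : forall x y : X, plus (opp x) y = minus y x) by (intros x y; lin_ring X).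
        apply PC.
      * lin_ring X.
    + intros [H1 [H2 [f3 [h3 [H3 [H4 H5]]]]]]. split; [exact H1|]. split; [exact H2|].
      rewrite (Hkey f f3) by now rewrite <- H1. rewrite H5, HIp, H4.
    assert (PC : forall x y : X, y = plus (opp x) (plus x y)) by (intros x y; lin_ring X).
    apply PC.
Qed.
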